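(* Let $d\geq 2$ and let $k$ be a field of characteristic $p>2$. Let $R$ be a singular complete intersection local ring of characteristic $p$, of dimension $d$, with residue field $k$. Then $e_s(R)\geq e_s(R_d)$ for all real $s>0$, where $R_d=k[[x_0,\ldots,x_d]]/(x_0^2+\cdots+x_d^2)$.
   Context: Local rings are commutative and Noetherian; singular means not regular; a complete intersection local ring is one whose completion is a quotient of a regular local ring (here, a power series ring over a field) by a regular sequence. For a local ring $(R,\mathfrak m)$ of prime characteristic $p>0$ and dimension $d$, $\lambda$ denotes length and $I^{[p^e]}$ is the ideal generated by the $p^e$-th powers of the elements of $I$. For an $\mathfrak m$-primary ideal $I$ and real $s>0$ put $h_s(I)=\lim_{e\to\infty}\lambda\big(R/(I^{\lceil sp^e\rceil}+I^{[p^e]})\big)/p^{ed}$ (this limit exists), $\mathcal H_s(d)=\sum_{i=0}^{\lfloor s\rfloor}\frac{(-1)^i}{d!}\binom{d}{i}(s-i)^d$, $e_s(I)=h_s(I)/\mathcal H_s(d)$ and $e_s(R)=e_s(\mathfrak m)$. *)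

(* Defs.v *)
From HB Require Import structures.
From mathcomp Require Import all_boot all_order all_algebra.
From mathcomp Require Import boolp classical_sets.
From mathcomp Require mpoly.

Set Implicit Arguments.
Unset Strict Implicit.
Unset Printing Implicit Defensive.

Import Order.TTheory GRing.Theory Num.Theory.
Local Open Scope ring_scope.

(* k[[x_0, ..., x_(n-1)]]. [mpoly] is imported only inside this module, because
   its notations clash with those of MathComp-Analysis. *)
Module PowerSeries.
Import mpoly.

Record mpseries (n : nat) (K : Type) := MPSeries {
  mpscoef : 'X_{1..n} -> K
}.

Section Ring.
Variables (n : nat) (K : comNzRingType).
Implicit Types f g h : mpseries n K.

HB.instance Definition _ := gen_eqMixin (mpseries n K).
HB.instance Definition _ := gen_choiceMixin (mpseries n K).

Lemma mpseriesP f g : (forall m, mpscoef f m = mpscoef g m) -> f = g.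
Proof. by case: f g => [f] [g] /= fg; congr MPSeries; apply: funext. Qed.

Definition mps0 := @MPSeries n K (fun _ => 0).
Definition mps_opp f := MPSeries (fun m => - mpscoef f m).
Definition mps_add f g := MPSeries (fun m => mpscoef f m + mpscoef g m).
Definition mps1 := @MPSeries n K (fun m => (m == 0%MM)%:R).
(* Cauchy product; the degree bound on [ab] only serves to make the set of
   pairs (a, b) with a + b = m a finite type. *)
Definition mps_mul f g := MPSeries (fun m =>
  \sum_(ab : 'X_{1..n < (mdeg m).+1, (mdeg m).+1} | m == (ab.1 + ab.2)%MM)
    mpscoef f ab.1 * mpscoef g ab.2).

Fact mps_addA : associative mps_add.
Proof. by move=> f g h; apply: mpseriesP => m /=; rewrite addrA. Qed.
Fact mps_addC : commutative mps_add.
Proof. by move=> f g; apply: mpseriesP => m /=; rewrite addrC. Qed.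
Fact mps_add0 : left_id mps0 mps_add.
Proof. by move=> f; apply: mpseriesP => m /=; rewrite add0r. Qed.
Fact mps_addN : left_inverse mps0 mps_opp mps_add.
Proof. by move=> f; apply: mpseriesP => m /=; rewrite addNr. Qed.

HB.instance Definition _ :=
  GRing.isZmodule.Build (mpseries n K) mps_addA mps_addC mps_add0 mps_addN.

Local Definition mps_trunc b f : {mpoly K[n]} :=
  \sum_(m : 'X_{1..n < b}) mpscoef f m *: 'X_[m].

Local Fact coef_trunc b f m : (mdeg m < b)%N ->
  (mps_trunc b f)@_m = mpscoef f m.
Proof. exact: mcoeff_mpoly. Qed.

Local Fact coef_mul_trunc b f g p q m : (mdeg m < b)%N ->
  (forall m', (mdeg m' < b)%N -> p@_m' = mpscoef f m') ->
  (forall m', (mdeg m' < b)%N -> q@_m' = mpscoef g m') ->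
  (p * q)@_m = mpscoef (mps_mul f g) m.
Proof.
move=> mb pf qg; rewrite mcoeffM /=; apply: eq_bigr => -[[a ha] [c hc]] _ /=.
by rewrite pf ?qg //; exact: (leq_trans _ mb).
Qed.

Fact mps_mulA : associative mps_mul.
Proof.
move=> f g h; apply: mpseriesP => m; set b := (mdeg m).+1.
have T u := @coef_trunc b u.
have M u v m' mb := @coef_mul_trunc b u v _ _ m' mb (T u) (T v).
have mb : (mdeg m < b)%N by [].
rewrite -(@coef_mul_trunc b _ _ _ _ m mb (T f) (M g h)).
by rewrite -(@coef_mul_trunc b _ _ _ _ m mb (M f g) (T h)) mulrA.
Qed.

Fact mps_mulC : commutative mps_mul.
Proof.
move=> f g; apply: mpseriesP => m; set b := (mdeg m).+1.
have T u := @coef_trunc b u.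
rewrite -(@coef_mul_trunc b _ _ _ _ m _ (T f) (T g)) //.
by rewrite -(@coef_mul_trunc b _ _ _ _ m _ (T g) (T f)) // mulrC.
Qed.

Fact mps_mul1 : left_id mps1 mps_mul.
Proof.
move=> f; apply: mpseriesP => m; set b := (mdeg m).+1.
rewrite -(@coef_mul_trunc b _ _ 1 _ m _ _ (@coef_trunc b f)) ?mul1r //.
  exact: coef_trunc.
by move=> m' _; rewrite mcoeff1.
Qed.

Fact mps_mulD : left_distributive mps_mul mps_add.
Proof.
move=> f g h; apply: mpseriesP => m /=; rewrite -big_split /=.
by apply: eq_bigr => ab _; rewrite mulrDl.
Qed.

Fact mps1_neq0 : mps1 != 0 :> mpseries n K.
Proof.
by apply/eqP => /(congr1 (@mpscoef n K ^~ 0%MM)) /= /eqP; rewrite eqxx oner_eq0.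
Qed.

HB.instance Definition _ := GRing.Zmodule_isComNzRing.Build (mpseries n K)
  mps_mulA mps_mulC mps_mul1 mps_mulD mps1_neq0.

Definition mpsX (i : 'I_n) : mpseries n K := MPSeries (fun m => (m == U_(i)%MM)%:R).

End Ring.
End PowerSeries.

From mathcomp Require Import all_classical all_reals all_analysis.
Import numFieldNormedType.Exports.
Import PowerSeries.

Local Open Scope classical_set_scope.

Section Ideals.
Variable A : comPzRingType.
Implicit Types (I J P : set A) (S : set A).

Definition is_ideal I :=
  [/\ I 0, (forall a b, I a -> I b -> I (a + b))
    & (forall a b, I b -> I (a * b))].

Definition ideal_gen S : set A := smallest is_ideal S.

Definition ideal_add I J : set A := [set a + b | a in I & b in J].

Definition ideal_mul I J : set A := ideal_gen [set a * b | a in I & b in J].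

Fixpoint ideal_exp I n : set A :=
  if n is n'.+1 then ideal_mul I (ideal_exp I n') else setT.

(* I^[q] *)
Definition ideal_frob I q : set A := ideal_gen [set a ^+ q | a in I].

Definition is_prime_ideal P :=
  [/\ is_ideal P, ~ P 1 & (forall a b, P (a * b) -> P a \/ P b)].

Definition is_maximal_ideal I :=
  [/\ is_ideal I, ~ I 1
    & (forall J, is_ideal J -> ~ J 1 -> I `<=` J -> J = I)].

Lemma ideal_gen_ideal S : is_ideal (ideal_gen S).
Proof.
split=> [I [[? _ _] _] //|a b Sa Sb I HI|a b Sb I HI].
  by case: (HI) => -[_ + _] _; apply; [apply: Sa|apply: Sb].
by case: (HI) => -[_ _ +] _; apply; apply: Sb.
Qed.

End Ideals.

(* The ring A/(S). Unlike the library's {ideal_quot I}, the ideal (S) may be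
   the whole ring, in which case the quotient is the zero ring. *)
Section Quotient.
Variables (A : comPzRingType) (S : set A).

Definition ideal_pred : A -> bool := fun a => `[< ideal_gen S a >].

Fact ideal_pred_zmod : zmod_closed (ideal_pred : {pred A}).
Proof.
have [i0 iD iM] := ideal_gen_ideal S.
split=> [|a b /asboolP Ia /asboolP Ib]; apply/asboolP => //.
by apply: iD => //; rewrite -mulN1r; apply: iM.
Qed.

HB.instance Definition _ := GRing.isZmodClosed.Build A ideal_pred ideal_pred_zmod.

Definition quot : Type :=
  ring_quotient.Quotient.quot (GRing.ZmodClosed.clone A ideal_pred _).

HB.instance Definition _ := GRing.Zmodule.on quot.
HB.instance Definition _ := generic_quotient.EqQuotient.on quot.

Definition quot_pi (a : A) : quot := (\pi_quot a)%qT.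
Definition quot_repr (x : quot) : A := generic_quotient.repr x.

Lemma quot_reprK x : quot_pi (quot_repr x) = x.
Proof. exact: generic_quotient.reprK. Qed.

Lemma quot_eqP a b : quot_pi a = quot_pi b <-> ideal_gen S (a - b).
Proof.
rewrite (rwP eqP) -[_ == _]ring_quotient.Quotient.idealrBE.
by split => /asboolP.
Qed.

Lemma quot_piB : zmod_morphism quot_pi.
Proof. exact: ring_quotient.pi_is_zmod_morphism. Qed.

Definition quot_one : quot := quot_pi 1.
Definition quot_mul (x y : quot) : quot := quot_pi (quot_repr x * quot_repr y).

Lemma quot_piM a b : quot_pi (a * b) = quot_mul (quot_pi a) (quot_pi b).
Proof.
have [_ iD iM] := ideal_gen_ideal S; apply/quot_eqP.
have ra := (quot_eqP _ _).1 (esym (quot_reprK (quot_pi a))).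
have rb := (quot_eqP _ _).1 (esym (quot_reprK (quot_pi b))).
set a' := quot_repr _ in ra *; set b' := quot_repr _ in rb *.
have -> : a * b - a' * b' = b * (a - a') + a' * (b - b').
  by rewrite !mulrBr (mulrC b) (mulrC b) addrA subrK.
by apply: iD; apply: iM.
Qed.

Fact quot_mulA : associative quot_mul.
Proof.
move=> x y z; rewrite -[x]quot_reprK -[y]quot_reprK -[z]quot_reprK.
by rewrite -!quot_piM mulrA.
Qed.

Fact quot_mulC : commutative quot_mul.
Proof. by move=> x y; rewrite /quot_mul mulrC. Qed.

Fact quot_mul1 : left_id quot_one quot_mul.
Proof. by move=> x; rewrite -[x]quot_reprK -quot_piM mul1r. Qed.

HB.instance Definition _ := GRing.isZmodMorphism.Build A quot quot_pi quot_piB.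

Fact quot_mulD : left_distributive quot_mul +%R.
Proof.
move=> x y z; rewrite -[x]quot_reprK -[y]quot_reprK -[z]quot_reprK.
by rewrite -raddfD -!quot_piM -raddfD mulrDl.
Qed.

HB.instance Definition _ := GRing.Zmodule_isComPzRing.Build quot
  quot_mulA quot_mulC quot_mul1 quot_mulD.

Fact quot_pi_monoid : monoid_morphism quot_pi.
Proof. by split => // a b; exact: quot_piM. Qed.

HB.instance Definition _ :=
  GRing.isMonoidMorphism.Build A quot quot_pi quot_pi_monoid.

End Quotient.

(* The I-adic completion, lim_n A/I^n: a family c is coherent when c_n is the
   image of c_(n+1) under the projection A/I^(n+1) -> A/I^n. *)
Section Completion.
Variables (A : comPzRingType) (I : set A).

Definition coherent (c : forall n, quot (ideal_exp I n)) :=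
  forall n, exists a, c n.+1 = quot_pi _ a /\ c n = quot_pi _ a.

Record completion := Completion {
  comp_val : forall n, quot (ideal_exp I n);
  comp_coherent : coherent comp_val
}.
Implicit Types x y z : completion.

HB.instance Definition _ := gen_eqMixin completion.
HB.instance Definition _ := gen_choiceMixin completion.

Lemma completionP x y : (forall n, comp_val x n = comp_val y n) -> x = y.
Proof.
case: x y => [x cx] [y cy] /= xy.
have {}xy : x = y by apply: functional_extensionality_dep.
by case: _ / xy cy => cy; rewrite (Prop_irrelevance cx cy).
Qed.

Fact comp0_coherent : coherent (fun _ => 0).
Proof. by move=> n; exists 0; rewrite !raddf0. Qed.
Fact comp1_coherent : coherent (fun _ => 1).
Proof. by move=> n; exists 1; rewrite !rmorph1. Qed.
Fact compN_coherent x : coherent (fun n => - comp_val x n).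
Proof.
by move=> n; have [a [-> ->]] := comp_coherent x n; exists (- a); rewrite !raddfN.
Qed.
Fact compD_coherent x y : coherent (fun n => comp_val x n + comp_val y n).
Proof.
move=> n; have [a [-> ->]] := comp_coherent x n.
by have [b [-> ->]] := comp_coherent y n; exists (a + b); rewrite !raddfD.
Qed.
Fact compM_coherent x y : coherent (fun n => comp_val x n * comp_val y n).
Proof.
move=> n; have [a [-> ->]] := comp_coherent x n.
by have [b [-> ->]] := comp_coherent y n; exists (a * b); rewrite !rmorphM.
Qed.

Definition comp0 := Completion comp0_coherent.
Definition comp1 := Completion comp1_coherent.
Definition comp_opp x := Completion (compN_coherent x).
Definition comp_add x y := Completion (compD_coherent x y).
Definition comp_mul x y := Completion (compM_coherent x y).

Fact comp_addA : associative comp_add.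
Proof. by move=> x y z; apply: completionP => n /=; rewrite addrA. Qed.
Fact comp_addC : commutative comp_add.
Proof. by move=> x y; apply: completionP => n /=; rewrite addrC. Qed.
Fact comp_add0 : left_id comp0 comp_add.
Proof. by move=> x; apply: completionP => n /=; rewrite add0r. Qed.
Fact comp_addN : left_inverse comp0 comp_opp comp_add.
Proof. by move=> x; apply: completionP => n /=; rewrite addNr. Qed.

HB.instance Definition _ :=
  GRing.isZmodule.Build completion comp_addA comp_addC comp_add0 comp_addN.

Fact comp_mulA : associative comp_mul.
Proof. by move=> x y z; apply: completionP => n /=; rewrite mulrA. Qed.
Fact comp_mulC : commutative comp_mul.
Proof. by move=> x y; apply: completionP => n /=; rewrite mulrC. Qed.
Fact comp_mul1 : left_id comp1 comp_mul.
Proof. by move=> x; apply: completionP => n /=; rewrite mul1r. Qed.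
Fact comp_mulD : left_distributive comp_mul comp_add.
Proof. by move=> x y z; apply: completionP => n /=; rewrite mulrDl. Qed.

HB.instance Definition _ := GRing.Zmodule_isComPzRing.Build completion
  comp_mulA comp_mulC comp_mul1 comp_mulD.

End Completion.

Section LocalRings.
Variable A : comPzRingType.

Definition noetherian :=
  forall I : set A, is_ideal I -> exists s : seq A, I = ideal_gen [set` s].

Definition local :=
  exists M : set A, forall I : set A, is_maximal_ideal I <-> I = M.

Definition noetherian_local := noetherian /\ local.

(* The maximal ideal of A, when A is local. *)
Definition maxideal : set A := xget set0 (@is_maximal_ideal A).

Definition prime_chain (n : nat) (P : nat -> set A) :=
  (forall i, (i <= n)%N -> is_prime_ideal (P i)) /\
  (forall i, (i < n)%N -> P i `<` P i.+1).

Definition is_krull_dim (d : nat) :=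
  (exists P, prime_chain d P) /\ (forall n P, prime_chain n P -> (n <= d)%N).

(* Krull dimension; 0 by convention if there is no bound on prime chains. *)
Definition krull_dim : nat := xget 0%N is_krull_dim.

Definition ideal_chain (n : nat) (J : nat -> set A) :=
  [/\ (forall i, (i <= n)%N -> is_ideal (J i)), J 0%N = [set 0], J n = setT
    & (forall i, (i < n)%N -> J i `<` J i.+1)].

Definition is_length (l : nat) :=
  (exists J, ideal_chain l J) /\ (forall n J, ideal_chain n J -> (n <= l)%N).

(* Length of A as a module over itself; 0 by convention if it is infinite. *)
Definition ring_length : nat := xget 0%N is_length.

Definition regular :=
  exists s : seq A, size s = krull_dim /\ ideal_gen [set` s] = maxideal.

Definition regular_sequence (s : seq A) :=
  (forall i, (i < size s)%N -> forall a,
     ideal_gen [set` take i s] (a * s`_i) -> ideal_gen [set` take i s] a) /\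
  ~ ideal_gen [set` s] 1.

End LocalRings.
Arguments maxideal A : clear implicits.

Definition ring_iso (A B : pzRingType) :=
  exists phi : {rmorphism A -> B}, bijective phi.

Definition has_residue_field (A : comPzRingType) (k : fieldType) :=
  ring_iso (quot (maxideal A)) k.

Definition complete_intersection (A : comPzRingType) :=
  exists (K : fieldType) (n : nat) (fs : seq (mpseries n K)),
    regular_sequence fs /\
    ring_iso (completion (maxideal A)) (quot [set` fs]).

Section SMultiplicity.
Variable R : realType.

Section Ideal.
Variables (A : comPzRingType) (p : nat) (s : R) (I : set A).

Definition hs_ideal (e : nat) : set A :=
  ideal_add (ideal_exp I `|Num.ceil (s * (p ^ e)%:R)|%N) (ideal_frob I (p ^ e)).

Definition h_s : R :=
  lim ((ring_length (quot (hs_ideal e)))%:R / ((p ^ (e * krull_dim A))%:R : R)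
         @[e --> \oo]).

End Ideal.

Definition calH (s : R) (d : nat) : R :=
  \sum_(0 <= i < `|Num.floor s|.+1)
    (-1) ^+ i / d`!%:R * 'C(d, i)%:R * (s - i%:R) ^+ d.

Definition e_s (A : comPzRingType) (p : nat) (s : R) (I : set A) : R :=
  h_s p s I / calH s (krull_dim A).

Definition e_s_ring (A : comPzRingType) (p : nat) (s : R) : R :=
  e_s p s (maxideal A).

End SMultiplicity.

(* R_d = k[[x_0, ..., x_d]] / (x_0^2 + ... + x_d^2) *)
Definition quadric (k : fieldType) (d : nat) : comPzRingType :=
  quot [set \sum_(i < d.+1) (mpsX k i : mpseries d.+1 k) ^+ 2].

(* Main.v *)
Require Import Defs.
From HB Require Import structures.
From mathcomp Require Import all_boot all_order all_algebra.
From mathcomp Require Import boolp classical_sets.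
From mathcomp Require Import zify ring.
From mathcomp Require mpoly.

Set Implicit Arguments.
Unset Strict Implicit.
Unset Printing Implicit Defensive.

Import Order.TTheory GRing.Theory Num.Theory.
Import PowerSeries.
Local Open Scope classical_set_scope.
Local Open Scope ring_scope.

(** A complete intersection A of dimension d has a completion K[[x_1, ..., x_n]]/(f_1,
    ..., f_c) with n = c + d. All lengths in sight can be computed in the power series
    ring: with E_(N,q) = m^N + m^[q], where m is the maximal ideal of K[[x]], the length
    of A modulo the ideal that defines h_s is the K-codimension of (f) + E_(N,q), for q
    = p^e and N = ceil (s q). The theorem follows from an inequality of these
    codimensions for each N and each q, before any limit is taken, and from the
    existence of the limit for A.

    Why the quadric is the least singular case. Let r be the rank of the linear parts of
    the f_i. The maximal ideal of A is generated by n - r elements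
    (maxideal_generators), so that A, being singular, has r < c. A linear change of
    variables then gives w = c - 1 linear forms W_1, ..., W_w and d + 1 further
    coordinates X_0, ..., X_d such that every f_i is congruent modulo (W) to an element
    of (X)^2. Consider over P[u], P = K[x], the pencil
      W_i + u f_i (1 <= i <= w),   X_0^2 + ... + X_d^2 + u f_0.
    Since 2 is invertible, eliminating the W_i and completing squares (morse) shows
    that, modulo u^L, this family lies in the ideal obtained from W_1, ..., W_w and the
    sum of the X_j^2 by a change of variables that depends on u; and E_(N,q) is
    invariant under such a change, because it is generated by
    the q-th powers of all linear forms (q = p^e) and by all forms of degree N.
    Hence the pencil has codimension at
    least L times that of (W, X_0^2 + ... + X_d^2). On the other hand u f_i lies, modulo
    the pencil, in P, which bounds the codimension of the pencil by L times that of (f)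
    plus a constant that does not depend on L. For L large this gives the wanted
    inequality (cdim_quadric_le, cdim_quadric_series), a form of semicontinuity that
    holds over finite fields as well. The field K only surjects onto k, and the
    codimension of the quadric over k is computed along this surjection.

    The limit for A. Replacing an ideal of K[[x]] by its Frobenius power multiplies the
    codimension by at least p^n, and raising c equations to the power p costs at most a
    factor p^c. So p^d times the length for (N, q) is at most the length for ((N + n) p,
    q p) (hs_frob_step). This makes a slightly shifted sequence nondecreasing after
    division by q^d; the shift changes N by a constant, hence the length by O(N^(d -
    1)), which is negligible (hsS_layer, hs_ratio_a_cvg). These bounds, and the equality
    n = c + d, rest on dimension theory: parameters bound the growth of lengths from
    above (dimle_growth), and a chain of primes of length l forces growth of degree at
    least l, because each step of the chain provides a nonzerodivisor that stays one in
    the completion (weak_artin_rees, prime_chain_growth).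

    Conclusion. If the quadric has Krull dimension d, the termwise inequality passes to
    the limit, and calH s d is nonnegative, being 1/d! times an alternating sum of
    truncated powers that satisfies a simple recurrence (alt_powersS). In the other case
    the normalization of h_s by a wrong power of q makes h_s of the quadric vanish, by
    the bounds for its lengths, and the inequality still holds. *)

(** * Ideals *)

Section IdealTheory.
Variable A : comPzRingType.
Implicit Types (I J L : set A) (a b g x : A) (s : seq A).

Lemma ideal0 I : is_ideal I -> I 0. Proof. by case. Qed.
Lemma idealD I a b : is_ideal I -> I a -> I b -> I (a + b).
Proof. by case=> _ + _; apply. Qed.
Lemma ideal_mull I a b : is_ideal I -> I b -> I (a * b).
Proof. by case=> _ _; apply. Qed.
Lemma ideal_mulr I a b : is_ideal I -> I a -> I (a * b).
Proof. by rewrite mulrC; apply: ideal_mull. Qed.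
Lemma idealN I a : is_ideal I -> I a -> I (- a).
Proof. by rewrite -mulN1r; apply: ideal_mull. Qed.
Lemma idealB I a b : is_ideal I -> I a -> I b -> I (a - b).
Proof. by move=> iI Ia Ib; apply: idealD => //; apply: idealN. Qed.
Lemma ideal_sum I (T : Type) (r : seq T) (P : pred T) (F : T -> A) :
  is_ideal I -> (forall i, P i -> I (F i)) -> I (\sum_(i <- r | P i) F i).
Proof.
by move=> iI; apply: big_ind => [|a b]; [exact: ideal0|exact: idealD].
Qed.
Lemma idealBr I a b : is_ideal I -> I a -> I (a - b) -> I b.
Proof. by move=> iI Ia /(idealB iI Ia); rewrite opprB addrC subrK. Qed.
Lemma idealBl I a b : is_ideal I -> I b -> I (a - b) -> I a.
Proof. by move=> iI Ib /(idealD iI)/(_ Ib); rewrite subrK. Qed.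
Lemma ideal1T I : is_ideal I -> I 1 -> I = setT.
Proof.
by move=> iI I1; apply/seteqP; split=> // x _; rewrite -[x]mulr1; apply: ideal_mull.
Qed.

Lemma sub_ideal_gen (S : set A) : S `<=` ideal_gen S.
Proof. by move=> x Sx I [_]; apply. Qed.
Lemma ideal_gen_sub (S : set A) I : is_ideal I -> S `<=` I -> ideal_gen S `<=` I.
Proof. by move=> iI SI x; apply. Qed.
Lemma ideal_gen_id I : is_ideal I -> ideal_gen I = I.
Proof.
move=> iI; apply/seteqP; split; last exact: sub_ideal_gen.
exact: ideal_gen_sub.
Qed.
Hint Resolve ideal_gen_ideal : core.

Lemma ideal_add_ideal I J : is_ideal I -> is_ideal J -> is_ideal (ideal_add I J).
Proof.
move=> iI iJ; split.
- by exists 0; [exact: ideal0|exists 0; [exact: ideal0|rewrite addr0]].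
- move=> _ _ [a Ia [b Jb <-]] [c Ic [d Jd <-]].
  exists (a + c); first exact: idealD.
  by exists (b + d); [exact: idealD|rewrite addrACA].
- move=> t _ [a Ia [b Jb <-]]; exists (t * a); first exact: ideal_mull.
  by exists (t * b); [exact: ideal_mull|rewrite mulrDr].
Qed.

Lemma ideal_add_subl I J : is_ideal J -> I `<=` ideal_add I J.
Proof. by move=> iJ a Ia; exists a => //; exists 0; [exact: ideal0|rewrite addr0]. Qed.
Lemma ideal_add_subr I J : is_ideal I -> J `<=` ideal_add I J.
Proof. by move=> iI a Ja; exists 0; [exact: ideal0|exists a => //; rewrite add0r]. Qed.
Lemma ideal_add_sub I J L : is_ideal L -> I `<=` L -> J `<=` L ->
  ideal_add I J `<=` L.
Proof. by move=> iL IL JL _ [a /IL ? [b /JL ? <-]]; apply: idealD. Qed.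
Lemma ideal_addS I I' J J' : I `<=` I' -> J `<=` J' ->
  ideal_add I J `<=` ideal_add I' J'.
Proof. by move=> II JJ _ [a /II ? [b /JJ ? <-]]; exists a => //; exists b. Qed.

Lemma ideal_mul_ideal I J : is_ideal (ideal_mul I J).
Proof. exact: ideal_gen_ideal. Qed.
Lemma ideal_exp_ideal I n : is_ideal (ideal_exp I n).
Proof. by case: n => [|n] //=; exact: ideal_mul_ideal. Qed.
Lemma ideal_frob_ideal I q : is_ideal (ideal_frob I q).
Proof. exact: ideal_gen_ideal. Qed.
Hint Resolve ideal_mul_ideal ideal_exp_ideal ideal_frob_ideal : core.

Lemma mem_ideal_mul I J a b : I a -> J b -> ideal_mul I J (a * b).
Proof. by move=> Ia Jb; apply: sub_ideal_gen; exists a => //; exists b. Qed.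
Lemma ideal_mul_sub I J L : is_ideal L ->
  (forall a b, I a -> J b -> L (a * b)) -> ideal_mul I J `<=` L.
Proof. by move=> iL H; apply: ideal_gen_sub => // _ [a Ia [b Jb <-]]; apply: H. Qed.
Lemma ideal_exp1 I : is_ideal I -> ideal_exp I 1 = I.
Proof.
move=> iI; apply/seteqP; split=> [|a Ia].
  by apply: ideal_mul_sub => // a b Ia _; apply: ideal_mulr.
by rewrite -[a]mulr1; apply: mem_ideal_mul.
Qed.
Lemma ideal_expS_sub I n : ideal_exp I n.+1 `<=` ideal_exp I n.
Proof. by apply: ideal_mul_sub => // a b _ ?; apply: ideal_mull. Qed.
Lemma ideal_exp_leq I m n : (m <= n)%N -> ideal_exp I n `<=` ideal_exp I m.
Proof.
move=> /subnK <-; elim: (n - m)%N => //= k IH x /ideal_expS_sub; exact: IH.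
Qed.
Lemma ideal_expM I a b m n :
  ideal_exp I m a -> ideal_exp I n b -> ideal_exp I (m + n) (a * b).
Proof.
elim: m a b => [|m IH] a b /=; first by move=> _; apply: ideal_mull.
move=> Ia Ib; suff: ideal_mul I (ideal_exp I m) `<=`
  [set a | ideal_exp I (m + n).+1 (a * b)] by exact.
apply: ideal_mul_sub => [|x y Ix Iy]; last first.
  by rewrite /= -mulrA; apply: mem_ideal_mul => //; apply: IH.
split=> /= [|x y|x y]; first by rewrite mul0r; apply: ideal0.
  by rewrite mulrDl; apply: idealD.
by rewrite -mulrA; apply: ideal_mull.
Qed.

Lemma ideal_frob_pow I a q : I a -> ideal_frob I q (a ^+ q).
Proof. by move=> Ia; apply: sub_ideal_gen; exists a. Qed.
Lemma ideal_frob_sub I J q : is_ideal J -> (forall a, I a -> J (a ^+ q)) ->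
  ideal_frob I q `<=` J.
Proof. by move=> iJ H; apply: ideal_gen_sub => // _ [a Ia <-]; apply: H. Qed.

Definition adj I g : set A := [set x | exists2 a, I a & exists t, x = a + g * t].
Definition colon I g : set A := [set x | I (g * x)].

Lemma adj_ideal I g : is_ideal I -> is_ideal (adj I g).
Proof.
move=> iI; split.
- by exists 0; [exact: ideal0|exists 0; rewrite mulr0 addr0].
- move=> _ _ [a Ia [s ->]] [b Ib [t ->]]; exists (a + b); first exact: idealD.
  by exists (s + t); rewrite addrACA mulrDr.
- move=> c _ [a Ia [s ->]]; exists (c * a); first exact: ideal_mull.
  by exists (c * s); rewrite mulrDr mulrCA.
Qed.
Lemma sub_adj I g : I `<=` adj I g.
Proof. by move=> a Ia; exists a => //; exists 0; rewrite mulr0 addr0. Qed.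
Lemma mem_adj I g t : is_ideal I -> adj I g (g * t).
Proof. by move=> iI; exists 0; [exact: ideal0|exists t; rewrite add0r]. Qed.
Lemma mem_adj1 I g : is_ideal I -> adj I g g.
Proof. by move=> iI; rewrite -{2}[g]mulr1; apply: mem_adj. Qed.
Lemma adj_sub I g L : is_ideal L -> I `<=` L -> L g -> adj I g `<=` L.
Proof. by move=> iL IL Lg _ [a /IL La [t ->]]; apply: idealD => //; apply: ideal_mulr. Qed.
Lemma adjS I J g : I `<=` J -> adj I g `<=` adj J g.
Proof. by move=> IJ _ [a /IJ ? [t ->]]; exists a => //; exists t. Qed.
Lemma colon_ideal I g : is_ideal I -> is_ideal (colon I g).
Proof.
move=> iI; split; rewrite /colon /=; first by rewrite mulr0; apply: ideal0.
  by move=> a b ? ?; rewrite mulrDr; apply: idealD.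
by move=> a b ?; rewrite mulrCA; apply: ideal_mull.
Qed.
Lemma sub_colon I g : is_ideal I -> I `<=` colon I g.
Proof. by move=> iI a Ia; apply: ideal_mull. Qed.

Definition adjs I s : set A := foldr (fun g J => adj J g) I s.

Lemma adjs_ideal I s : is_ideal I -> is_ideal (adjs I s).
Proof. by elim: s => //= g s IH iI; apply/adj_ideal/IH. Qed.
Lemma sub_adjs I s : I `<=` adjs I s.
Proof. by elim: s => //= g s IH x /IH; apply: sub_adj. Qed.
Lemma mem_adjs I s x : is_ideal I -> x \in s -> adjs I s x.
Proof.
move=> iI; elim: s => //= g s IH; rewrite inE => /predU1P[->|/IH /sub_adj //].
exact/mem_adj1/adjs_ideal.
Qed.
Lemma adjs_sub I s L : is_ideal L -> I `<=` L -> (forall x, x \in s -> L x) ->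
  adjs I s `<=` L.
Proof.
move=> iL IL; elim: s => //= g s IH H; apply: adj_sub => //.
  by apply: IH => x xs; apply: H; rewrite inE xs orbT.
by apply: H; rewrite inE eqxx.
Qed.
Lemma adjsE I s : is_ideal I -> adjs I s = ideal_add (ideal_gen [set` s]) I.
Proof.
move=> iI; apply/seteqP; split.
  apply: adjs_sub; [exact: ideal_add_ideal|exact: ideal_add_subr|move=> x xs].
  by apply: ideal_add_subl => //; apply: sub_ideal_gen.
apply: ideal_add_sub; [exact: adjs_ideal| |exact: sub_adjs].
by apply: ideal_gen_sub; [exact: adjs_ideal|move=> x /= xs; apply: mem_adjs].
Qed.
Lemma adjsS I J s : I `<=` J -> adjs I s `<=` adjs J s.
Proof. by move=> IJ; elim: s => //= g s IH; apply: adjS. Qed.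
Lemma ideal_set0 : is_ideal [set (0 : A)].
Proof.
by split=> [//|a b /= -> ->|a b /= ->]; [rewrite addr0|rewrite mulr0].
Qed.
End IdealTheory.
#[global] Hint Resolve ideal_gen_ideal ideal_mul_ideal ideal_exp_ideal
  ideal_frob_ideal : core.

(** * Colength *)

Section Colength.

(** The analogue of ideal_chain for the ideals that contain I, so that colengths can
   be handled without passing to the quotient ring. *)
Definition ichain (A : comPzRingType) (I : set A) (n : nat) (J : nat -> set A) :=
  [/\ (forall i, (i <= n)%N -> is_ideal (J i)), J 0%N = I, J n = setT
    & (forall i, (i < n)%N -> J i `<` J i.+1)].

Definition colength (A : comPzRingType) (I : set A) (l : nat) :=
  (exists J, ichain I l J) /\ (forall n J, ichain I n J -> (n <= l)%N).

(** Ideals of A above I and ideals of B above J correspond through h, because h is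
   surjective modulo J and I is the preimage of J. No surjectivity of h itself is
   asked for: this covers the map from a local ring to its completion. *)
Lemma ichain_transport (A B : comPzRingType) (h : {rmorphism A -> B})
    (I : set A) (J : set B) n :
  is_ideal J -> (forall a, I a <-> J (h a)) ->
  (forall b, exists a, J (b - h a)) ->
  (exists C, ichain I n C) <-> (exists C, ichain J n C).
Proof.
move=> iJ IJ hd.
have iI : is_ideal I.
  split; first by apply/IJ; rewrite rmorph0; apply: ideal0.
    by move=> a b /IJ ? /IJ ?; apply/IJ; rewrite rmorphD; apply: idealD.
  by move=> a b /IJ ?; apply/IJ; rewrite rmorphM; apply: ideal_mull.
split=> -[C [Ci C0 CT Cs]].
- have IC i : (i <= n)%N -> I `<=` C i.
    elim: i => [_|i IH ltin]; first by rewrite C0.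
    by move=> a /(IH (ltnW ltin)); apply: (Cs i ltin).1.
  (* The extension of C i, saturated by J. *)
  exists (fun i => [set b | exists2 a, C i a & J (b - h a)]); split.
  + move=> i /Ci iC; split=> [|b c [a Ca Jb] [a' Ca' Jc]|b c [a Ca Jc]].
    * exists 0; first exact: ideal0.
      by rewrite rmorph0 subrr; apply: ideal0.
    * exists (a + a'); first exact: idealD.
      by rewrite rmorphD opprD addrACA; apply: idealD.
    * have [a' Ja'] := hd b; exists (a' * a); first exact: ideal_mull.
      have -> : b * c - h (a' * a) = b * (c - h a) + h a * (b - h a').
        by rewrite rmorphM !mulrBr [h a * b]mulrC [h a * _]mulrC addrA subrK.
      by apply: idealD => //; apply: ideal_mull.
  + apply/seteqP; split=> [b [a]|b Jb].
      by rewrite C0 => /IJ Ja Jb; apply: (idealBl iJ Ja).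
    by exists 0; [rewrite C0; apply: ideal0|rewrite rmorph0 subr0].
  + by apply/seteqP; split=> // b _; have [a ?] := hd b; exists a; rewrite ?CT.
  + move=> i ltin; have [CC nC] := Cs i ltin; split.
      by move=> b [a /CC Ca Jb]; exists a.
    apply: contra_not nC => H a Ca.
    have [|a' Ca' Ja'] := H (h a).
      by exists a => //; rewrite subrr; apply: ideal0.
    have iCi := Ci i (ltnW ltin).
    apply: (idealBl iCi Ca'); apply: (IC i (ltnW ltin)).
    by apply/IJ; rewrite rmorphB.
- have JC i : (i <= n)%N -> J `<=` C i.
    elim: i => [_|i IH ltin]; first by rewrite C0.
    by move=> a /(IH (ltnW ltin)); apply: (Cs i ltin).1.
  exists (fun i => [set a | C i (h a)]); split.
  + move=> i /Ci iC; split=> /= [|b c|b c]; rewrite ?rmorph0 ?rmorphD ?rmorphM.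
    * exact: ideal0.
    * exact: idealD.
    * exact: ideal_mull.
  + by apply/seteqP; split=> a /=; rewrite C0 => /IJ.
  + by rewrite CT.
  + move=> i ltin; have [CC nC] := Cs i ltin; split.
      by move=> a /CC.
    apply: contra_not nC => H b Cb; have [a Ja] := hd b.
    have Cha : C i.+1 (h a).
      by apply: (idealBr (Ci _ ltin) Cb); apply: JC.
    by apply: (idealBl (Ci _ (ltnW ltin)) (H _ Cha)); apply: JC; rewrite 1?ltnW.
Qed.

Lemma colength_transport (A B : comPzRingType) (h : {rmorphism A -> B})
    (I : set A) (J : set B) l :
  is_ideal J -> (forall a, I a <-> J (h a)) ->
  (forall b, exists a, J (b - h a)) -> colength I l <-> colength J l.
Proof.
move=> iJ IJ hd; have T n := ichain_transport n iJ IJ hd.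
split=> -[/T c m]; split=> // n C cC.
  by have [|D] := (T n).2; [exists C|apply: m].
by have [|D] := (T n).1; [exists C|apply: m].
Qed.

Lemma colength_uniq (A : comPzRingType) (I : set A) l l' :
  colength I l -> colength I l' -> l = l'.
Proof.
by move=> [[C Cc] m] [[D Dc] m']; apply/anti_leq/andP; split; [apply: m' Cc|apply: m Dc].
Qed.

Lemma ring_lengthE (A : comPzRingType) (I : set A) l :
  is_ideal I -> colength I l -> ring_length (quot I) = l.
Proof.
move=> iI cI.
have E n : is_length (quot I) n <-> colength I n.
  symmetry; apply: (@colength_transport _ _ (quot_pi I)).
  - exact: ideal_set0.
  - move=> a /=; rewrite -[X in I X]subr0 -{1}(ideal_gen_id iI).
    by rewrite -(quot_eqP I) rmorph0.
  - by move=> b; exists (quot_repr b); rewrite /= quot_reprK subrr.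
rewrite /ring_length; case: xgetP => [m _ /E cm|/(_ l)].
  exact: colength_uniq cm cI.
by move=> /[dup] /E.
Qed.
End Colength.

(** * Codimension over a field *)

Section Codim.
Variables (K : fieldType) (C : comPzRingType) (k : {rmorphism K -> C}).
Implicit Types (I J : set C) (F G : finType).

(** The scalars act through the ring morphism k and not through an algebra structure
   of C: power series over one field will also be measured over another field that
   surjects onto it. *)
Definition subspace I := [/\ I 0, (forall a b, I a -> I b -> I (a + b))
  & (forall c a, I a -> I (k c * a))].

Definition lincomb F (v : F -> C) (c : F -> K) : C := \sum_i k (c i) * v i.

Definition spans I F (v : F -> C) := forall x, exists c, I (x - lincomb v c).
Definition indep I F (v : F -> C) :=
  forall c, I (lincomb v c) -> forall i, c i = 0.
Definition codim I m := exists v : 'I_m -> C, spans I v /\ indep I v.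
Definition fincodim I := exists m, codim I m.
Definition cdim I : nat := xget 0%N [set m | codim I m].

Lemma ideal_subspace I : is_ideal I -> subspace I.
Proof. by case=> I0 ID IM; split=> // c a; apply: IM. Qed.

Lemma subspaceB I a b : subspace I -> I a -> I b -> I (a - b).
Proof.
by case=> _ ID IM Ia Ib; rewrite -mulN1r -(rmorphN1 k); apply: ID => //; apply: IM.
Qed.

Lemma subspace_sum I (T : Type) (r : seq T) (P : pred T) (f : T -> C) :
  subspace I -> (forall i, P i -> I (f i)) -> I (\sum_(i <- r | P i) f i).
Proof. by case=> I0 ID _; apply: big_ind. Qed.

Lemma subspace_tr I a b c : subspace I -> I (a - b) -> I (b - c) -> I (a - c).
Proof. by case=> _ ID _ ab /(ID _ _ ab); rewrite addrA subrK. Qed.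

Lemma lincombB F (v : F -> C) c d :
  lincomb v c - lincomb v d = lincomb v (fun i => c i - d i).
Proof. by rewrite /lincomb -sumrB; apply: eq_bigr => i _; rewrite rmorphB mulrBl. Qed.

Lemma lincombZ F (v : F -> C) a c : k a * lincomb v c = lincomb v (fun i => a * c i).
Proof.
by rewrite /lincomb mulr_sumr; apply: eq_bigr => i _; rewrite rmorphM mulrA.
Qed.

Lemma lincomb_comp I F G (v : F -> C) (w : G -> C) (a : G -> F -> K) c :
  subspace I -> (forall g, I (w g - lincomb v (a g))) ->
  I (lincomb w c - lincomb v (fun f => \sum_g c g * a g f)).
Proof.
move=> sI wv; have -> : lincomb v (fun f => \sum_g c g * a g f) =
    \sum_g k (c g) * lincomb v (a g).
  rewrite /lincomb; under eq_bigr do rewrite rmorph_sum mulr_suml.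
  rewrite exchange_big; apply: eq_bigr => g _; rewrite mulr_sumr.
  by apply: eq_bigr => f _; rewrite rmorphM mulrA.
rewrite -sumrB; apply: subspace_sum => // g _; rewrite -mulrBr.
by case: sI => _ _; apply; exact: wv.
Qed.

(** Express the independent vectors through the spanning ones: a matrix with more rows
   than columns would have a nonzero row in its kernel, that is, a relation. *)
Lemma spans_indep_leq I F G (v : F -> C) (w : G -> C) :
  subspace I -> spans I v -> indep I w -> (#|G| <= #|F|)%N.
Proof.
move=> sI sv iw; rewrite leqNgt; apply/negP => ltFG.
have [a wa] := choice (fun g => sv (w g)).
pose M := \matrix_(i < #|G|, j < #|F|) a (enum_val i) (enum_val j).
have : kermx M != 0.
  by rewrite -mxrank_eq0 mxrank_ker -lt0n subn_gt0 (leq_ltn_trans (rank_leq_col M)).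
case/rowV0Pn => u /sub_kermxP uM /eqP; apply.
apply/rowP => i; rewrite mxE.
rewrite -(enum_valK i); move: (enum_val i) => {}i.
apply: (iw (fun g => u 0 (enum_rank g))).
have := lincomb_comp (fun g => u 0 (enum_rank g)) sI wa.
suff -> : lincomb v (fun f => \sum_g u 0 (enum_rank g) * a g f) = 0 by rewrite subr0.
rewrite /lincomb big1 // => f _.
have /matrixP/(_ 0 (enum_rank f)) := uM; rewrite !mxE => H.
suff -> : \sum_g u 0 (enum_rank g) * a g f = 0 by rewrite rmorph0 mul0r.
rewrite -[RHS]H (reindex _ (onW_bij _ (@enum_val_bij G))) /=.
by apply: eq_bigr => j _; rewrite mxE enum_valK enum_rankK.
Qed.

Lemma lincomb_enum F (v : F -> C) c :
  lincomb v c = lincomb (fun i : 'I_#|F| => v (enum_val i)) (fun i => c (enum_val i)).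
Proof. by rewrite /lincomb (reindex _ (onW_bij _ (@enum_val_bij F))). Qed.

Lemma basis_codim I F (v : F -> C) : spans I v -> indep I v -> codim I #|F|.
Proof.
move=> sv iv; exists (fun i => v (enum_val i)); split.
  move=> x; have [c cx] := sv x; exists (fun i => c (enum_val i)).
  by rewrite -lincomb_enum.
move=> c Ic i; rewrite -(enum_valK i).
apply: (iv (fun f => c (enum_rank f))); rewrite lincomb_enum.
congr (I _): Ic; apply: eq_bigr => j _; by rewrite enum_valK.
Qed.

Lemma codim_uniq I m n : subspace I -> codim I m -> codim I n -> m = n.
Proof.
move=> sI [v [sv iv]] [w [sw iw]]; apply/anti_leq; rewrite -[m]card_ord -[n]card_ord.
by rewrite (spans_indep_leq sI sw iv) (spans_indep_leq sI sv iw).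
Qed.

Lemma cdimE I m : subspace I -> codim I m -> cdim I = m.
Proof.
move=> sI cm; rewrite /cdim; case: xgetP => [n _ /= cn|/(_ m)//].
exact: codim_uniq cn cm.
Qed.

Lemma fincodimP I : fincodim I -> codim I (cdim I).
Proof. by move=> [m cm]; rewrite /cdim; apply: (xgetPex 0%N); exists m. Qed.

Lemma spans_drop I n (v : 'I_n.+1 -> C) c j : subspace I ->
  I (lincomb v c) -> c j != 0 -> spans I v -> spans I (fun i => v (lift j i)).
Proof.
move=> sI Ic cj sv x; have [d dx] := sv x.
have [I0 ID IM] := sI.
pose e i := d i - d j / c j * c i.
exists (fun i => e (lift j i)).
have <- : lincomb v e = lincomb (fun i => v (lift j i)) (fun i => e (lift j i)).
  rewrite /lincomb (bigD1_ord j) //=.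
  by rewrite {1}/e divfK // subrr rmorph0 mul0r add0r.
rewrite /e -lincombB -(lincombZ v (d j / c j)) opprB addrCA -opprB.
by rewrite opprB; apply: ID => //; apply: IM.
Qed.

Lemma spans_codim_ord I n (v : 'I_n -> C) : subspace I -> spans I v ->
  exists2 m, (m <= n)%N & codim I m.
Proof.
elim: n v => [|n IH] v sI sv.
  by exists 0%N => //; exists v; split=> // c _ [].
have [iv|] := EM (indep I v); first by exists n.+1 => //; exists v.
move=> /existsNP[c /not_implyP[Ic /existsNP[j /eqP cj]]].
have [m lemn cm] := IH _ sI (spans_drop sI Ic cj sv).
by exists m => //; apply: leqW.
Qed.

Lemma cdim_leq_spans I F (v : F -> C) : subspace I -> spans I v ->
  fincodim I /\ (cdim I <= #|F|)%N.
Proof.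
move=> sI sv; have : spans I (fun i : 'I_#|F| => v (enum_val i)).
  by move=> x; have [c cx] := sv x; exists (fun i => c (enum_val i)); rewrite -lincomb_enum.
by move=> /(spans_codim_ord sI)[m lem cm]; split; [exists m|rewrite (cdimE sI cm)].
Qed.

Lemma cdim_geq_indep I G (w : G -> C) : subspace I -> fincodim I -> indep I w ->
  (#|G| <= cdim I)%N.
Proof.
move=> sI /fincodimP[v [sv _]] iw.
by have := spans_indep_leq sI sv iw; rewrite card_ord.
Qed.

Lemma spansS I J F (v : F -> C) : I `<=` J -> spans I v -> spans J v.
Proof. by move=> IJ sv x; have [c /IJ ?] := sv x; exists c. Qed.

Lemma fincodimS I J : subspace J -> I `<=` J -> fincodim I -> fincodim J.
Proof.
by move=> sJ IJ /fincodimP[v [sv _]]; case: (cdim_leq_spans sJ (spansS IJ sv)).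
Qed.

Lemma cdimS I J : subspace J -> I `<=` J -> fincodim I -> (cdim J <= cdim I)%N.
Proof.
move=> sJ IJ /fincodimP[v [sv _]].
by case: (cdim_leq_spans sJ (spansS IJ sv)) => _; rewrite card_ord.
Qed.

Lemma cdim_eq_sub I J : subspace I -> subspace J -> I `<=` J -> fincodim I ->
  (cdim I <= cdim J)%N -> J `<=` I.
Proof.
move=> sI sJ IJ fI le; have fJ := fincodimS sJ IJ fI.
have [v [sv iv]] := fincodimP fI.
have svJ := spansS IJ sv.
have ivJ : indep J v.
  move=> c Jc i; apply/eqP; apply: contraT => ci; exfalso; move: le.
  move: (cdim I) v c sv iv svJ Jc i ci => [|n] v c sv iv svJ Jc; first by case.
  move=> i ci; rewrite leqNgt => /negP; apply.
  have [_] := cdim_leq_spans sJ (spans_drop sJ Jc ci svJ).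
  by rewrite card_ord.
move=> x Jx; have [c Ix] := sv x.
have Jc : J (lincomb v c).
  by rewrite -[lincomb v c](subKr x); apply: subspaceB => //; apply: IJ.
suff E : lincomb v c = 0 by rewrite E subr0 in Ix.
by rewrite /lincomb big1 // => i _; rewrite (ivJ _ Jc) rmorph0 mul0r.
Qed.

Lemma cdim_setT : cdim setT = 0%N.
Proof. by apply: cdimE => //; exists (fun _ => 0); split=> [x|c _ []//]; exists (fun _ => 0). Qed.

Lemma cdim_eq0 I : subspace I -> fincodim I -> cdim I = 0%N -> I = setT.
Proof.
move=> sI fI c0; apply/seteqP; split=> //.
by apply: cdim_eq_sub => //; rewrite c0.
Qed.

Lemma cdim_gt0 I : is_ideal I -> fincodim I -> ~ I 1 -> (0 < cdim I)%N.
Proof.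
move=> iI fI nI1; rewrite lt0n; apply/eqP => /(cdim_eq0 (ideal_subspace iI) fI) IT.
by apply: nI1; rewrite IT.
Qed.

Lemma fincodim_colon I g : is_ideal I -> fincodim I -> fincodim (colon I g).
Proof.
move=> iI; apply: fincodimS; last exact: sub_colon.
exact/ideal_subspace/colon_ideal.
Qed.

(** Additivity along 0 -> C/(I : g) -> C/I -> C/(I + (g)) -> 0, where the first map is
   the multiplication by g. Most estimates of lengths below are applications of this
   formula. *)
Lemma cdim_adj_colon I g : is_ideal I -> fincodim I ->
  cdim I = (cdim (adj I g) + cdim (colon I g))%N.
Proof.
move=> iI fI; have sI := ideal_subspace iI.
have iA := adj_ideal g iI; have iC := colon_ideal g iI.
have sA := ideal_subspace iA; have sC := ideal_subspace iC.
have fA := fincodimS sA (@sub_adj _ I g) fI.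
have fC := fincodim_colon g iI fI.
have [v [sv iv]] := fincodimP fA; have [w [sw iw]] := fincodimP fC.
pose u (i : 'I_(cdim (adj I g)) + 'I_(cdim (colon I g))) :=
  match i with inl i => v i | inr i => g * w i end.
have uE c : lincomb u c = lincomb v (fun i => c (inl i)) +
    g * lincomb w (fun i => c (inr i)).
  rewrite /lincomb big_sumType /= mulr_sumr; congr (_ + _).
  by apply: eq_bigr => i _; rewrite mulrCA.
rewrite -[X in (X + _)%N]card_ord -[X in (_ + X)%N]card_ord -card_sum.
apply: cdimE => //; apply: (@basis_codim _ _ u).
- move=> x; have [c [a Ia [t Et]]] := sv x; have [d Id] := sw t.
  exists (fun i => match i with inl i => c i | inr i => d i end).
  by rewrite uE /= opprD addrA Et -addrA -mulrBr; apply: idealD.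
- move=> c; rewrite uE => Ic.
  have H1 : forall i, c (inl i) = 0.
    apply: iv; apply: (idealBl iA (mem_adj g (- lincomb w (fun i => c (inr i))) iI)).
    by rewrite mulrN opprK; apply: sub_adj.
  move: Ic; rewrite {1}/lincomb big1 => [|i _]; last by rewrite H1 rmorph0 mul0r.
  by rewrite add0r => /iw H2 [] i.
Qed.

End Codim.

Section CodimTransport.
Variables (K : fieldType) (C D : comPzRingType).
Variables (k : {rmorphism K -> C}) (l : {rmorphism K -> D}).
Variable h : {rmorphism C -> D}.
Hypothesis hk : forall c, h (k c) = l c.

Lemma rmorph_lincomb (F : finType) (v : F -> C) c :
  h (lincomb k v c) = lincomb l (fun i => h (v i)) c.
Proof. by rewrite rmorph_sum; apply: eq_bigr => i _; rewrite rmorphM hk. Qed.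

Lemma codim_transport (I : set C) (J : set D) m : subspace l J ->
  (forall a, I a <-> J (h a)) -> (forall b, exists a, J (b - h a)) ->
  codim k I m -> codim l J m.
Proof.
move=> sJ IJ hd [v [sv iv]]; exists (fun i => h (v i)); split.
  move=> x; have [a xa] := hd x; have [c /IJ] := sv a.
  rewrite rmorphB rmorph_lincomb => ac; exists c; exact: subspace_tr sJ xa ac.
by move=> c; rewrite -rmorph_lincomb => /IJ; apply: iv.
Qed.

Lemma cdim_transport (I : set C) (J : set D) :
  subspace k I -> subspace l J -> fincodim k I ->
  (forall a, I a <-> J (h a)) -> (forall b, exists a, J (b - h a)) ->
  fincodim l J /\ cdim l J = cdim k I.
Proof.
move=> sI sJ /fincodimP/(codim_transport sJ) H IJ hd; have := H IJ hd => cJ.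
by split; [exists (cdim k I)|apply: cdimE].
Qed.
End CodimTransport.

Section ColengthCodim.
Variables (K : fieldType) (C : comPzRingType) (k : {rmorphism K -> C}).
Variable m : set C.
Hypotheses (im : is_ideal m) (m1 : ~ m 1) (mK : forall x, exists c, m (x - k c)).

Lemma cdim_residue : fincodim k m /\ cdim k m = 1%N.
Proof.
suff c1 : codim k m 1%N.
  by split; [exists 1%N|apply: cdimE => //; apply: ideal_subspace].
exists (fun _ => 1); split=> [x|c].
  by have [c mc] := mK x; exists (fun _ => c); rewrite /lincomb big_ord1 mulr1.
rewrite /lincomb big_ord1 mulr1 => mc i; rewrite ord1.
apply/eqP; apply: contraT => c0; exfalso; apply: m1.
by rewrite -(rmorph1 k) -(mulVf c0) rmorphM; apply: ideal_mull.
Qed.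

Lemma ichain_cdim I n J : fincodim k I -> ichain I n J -> (n <= cdim k I)%N.
Proof.
move=> fI [Ji J0 JT Js].
have H i : (i <= n)%N -> fincodim k (J i) /\ (i + cdim k (J i) <= cdim k I)%N.
  elim: i => [_|i IH ltin]; first by rewrite J0 add0n.
  have [fi le] := IH (ltnW ltin); have [JJ nJ] := Js i ltin.
  have sJi := ideal_subspace k (Ji i (ltnW ltin)).
  have sJ := ideal_subspace k (Ji i.+1 ltin).
  split; first exact: fincodimS fi.
  apply: leq_trans le; rewrite addSnnS leq_add2l ltnNge; apply/negP => le'.
  by apply: nJ; apply: cdim_eq_sub fi le'.
by have [_] := H n (leqnn n); apply: leq_trans; rewrite leq_addr.
Qed.

(** Take the largest power of m that is not contained in I; any of its elements
   outside I will do. *)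
Lemma socle_ex I N : is_ideal I -> ideal_exp m N `<=` I -> ~ I 1 ->
  exists2 a, ~ I a & forall x, m x -> I (a * x).
Proof.
move=> iI; elim: N => [|N IH] mI nI; first by case: nI; apply: mI.
have [H|] := EM (ideal_exp m N `<=` I); first exact: IH.
move=> /existsNP[a /not_implyP[ma nIa]]; exists a => // x mx.
by apply: mI; rewrite mulrC; apply: mem_ideal_mul.
Qed.

(** Each step of a chain of ideals raises the dimension. Conversely, the quotient by
   the annihilator of a socle element is the residue field, which m identifies with K;
   so adjoining such elements one at a time lowers the codimension by exactly one and
   builds a chain of maximal length. *)
Lemma colength_cdim I N : is_ideal I -> ideal_exp m N `<=` I -> fincodim k I ->
  colength I (cdim k I).
Proof.
move=> iI mI fI; split; last by move=> n J; apply: ichain_cdim.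
move: {-1}(cdim k I) (erefl (cdim k I)) => n; elim: n I iI mI fI => [|n IH] I iI mI fI dI.
  exists (fun _ => I); split=> //.
  exact: cdim_eq0 (ideal_subspace k iI) fI dI.
have nI1 : ~ I 1.
  by move=> I1; move: dI; rewrite (ideal1T iI I1) cdim_setT.
have [a nIa ma] := socle_ex iI mI nI1.
have iA := adj_ideal a iI.
have [fm dm] := cdim_residue.
have dA : cdim k (adj I a) = n.
  have := cdim_adj_colon a iI fI; rewrite dI.
  suff -> : cdim k (colon I a) = 1%N by rewrite addn1 => -[].
  apply/anti_leq/andP; split.
    rewrite -dm; apply: (cdimS _ _ fm); last by move=> x mx; apply: ma.
    exact/ideal_subspace/colon_ideal.
  apply: cdim_gt0; [exact: colon_ideal|exact: fincodim_colon|].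
  by rewrite /colon /= mulr1.
have [||J [Ji J0 JT Js]] := IH _ iA _ _ dA.
- by move=> x xm; apply: sub_adj; apply: mI.
- by apply: fincodimS fI; [exact: ideal_subspace|exact: sub_adj].
exists (fun i => if i is i'.+1 then J i' else I); split=> //.
  by case=> // i; apply: Ji.
case=> [_|i ltin]; last exact: Js.
rewrite J0; split; first exact: sub_adj.
by move=> H; apply: nIa; apply: H; apply: mem_adj1.
Qed.
End ColengthCodim.

(** * Power series *)

Module Series.
Import mpoly.

Section Series.
Variables (n : nat) (K : comNzRingType).
Notation S := (mpseries n K).
Implicit Types (f g h : S) (m : 'X_{1..n}) (N : nat).

Lemma scoef1 m : mpscoef (1 : S) m = (m == 0%MM)%:R. Proof. by []. Qed.
Lemma scoefD f g m : mpscoef (f + g) m = mpscoef f m + mpscoef g m.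
Proof. by []. Qed.
Lemma scoefB f g m : mpscoef (f - g) m = mpscoef f m - mpscoef g m.
Proof. by []. Qed.
Lemma scoef_sum (I : Type) (r : seq I) (P : pred I) (F : I -> S) m :
  mpscoef (\sum_(i <- r | P i) F i) m = \sum_(i <- r | P i) mpscoef (F i) m.
Proof. exact: (big_morph (fun f => mpscoef f m) (fun f g => scoefD f g m)). Qed.
Lemma scoefM f g m : mpscoef (f * g) m =
  \sum_(ab : 'X_{1..n < (mdeg m).+1, (mdeg m).+1} | m == (ab.1 + ab.2)%MM)
    mpscoef f ab.1 * mpscoef g ab.2.
Proof. by []. Qed.

Definition of_mpoly (p : {mpoly K[n]}) : S := MPSeries (fun m => p@_m).

Fact of_mpoly_zmod : zmod_morphism of_mpoly.
Proof. by move=> p q; apply: mpseriesP => m /=; rewrite mcoeffB. Qed.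
Fact of_mpoly_monoid : monoid_morphism of_mpoly.
Proof.
split=> [|p q]; first by apply: mpseriesP => m /=; rewrite mcoeff1.
by apply: mpseriesP => m; rewrite scoefM /= mcoeffM.
Qed.
HB.instance Definition _ :=
  GRing.isZmodMorphism.Build {mpoly K[n]} S of_mpoly of_mpoly_zmod.
HB.instance Definition _ :=
  GRing.isMonoidMorphism.Build {mpoly K[n]} S of_mpoly of_mpoly_monoid.

Definition cst : K -> S := of_mpoly \o @mpolyC n K.
HB.instance Definition _ := GRing.RMorphism.on cst.

Definition monom m : S := of_mpoly 'X_[m].

Lemma monomE i : monom U_(i)%MM = mpsX K i.
Proof. by apply: mpseriesP => m /=; rewrite mcoeffX eq_sym. Qed.
Lemma monomD m1 m2 : monom (m1 + m2)%MM = monom m1 * monom m2.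
Proof. by rewrite /monom mpolyXD rmorphM. Qed.
Lemma monom0 : monom 0%MM = 1.
Proof. by rewrite /monom mpolyX0 rmorph1. Qed.
Lemma monomMn m k : monom (m *+ k)%MM = monom m ^+ k.
Proof. by rewrite /monom -rmorphXn mpolyXn. Qed.
Lemma monom_prod m : monom m = \prod_i mpsX K i ^+ m i.
Proof.
rewrite {1}(multinomUE_id m) (big_morph monom monomD monom0).
by apply: eq_bigr => i _; rewrite monomMn monomE.
Qed.

Definition strunc b f : {mpoly K[n]} :=
  \sum_(m : 'X_{1..n < b}) mpscoef f m *: 'X_[m].
Lemma scoef_trunc b f m : (mdeg m < b)%N -> (strunc b f)@_m = mpscoef f m.
Proof. exact: mcoeff_mpoly. Qed.

(** The series of order at least N: the N-th power of the maximal ideal, by ordge_exp,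
   but with a membership test that looks at coefficients only. *)
Definition ordge N : set S := [set f | forall m, (mdeg m < N)%N -> mpscoef f m = 0].

Lemma scoef_cstM c f m : mpscoef (cst c * f) m = c * mpscoef f m.
Proof.
have h0 : (mdeg (0%MM : 'X_{1..n}) < (mdeg m).+1)%N by rewrite mdeg0.
rewrite scoefM (bigD1 (BMultinom h0, BMultinom (ltnSn (mdeg m)))) /=; last first.
  by rewrite add0m.
rewrite mcoeffC eqxx mulr1 big1 ?addr0 // => -[[a ha] [b hb]] /= /andP[/eqP E].
rewrite mcoeffC; have [a0|_] := eqVneq a 0%MM; last by rewrite mulr0 mul0r.
rewrite -pair_eqE /= -!val_eqE /= a0 eqxx /=.
by move: E; rewrite a0 add0m => ->; rewrite eqxx.
Qed.

Lemma ordge_ideal N : is_ideal (ordge N).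
Proof.
split=> [//|f g Hf Hg m mN|f g Hg m mN]; first by rewrite scoefD Hf ?Hg ?addr0.
rewrite scoefM big1 // => -[[a ha] [b hb]] /= /eqP E.
by rewrite Hg ?mulr0 //; apply: leq_ltn_trans mN; rewrite E mdegD leq_addl.
Qed.
Hint Resolve ordge_ideal : core.

Lemma ordgeD N f g : ordge N f -> ordge N g -> ordge N (f + g).
Proof. exact: idealD. Qed.
Lemma ordgeB N f g : ordge N f -> ordge N g -> ordge N (f - g).
Proof. exact: idealB. Qed.
Lemma ordgeMl N f g : ordge N g -> ordge N (f * g).
Proof. exact: ideal_mull. Qed.
Lemma ordgeMr N f g : ordge N f -> ordge N (f * g).
Proof. exact: ideal_mulr. Qed.
Lemma ordge_sum N (I : Type) (r : seq I) (P : pred I) (F : I -> S) :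
  (forall i, P i -> ordge N (F i)) -> ordge N (\sum_(i <- r | P i) F i).
Proof. exact: ideal_sum. Qed.

Lemma ordgeS M N : (M <= N)%N -> ordge N `<=` ordge M.
Proof. by move=> MN f H m mM; apply: H; apply: leq_trans MN. Qed.

Lemma ordge0 : ordge 0 = setT. Proof. by apply/seteqP; split. Qed.

Lemma ordgeM M N f g : ordge M f -> ordge N g -> ordge (M + N) (f * g).
Proof.
move=> Hf Hg m mN; rewrite scoefM big1 // => -[[a ha] [b hb]] /= /eqP E.
have [aM|Ma] := ltnP (mdeg a) M; first by rewrite Hf ?mul0r.
have [bN|Nb] := ltnP (mdeg b) N; first by rewrite Hg ?mulr0.
by move: mN; rewrite E mdegD ltnNge leq_add.
Qed.

Lemma ordgeX N f : ordge 1 f -> ordge N (f ^+ N).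
Proof.
move=> Hf; elim: N => [|N IH]; first by rewrite ordge0.
by rewrite exprS -add1n; apply: ordgeM.
Qed.

Lemma ordge_eq0 f : (forall N, ordge N f) -> f = 0.
Proof. by move=> H; apply: mpseriesP => m; apply: (H (mdeg m).+1). Qed.

Lemma ordge_eq f g : (forall N, ordge N (f - g)) -> f = g.
Proof. by move=> /ordge_eq0/eqP; rewrite subr_eq0 => /eqP. Qed.

Lemma ordge1P f : ordge 1 f <-> mpscoef f 0%MM = 0.
Proof.
split=> [|H m]; first by apply; rewrite mdeg0.
by rewrite ltnS leqn0 mdeg_eq0 => /eqP ->.
Qed.

Lemma ordge1_1 : ~ ordge 1 1.
Proof. by move=> /ordge1P/eqP; rewrite scoef1 eqxx oner_eq0. Qed.

Lemma strunc_ordge b f : ordge b (f - of_mpoly (strunc b f)).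
Proof. by move=> m mb; rewrite scoefB /= scoef_trunc // subrr. Qed.

Lemma ordge_monom m : ordge (mdeg m) (monom m).
Proof.
move=> k km; rewrite /= mcoeffX; case: eqP => // E.
by move: km; rewrite E ltnn.
Qed.

Lemma ordge_X i : ordge 1 (mpsX K i).
Proof. by rewrite -monomE; have := @ordge_monom U_(i)%MM; rewrite mdeg1. Qed.

Lemma scoef_monomM m g k : mpscoef (monom m * g) k =
  if (m <= k)%MM then mpscoef g (k - m)%MM else 0.
Proof.
case: ifP => [mk|/negP nmk].
  have hm : (mdeg m < (mdeg k).+1)%N.
    by rewrite ltnS -(submK mk) mdegD leq_addl.
  have hk : (mdeg (k - m)%MM < (mdeg k).+1)%N.
    by rewrite ltnS -{2}(submK mk) mdegD leq_addr.
  rewrite scoefM (bigD1 (BMultinom hm, BMultinom hk)) /=; last first.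
    by rewrite addmC submK.
  rewrite mcoeffX eqxx mul1r big1 ?addr0 // => -[[a ha] [b hb]] /= /andP[/eqP E].
  rewrite mcoeffX; have [am|_] := eqVneq m a; last by rewrite mul0r.
  rewrite -pair_eqE /= -!val_eqE /= -am eqxx /=.
  have -> : b = (k - m)%MM by rewrite E -am addmC addmK.
  by rewrite eqxx.
rewrite scoefM big1 // => -[[a ha] [b hb]] /= /eqP E.
rewrite mcoeffX; have [am|_] := eqVneq m a; last by rewrite mul0r.
by case: nmk; rewrite E am lem_addr.
Qed.

Lemma monom_div m f : (forall k, mpscoef f k != 0 -> (m <= k)%MM) ->
  f = monom m * MPSeries (fun k => mpscoef f (m + k)%MM).
Proof.
move=> H; apply: mpseriesP => k; rewrite scoef_monomM /=.
case: ifP => [mk|nmk]; first by rewrite addmC submK.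
by apply/eqP; apply: contraFT nmk; apply: H.
Qed.

(** Attach every monomial to the first variable that divides it. *)
Lemma ordgeSP N f : ordge N.+1 f ->
  exists2 g : 'I_n -> S, (forall i, ordge N (g i)) & f = \sum_i mpsX K i * g i.
Proof.
move=> Hf.
pose fi i : S := MPSeries (fun m =>
  if [pick i | m i != 0%N] == Some i then mpscoef f m else 0).
have fiE i : fi i = mpsX K i * MPSeries (fun k => mpscoef (fi i) (U_(i) + k)%MM).
  rewrite -monomE -monom_div // => k /=; case: pickP => [j kj|_]; last by rewrite eqxx.
  by case: (Some j =P Some i) => [[<-] _|_]; [rewrite lep1mP|rewrite eqxx].
exists (fun i => MPSeries (fun k => mpscoef (fi i) (U_(i) + k)%MM)).
  move=> i m mN /=; case: ifP => // _; apply: Hf.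
  by rewrite mdegD mdeg1 add1n ltnS.
transitivity (\sum_i fi i); last by apply: eq_bigr => i _; rewrite -fiE.
apply: mpseriesP => m; rewrite scoef_sum /=; case: pickP => [j mj|m0].
  rewrite (bigD1 j) //= eqxx big1 ?addr0 // => i ij.
  by case: (Some j =P Some i) => // -[ji]; rewrite ji eqxx in ij.
rewrite big1 => [|//]; apply: Hf; rewrite (_ : m = 0%MM) ?mdeg0 //.
by apply/mnmP => i; rewrite mnm0E; apply/eqP/negbFE/m0.
Qed.

Lemma ordge_exp N : ideal_exp (ordge 1) N = ordge N.
Proof.
elim: N => [|N IH]; first by rewrite ordge0.
apply/seteqP; split=> [|f /ordgeSP[g Hg ->]] /=.
  by rewrite IH; apply: ideal_mul_sub => // a b Ha Hb; rewrite -add1n; apply: ordgeM.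
apply: ideal_sum => // i _; apply: mem_ideal_mul; first exact: ordge_X.
by rewrite IH.
Qed.

(** There are infinitely many monomials in a series, but its part of degree at least N
   is a finite combination of monomials of degree N, with series as coefficients. *)
Lemma ordge_sub_monom N J : is_ideal J ->
  (forall m, mdeg m = N -> J (monom m)) -> ordge N `<=` J.
Proof.
elim: N J => [|N IH] J iJ H f.
  move=> _; rewrite (ideal1T iJ) //; rewrite -monom0; apply: H; exact: mdeg0.
move=> /ordgeSP[g Hg ->]; apply: ideal_sum => // i _.
apply: (IH (colon J (mpsX K i))) (Hg i); first exact: colon_ideal.
by move=> m mN; rewrite /colon /= -monomE -monomD; apply: H; rewrite mdegD mdeg1 mN.
Qed.

(** The coefficient at m is read off once the sequence no longer changes in degree
   mdeg m. *)
Lemma series_lim (s : nat -> S) : (forall N, ordge N (s N.+1 - s N)) ->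
  exists L, forall N, ordge N (L - s N).
Proof.
move=> Hs; exists (MPSeries (fun m => mpscoef (s (mdeg m).+1) m)) => N m mN.
rewrite scoefB /=; apply/eqP; rewrite subr_eq0; apply/eqP.
rewrite -(subnKC mN); elim: (N - _)%N => [|k IH]; first by rewrite addn0.
rewrite IH addnS; apply/esym/eqP; rewrite -subr_eq0 -scoefB; apply/eqP/Hs.
by rewrite addSn ltnS leq_addr.
Qed.

End Series.
Arguments cst n {K} c.
Arguments ordge {n K} N.
#[global] Hint Resolve ordge_ideal : core.

Section SeriesField.
Variables (n : nat) (K : fieldType).
Notation S := (mpseries n K).
Implicit Types (f g h : S) (m : 'X_{1..n}) (N : nat).

(** The geometric series inverts 1 - h when h has no constant term. *)
Lemma series_unit f : ~ ordge 1 f -> exists g, f * g = 1.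
Proof.
move=> /ordge1P/eqP f0; set c := mpscoef f 0%MM in f0.
pose h := 1 - cst n c^-1 * f.
have Hh : ordge 1 h.
  by apply/ordge1P; rewrite scoefB scoef1 scoef_cstM -/c mulVf // eqxx subrr.
have [N|L HL] := @series_lim _ _ (fun N => \sum_(i < N) h ^+ i).
  by rewrite big_ord_recr /= addrAC subrr add0r; apply: ordgeX.
exists (cst n c^-1 * L); apply: ordge_eq => N.
have E : f * cst n c^-1 = 1 - h by rewrite /h opprB addrC subrK mulrC.
rewrite mulrA E.
have -> : (1 - h) * L - 1 =
   (1 - h) * (L - \sum_(i < N) h ^+ i) - h ^+ N.
  have E2 : (1 - h) * (\sum_(i < N) h ^+ i) = 1 - h ^+ N.
    by rewrite -[LHS]opprK -mulNr opprB -subrX1 opprB.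
  by rewrite mulrBr E2; ring.
by apply: ordgeB; [apply: ordgeMl; exact: HL|exact: ordgeX].
Qed.

Lemma proper_sub_ordge1 (I : set S) : is_ideal I -> ~ I 1 -> I `<=` ordge 1.
Proof.
move=> iI nI f If; apply: contrapT => /series_unit[g fg]; apply: nI.
by rewrite -fg; apply: ideal_mulr.
Qed.

Lemma cst_residue f : exists c, ordge 1 (f - cst n c).
Proof.
exists (mpscoef f 0%MM); apply/ordge1P.
by rewrite scoefB -[cst n _]mulr1 scoef_cstM scoef1 eqxx mulr1 subrr.
Qed.

Lemma spans_monom (I : set S) N : ordge N `<=` I ->
  spans (cst n) I (fun m : 'X_{1..n < N} => monom K m).
Proof.
move=> NI f; exists (fun m : 'X_{1..n < N} => mpscoef f m); apply: NI.
suff -> : lincomb (cst n) (fun m : 'X_{1..n < N} => monom K m)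
  (fun m : 'X_{1..n < N} => mpscoef f m) = of_mpoly (strunc N f) by exact: strunc_ordge.
rewrite /lincomb rmorph_sum; apply: eq_bigr => m _.
by rewrite -mul_mpolyC rmorphM.
Qed.

Lemma fincodim_ordge (I : set S) N : is_ideal I -> ordge N `<=` I ->
  fincodim (cst n) I.
Proof.
move=> iI /spans_monom sI.
by have [] := cdim_leq_spans (ideal_subspace (cst n) iI) sI.
Qed.

End SeriesField.
End Series.

Import Series.

(** * Quotients of power series rings *)

Section ImageIdeal.
Variables (A B : comPzRingType) (h : {rmorphism A -> B}).
Hypothesis hs : forall b, exists a, h a = b.
Implicit Types I J : set A.

Lemma image_ideal I : is_ideal I -> is_ideal (h @` I).
Proof.
move=> iI; split; first by exists 0; [exact: ideal0|rewrite rmorph0].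
  move=> _ _ [a Ia <-] [b Ib <-]; exists (a + b); last by rewrite rmorphD.
  exact: idealD.
move=> b _ [a Ia <-]; have [c <-] := hs b; exists (c * a); last by rewrite rmorphM.
exact: ideal_mull.
Qed.

Lemma preimage_ideal (J : set B) : is_ideal J -> is_ideal [set a | J (h a)].
Proof.
move=> iJ; split=> /= [|a b|a b]; rewrite ?rmorph0 ?rmorphD ?rmorphM.
- exact: ideal0.
- exact: idealD.
- exact: ideal_mull.
Qed.

Lemma image_exp I N : h @` (ideal_exp I N) = ideal_exp (h @` I) N.
Proof.
elim: N => [|N IH] /=; first by apply/seteqP; split=> // b _; have [a <-] := hs b; exists a.
apply/seteqP; split=> [_ [a + <-]|].
  suff: ideal_mul I (ideal_exp I N) `<=`
    [set a | ideal_mul (h @` I) (ideal_exp (h @` I) N) (h a)] by exact.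
  apply: ideal_mul_sub; first exact: preimage_ideal.
  move=> x y Ix Iy /=; rewrite rmorphM; apply: mem_ideal_mul; first by exists x.
  by rewrite -IH; exists y.
apply: ideal_mul_sub; first exact: image_ideal.
move=> _ b [x Ix <-]; rewrite -IH => -[y Iy <-]; exists (x * y); last by rewrite rmorphM.
exact: mem_ideal_mul.
Qed.

Lemma image_frob I q : h @` (ideal_frob I q) = ideal_frob (h @` I) q.
Proof.
apply/seteqP; split=> [_ [a + <-]|].
  suff: ideal_frob I q `<=` [set a | ideal_frob (h @` I) q (h a)] by exact.
  apply: ideal_frob_sub; first exact: preimage_ideal.
  by move=> x Ix /=; rewrite rmorphXn; apply: ideal_frob_pow; exists x.
apply: ideal_frob_sub; first exact: image_ideal.
move=> _ [x Ix <-]; exists (x ^+ q); last by rewrite rmorphXn.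
exact: ideal_frob_pow.
Qed.

Lemma image_add I J : h @` (ideal_add I J) = ideal_add (h @` I) (h @` J).
Proof.
apply/seteqP; split=> [_ [_ [a Ia [b Jb <-]] <-]|_ [_ [a Ia <-] [_ [b Jb <-] <-]]].
  rewrite rmorphD; exists (h a); first by exists a.
  by exists (h b) => //; exists b.
by exists (a + b); [exists a => //; exists b|rewrite rmorphD].
Qed.

Lemma image_ker I : is_ideal I -> (forall a, h a = 0 -> I a) ->
  forall a, I a <-> (h @` I) (h a).
Proof.
move=> iI kI a; split=> [Ia|[b Ib hab]]; first by exists a.
by apply: (idealBr iI Ib); apply: kI; rewrite rmorphB hab subrr.
Qed.

Lemma colength_image I l : is_ideal I -> (forall a, h a = 0 -> I a) ->
  colength I l <-> colength (h @` I) l.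
Proof.
move=> iI kI; apply: (@colength_transport _ _ h); first exact: image_ideal.
  exact: image_ker.
by move=> b; have [a <-] := hs b; exists a; exists 0; [exact: ideal0|rewrite rmorph0 subrr].
Qed.
End ImageIdeal.

Lemma quot_pi_surj (A : comPzRingType) (G : set A) (b : quot G) :
  exists a, quot_pi G a = b.
Proof. by exists (quot_repr b); rewrite quot_reprK. Qed.

Lemma quot_pi_eq0 (A : comPzRingType) (G : set A) (a : A) :
  quot_pi G a = 0 <-> ideal_gen G a.
Proof. by rewrite -(rmorph0 (quot_pi G)) quot_eqP subr0. Qed.

Lemma image_quot_gen (A : comPzRingType) (G : set A) I : is_ideal I ->
  quot_pi G @` (ideal_add (ideal_gen G) I) = quot_pi G @` I.
Proof.
move=> iI; apply/seteqP; split=> [_ [_ [a /quot_pi_eq0 Ga [b Ib <-]] <-]|_ [a Ia <-]].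
  by exists b => //; rewrite rmorphD /= Ga add0r.
by exists a => //; apply: ideal_add_subr.
Qed.

Section SeriesQuotient.
Variables (n : nat) (K : fieldType) (G : set (mpseries n K)).
Hypothesis G1 : ~ ideal_gen G 1.
Notation S := (mpseries n K).
Notation pi := (quot_pi G).

Definition qmax : set (quot G) := pi @` (ordge 1).

(** The ideal m^N + m^[q] of the power series ring itself, in which all lengths will
   be computed. *)
Definition hsE N q : set S := ideal_add (ordge N) (ideal_frob (ordge 1) q).

Lemma hsE_ideal N q : is_ideal (hsE N q).
Proof. by apply: ideal_add_ideal. Qed.

Lemma proper_sub_qmax (I : set (quot G)) : is_ideal I -> ~ I 1 -> I `<=` qmax.
Proof.
move=> iI nI b; have [f <-] := quot_pi_surj b => If; exists f => //.
apply: (@proper_sub_ordge1 _ _ [set f | I (pi f)]) If; first exact: preimage_ideal.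
by rewrite /= rmorph1.
Qed.

Lemma gen_sub_ordge1 : ideal_gen G `<=` ordge 1.
Proof. by apply: proper_sub_ordge1. Qed.

Lemma qmax_ideal : is_ideal qmax.
Proof. by apply: image_ideal => //; exact: quot_pi_surj. Qed.

Lemma qmax_pi f : qmax (pi f) <-> ordge 1 f.
Proof.
symmetry; apply: image_ker => //; move=> a /quot_pi_eq0; exact: gen_sub_ordge1.
Qed.

Lemma qmax1 : ~ qmax 1.
Proof. by rewrite -(rmorph1 pi) => /qmax_pi/ordge1_1. Qed.

Lemma qmax_maximal : is_maximal_ideal qmax.
Proof.
split; [exact: qmax_ideal|exact: qmax1|move=> J iJ nJ mJ].
by apply/seteqP; split=> //; apply: proper_sub_qmax.
Qed.

Lemma maxideal_quot : maxideal (quot G) = qmax.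
Proof.
rewrite /maxideal; case: xgetP => [I _ [iI nI mI]|/(_ qmax)/(_ qmax_maximal)//].
by rewrite (mI qmax) //; [exact: qmax_ideal|exact: qmax1|exact: proper_sub_qmax].
Qed.

Lemma qmax_exp N : ideal_exp qmax N = pi @` (ordge N).
Proof. by rewrite -image_exp ?ordge_exp //; apply: quot_pi_surj. Qed.

Lemma qmax_exp_pi N f :
  ideal_exp qmax N (pi f) <-> ideal_add (ideal_gen G) (ordge N) f.
Proof.
rewrite qmax_exp -image_quot_gen //; symmetry; apply: image_ker.
  exact: ideal_add_ideal.
by move=> a /quot_pi_eq0 Ga; apply: ideal_add_subl.
Qed.

Lemma qmax_hs N q : ideal_add (ideal_exp qmax N) (ideal_frob qmax q) =
  pi @` (hsE N q).
Proof.
rewrite qmax_exp -image_frob ?image_add //; exact: quot_pi_surj.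
Qed.

Lemma colength_qmax_hs N q l :
  colength (ideal_add (ideal_gen G) (hsE N q)) l <->
  colength (ideal_add (ideal_exp qmax N) (ideal_frob qmax q)) l.
Proof.
have iE := hsE_ideal N q.
rewrite qmax_hs -image_quot_gen //; apply: colength_image.
- exact: quot_pi_surj.
- exact: ideal_add_ideal.
- by move=> a /quot_pi_eq0 Ga; apply: ideal_add_subl.
Qed.

End SeriesQuotient.
Arguments qmax {n K} G _.
Arguments hsE {n K} N q _.

(** * The completion of a local ring *)

Section CompletionPowers.
Variables (A : comPzRingType) (m : set A) (ys : seq A).
Hypothesis mys : m = ideal_gen [set` ys].
Notation C := (completion m).

Lemma quot_exp_eq N a b :
  quot_pi (ideal_exp m N) a = quot_pi (ideal_exp m N) b <-> ideal_exp m N (a - b).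
Proof. by rewrite quot_eqP ideal_gen_id. Qed.

Lemma comp_rep_leq (x : C) M N a : (M <= N)%N ->
  comp_val x N = quot_pi _ a -> comp_val x M = quot_pi _ a.
Proof.
move=> /subnK <-; elim: (N - M)%N => [//|k IH] E; apply: IH.
have {}E : comp_val x (k + M).+1 = quot_pi _ a := E.
have [b [xb ->]] := comp_coherent x (k + M)%N.
apply/quot_exp_eq; apply: ideal_expS_sub; apply/quot_exp_eq.
by rewrite -xb.
Qed.

Lemma comp_lim_proof (s : nat -> A) : (forall N, ideal_exp m N (s N.+1 - s N)) ->
  coherent (fun N => quot_pi (ideal_exp m N) (s N)).
Proof.
move=> Hs N; exists (s N.+1); split=> //; apply/esym/quot_exp_eq; exact: Hs.
Qed.

Lemma diag_proof a : coherent (fun N => quot_pi (ideal_exp m N) a).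
Proof. by move=> N; exists a. Qed.
Definition diag a : C := Completion (diag_proof a).

Fact diag_zmod : zmod_morphism diag.
Proof. by move=> a b; apply: completionP => N /=; rewrite rmorphB. Qed.
Fact diag_monoid : monoid_morphism diag.
Proof. by split=> [|a b]; apply: completionP => N /=; rewrite ?rmorph1 ?rmorphM. Qed.
HB.instance Definition _ := GRing.isZmodMorphism.Build A C diag diag_zmod.
HB.instance Definition _ := GRing.isMonoidMorphism.Build A C diag diag_monoid.

Definition comp_ker N : set C := [set x | comp_val x N = 0].

Lemma comp_ker_ideal N : is_ideal (comp_ker N).
Proof.
split=> [//|x y|x y]; rewrite /comp_ker /=.
  by move=> -> ->; rewrite addr0.
by move=> ->; rewrite mulr0.
Qed.
Hint Resolve comp_ker_ideal : core.

Lemma comp_ker_diag N a : comp_ker N (diag a) <-> ideal_exp m N a.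
Proof. by rewrite /comp_ker /= quot_pi_eq0 ideal_gen_id. Qed.

Lemma comp_ker_dense N (x : C) : exists a, comp_ker N (x - diag a).
Proof.
by exists (quot_repr (comp_val x N)); rewrite /comp_ker /= quot_reprK subrr.
Qed.

Lemma comp_ker_rep (x : C) N M : (N <= M)%N -> comp_ker N x ->
  exists2 a, comp_val x M = quot_pi _ a & ideal_exp m N a.
Proof.
move=> NM xN; have xM := esym (quot_reprK (comp_val x M)).
exists (quot_repr (comp_val x M)) => //; rewrite -[ideal_exp m N]ideal_gen_id //.
by rewrite -quot_pi_eq0 -(comp_rep_leq NM xM).
Qed.

Lemma ideal_mul_gen (L : set A) b : is_ideal L -> ideal_mul m L b ->
  exists2 c : 'I_(size ys) -> A, (forall i, L (c i)) & b = \sum_(i < size ys) ys`_i * c i.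
Proof.
move=> iL; suff: ideal_mul m L `<=` [set b |
    exists2 c : 'I_(size ys) -> A, (forall i, L (c i)) & b = \sum_(i < size ys) ys`_i * c i] by apply.
have iT : is_ideal [set b |
    exists2 c : 'I_(size ys) -> A, (forall i, L (c i)) & b = \sum_(i < size ys) ys`_i * c i].
  split.
  - exists (fun _ => 0) => [_|]; first exact: ideal0.
    by rewrite big1 // => i _; rewrite mulr0.
  - move=> _ _ [c Lc ->] [d Ld ->]; exists (fun i => c i + d i) => [i|].
      exact: idealD.
    by rewrite -big_split; apply: eq_bigr => i _; rewrite mulrDr.
  - move=> a _ [c Lc ->]; exists (fun i => a * c i) => [i|].
      exact: ideal_mull.
    by rewrite mulr_sumr; apply: eq_bigr => i _; rewrite mulrCA.
apply: ideal_mul_sub => // a c; rewrite mys => ma Lc.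
suff: ideal_gen [set` ys] `<=` colon [set b |
    exists2 c : 'I_(size ys) -> A, (forall i, L (c i)) & b = \sum_(i < size ys) ys`_i * c i] c.
  by move=> /(_ _ ma); rewrite /colon /= mulrC.
apply: ideal_gen_sub; first exact: colon_ideal.
move=> y /= yys; have iy : (index y ys < size ys)%N by rewrite index_mem.
exists (fun i => if i == Ordinal iy then c else 0) => [i|].
  by case: ifP => // _; apply: ideal0.
rewrite (bigD1 (Ordinal iy)) //= eqxx nth_index // big1 ?addr0 ?[c * y]mulrC //.
by move=> i /negPf ->; rewrite mulr0.
Qed.

(** An element of the kernel of the projection to A/m^(N+1) is the limit of
   representatives a M. Their successive differences lie in m^(N+M+1); write them over
   the finitely many generators y_i of m with coefficients in m^(N+M), and sum these
   coefficients for each i: this converges in the completion and expresses the element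
   as a combination of the y_i. *)
Lemma comp_ker_mul N : comp_ker N.+1 `<=` ideal_mul (comp_ker 1) (comp_ker N).
Proof.
move=> x xN.
pose a M := quot_repr (comp_val x (N + M.+1)%N).
have xaN M : comp_val x (N + M.+1)%N = quot_pi _ (a M) by rewrite quot_reprK.
have aS M : ideal_exp m (N + M).+1 (a M.+1 - a M).
  apply/quot_exp_eq; rewrite -addnS -xaN; apply/esym.
  by apply: (comp_rep_leq _ (xaN M.+1)); rewrite leq_add2l.
have a0 : ideal_exp m N.+1 (a 0%N).
  rewrite -[ideal_exp m N.+1]ideal_gen_id // -quot_pi_eq0 -(addn1 N) -xaN addn1.
  exact: xN.
(* The telescoping terms, the first one being the value of the approximation itself.
   *)
pose dl j := if j is j'.+1 then a j'.+1 - a j' else a 0%N.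
have dlP j : ideal_mul m (ideal_exp m (N + j.-1)) (dl j).
  by case: j => [|j] /=; rewrite ?addn0; [exact: a0|exact: aS].
have /choice[c cP] j : exists c : 'I_(size ys) -> A,
    (forall i, ideal_exp m (N + j.-1) (c i)) /\ dl j = \sum_(i < size ys) ys`_i * c i.
  by have [c ? ?] := ideal_mul_gen (ideal_exp_ideal m (N + j.-1)) (dlP j); exists c.
pose s i M := \sum_(j < M.+1) c j i.
have sS i M : ideal_exp m M (s i M.+1 - s i M).
  rewrite /s [X in X - _]big_ord_recr /= addrAC subrr add0r.
  by apply: ideal_exp_leq ((cP M.+1).1 i); rewrite leq_addl.
pose z i : C := Completion (comp_lim_proof (sS i)).
have -> : x = \sum_(i < size ys) diag ys`_i * z i.
  apply: completionP => M.
  rewrite (big_morph (fun y : C => comp_val y M) (fun _ _ => erefl) erefl) /=.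
  under eq_bigr do rewrite -rmorphM.
  rewrite -rmorph_sum.
  have -> : \sum_(i < size ys) ys`_i * s i M = a M.
    under eq_bigr do rewrite mulr_sumr.
    rewrite exchange_big /=; under eq_bigr => j _ do rewrite -(cP j).2.
    by elim: M => [|M IH]; [rewrite big_ord1|rewrite big_ord_recr IH /= addrC subrK].
  by apply: (comp_rep_leq _ (xaN M)); rewrite addnS ltnW // ltnS leq_addl.
apply: ideal_sum => // i _; apply: mem_ideal_mul.
  apply/comp_ker_diag; rewrite ideal_exp1 ?mys //.
  by apply: sub_ideal_gen; apply: mem_nth.
rewrite /comp_ker /= quot_pi_eq0 ideal_gen_id //; apply: ideal_sum => // j _.
by apply: ideal_exp_leq ((cP j).1 i); rewrite leq_addr.
Qed.

(** Together with comp_ker_diag this says that A and its completion have the same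
   quotients by the powers of their maximal ideals. It may fail when m is not finitely
   generated. *)
Lemma comp_ker_exp N : ideal_exp (comp_ker 1) N = comp_ker N.
Proof.
elim: N => [|N IH].
  apply/seteqP; split=> // x _; rewrite /comp_ker /= -[comp_val x 0]quot_reprK.
  by apply/quot_pi_eq0; rewrite ideal_gen_id.
rewrite [LHS]/= IH; apply/seteqP; split; last exact: comp_ker_mul.
apply: ideal_mul_sub => // x y x1 yN.
have [a xa ma] := comp_ker_rep (ltn0Sn N) x1.
have [b yb mb] := comp_ker_rep (leqnSn N) yN.
rewrite /comp_ker /= xa yb -rmorphM; apply/quot_pi_eq0.
by rewrite ideal_gen_id //; apply: (@ideal_expM _ m a b 1 N).
Qed.
End CompletionPowers.

Section CompletionQuotient.
Variables (A : comPzRingType) (m : set A) (ys : seq A).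
Hypotheses (im : is_ideal m) (m1 : ~ m 1).
Hypothesis mV : forall a, ~ m a -> exists b, m (a * b - 1).
Hypothesis mys : m = ideal_gen [set` ys].
Variables (n : nat) (K : fieldType) (G : set (mpseries n K)).
Hypothesis G1 : ~ ideal_gen G 1.
Variable phi : {rmorphism completion m -> quot G}.
Hypothesis phi_bij : bijective phi.

(** Both sides are the maximal ideal: the left one is proper, hence contained in the
   right one, and whatever lies outside of it is invertible modulo it. *)
Lemma phi_comp_ker1 : phi @` (comp_ker 1) = qmax G.
Proof.
have phis b : exists x, phi x = b by have [g _ gK] := phi_bij; exists (g b).
have iK := comp_ker_ideal m 1.
have sub : phi @` (comp_ker 1) `<=` qmax G.
  apply: proper_sub_qmax => //; first exact: image_ideal.
  move=> [x x1]; rewrite -(rmorph1 phi) => /(bij_inj phi_bij) E; move: x1; rewrite E.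
  by rewrite -(rmorph1 (@diag _ m)) => /comp_ker_diag; rewrite ideal_exp1.
apply/seteqP; split=> //.
move=> b; have [x <-] := phis b => qx; exists x => //.
have [a ax] := comp_ker_dense 1 x.
apply: (idealBl iK _ ax); apply/comp_ker_diag; rewrite ideal_exp1 //.
apply: contrapT => /mV[c mac]; apply: (qmax1 G1).
have xc : comp_ker 1 (x * diag m c - 1).
  have -> : x * diag m c - 1 = (x - diag m a) * diag m c + diag m (a * c - 1).
    by rewrite !rmorphB rmorphM rmorph1 /=; ring.
  apply: idealD => //; first exact: ideal_mulr.
  by apply/comp_ker_diag; rewrite ideal_exp1.
have : (phi @` (comp_ker 1)) (phi (x * diag m c - 1)) by exists (x * diag m c - 1).
move=> /sub; rewrite rmorphB rmorphM rmorph1 => H.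
exact: (idealBr (qmax_ideal G) (ideal_mulr _ (qmax_ideal G) qx) H).
Qed.

(** The composite of A -> completion -> K[[x]]/(G). All that will be used of the
   completion is theta_exp, that theta detects the powers of m, and theta_dense, that
   its image is dense. *)
Definition theta : A -> quot G := phi \o @diag A m.
HB.instance Definition _ := GRing.RMorphism.on theta.

Lemma phi_ker_exp N (x : completion m) : comp_ker N x <-> ideal_exp (qmax G) N (phi x).
Proof.
have phis b : exists x, phi x = b by have [g _ gK] := phi_bij; exists (g b).
rewrite -phi_comp_ker1 -image_exp // (comp_ker_exp mys).
by split=> [xN|[y yN /(bij_inj phi_bij) <-//]]; exists x.
Qed.

Lemma theta_exp N a : ideal_exp m N a <-> ideal_exp (qmax G) N (theta a).
Proof. by rewrite -comp_ker_diag phi_ker_exp. Qed.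

Lemma theta_dense N x : exists a, ideal_exp (qmax G) N (x - theta a).
Proof.
have [g _ gK] := phi_bij; have [a ag] := comp_ker_dense N (g x).
by exists a; rewrite -{1}(gK x) -rmorphB; apply/phi_ker_exp.
Qed.
End CompletionQuotient.

(** * Extension of ideals to the power series ring *)

Section Extension.
Variables (A : comPzRingType) (m : set A).
Hypotheses (im : is_ideal m).
Variables (n : nat) (K : fieldType) (G : set (mpseries n K)).
Hypothesis G1 : ~ ideal_gen G 1.
Variable th : {rmorphism A -> quot G}.
Notation S := (mpseries n K).
Notation pi := (quot_pi G).
Notation mQ := (qmax G).
Hypothesis th_exp : forall N a, ideal_exp m N a <-> ideal_exp mQ N (th a).
Hypothesis th_dense : forall N x, exists a, ideal_exp mQ N (x - th a).
Implicit Types (J : set A) (u v : S).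

(** The preimage in K[[x]] of the extension of J to the completion, up to order N;
   this approximation makes all codimensions finite. *)
Definition ext J N : set S :=
  [set u | exists2 a, J a & ideal_exp mQ N (pi u - th a)].

Definition extQ J N : set (quot G) :=
  [set x | exists2 a, J a & ideal_exp mQ N (x - th a)].

Lemma extQ_ideal J N : is_ideal J -> is_ideal (extQ J N).
Proof.
move=> iJ; split.
- by exists 0; [exact: ideal0|rewrite rmorph0 subr0; apply: ideal0].
- move=> x y [a Ja xa] [b Jb yb]; exists (a + b); first exact: idealD.
  by rewrite rmorphD opprD addrACA; apply: idealD.
- move=> x y [a Ja ya]; have [b xb] := th_dense N x.
  exists (b * a); first exact: ideal_mull.
  have -> : x * y - th (b * a) = x * (y - th a) + th a * (x - th b).
    by rewrite rmorphM; ring.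
  by apply: idealD => //; apply: ideal_mull.
Qed.

Lemma ext_ideal J N : is_ideal J -> is_ideal (ext J N).
Proof. by move=> iJ; exact: (@preimage_ideal _ _ pi (extQ J N) (extQ_ideal N iJ)). Qed.

Lemma extS J J' N : J `<=` J' -> ext J N `<=` ext J' N.
Proof. by move=> JJ u [a /JJ ? ?]; exists a. Qed.

Lemma gen_sub_ext J N : is_ideal J -> ideal_gen G `<=` ext J N.
Proof.
move=> iJ u /quot_pi_eq0 u0; exists 0; first exact: ideal0.
by rewrite u0 rmorph0 subr0; apply: ideal0.
Qed.

Lemma ordge_sub_ext J N : is_ideal J -> ordge N `<=` ext J N.
Proof.
move=> iJ u uN; exists 0; first exact: ideal0.
by rewrite rmorph0 subr0; apply/qmax_exp_pi; apply: ideal_add_subr.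
Qed.

Lemma fincodim_ext J N : is_ideal J -> fincodim (cst n) (ext J N).
Proof.
move=> iJ; apply: (fincodim_ordge (ext_ideal N iJ)).
exact: ordge_sub_ext.
Qed.

Lemma mem_ext J N u a : J a -> pi u = th a -> ext J N u.
Proof. by move=> Ja E; exists a; rewrite // E subrr; apply: ideal0. Qed.

Lemma ext_mem J N u a : is_ideal J -> ideal_exp m N `<=` J -> ext J N u ->
  pi u = th a -> J a.
Proof.
move=> iJ mJ [b Jb ub] ua; apply: (idealBl iJ Jb); apply: mJ.
by apply/th_exp; rewrite rmorphB -ua.
Qed.

Lemma colength_ext J N l : is_ideal J -> ideal_exp m N `<=` J ->
  colength J l <-> colength (ext J N) l.
Proof.
move=> iJ mJ; have iQ := extQ_ideal N iJ.
rewrite (@colength_transport _ _ th J (extQ J N) l) //.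
- symmetry; apply: (@colength_transport _ _ pi) => // x.
  have [u <-] := quot_pi_surj x; exists u; rewrite subrr; exact: ideal0.
- move=> a; split=> [Ja|[b Jb H]]; first by exists a => //; rewrite subrr; apply: ideal0.
  by apply: (idealBl iJ Jb); apply: mJ; apply/th_exp; rewrite rmorphB.
- move=> x; have [a xa] := th_dense N x; exists a; exists 0; first exact: ideal0.
  by rewrite rmorph0 subr0.
Qed.

(** This allows cdim_adj_colon to be applied to ideals of A through power series. *)
Lemma ext_adj J N a u : is_ideal J -> pi u = th a ->
  ext (adj J a) N = adj (ext J N) u.
Proof.
move=> iJ ua; apply/seteqP; split=> [v [_ [b Jb [t ->]] H]|].
  have [w wt] := quot_pi_surj (th t).
  exists (v - u * w); last by exists w; rewrite subrK.
  exists b => //; congr (ideal_exp _ _ _): H.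
  by rewrite !rmorphB !rmorphD !rmorphM /= ua wt; ring.
apply: adj_sub; first exact/ext_ideal/adj_ideal.
  by apply: extS; apply: sub_adj.
by apply: mem_ext ua; apply: mem_adj1.
Qed.

(** The images of m^N and m^[q] under theta generate, together with G and the series
   of order N, the same ideal of K[[x]] as m^N + m^[q] there: an element of the
   maximal ideal of K[[x]] differs from a lift of an element of m by a series of order
   N, and q-th powers preserve this congruence. *)
Lemma ext_hs N q : ext (ideal_add (ideal_exp m N) (ideal_frob m q)) N =
  ideal_add (ideal_gen G) (hsE N q).
Proof.
have iE := @hsE_ideal n K N q.
have iR : is_ideal (ideal_add (ideal_gen G) (hsE N q)) by apply: ideal_add_ideal.
have iL : is_ideal (ideal_add (ideal_exp m N) (ideal_frob m q)) by apply: ideal_add_ideal.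
have [N0|N0] := posnP N.
  subst N.
  apply: (@etrans _ _ setT); last apply: esym.
    apply: (ideal1T (ext_ideal 0 iL)).
    by exists 0; first exact: ideal0.
  apply: (ideal1T iR); apply: ideal_add_subr; first exact: ideal_gen_ideal.
  by apply: ideal_add_subl; [exact: ideal_frob_ideal|rewrite ordge0].
have NR : ordge N `<=` ideal_add (ideal_gen G) (hsE N q).
  by move=> u uN; apply: ideal_add_subr => //; apply: ideal_add_subl.
have GR : ideal_gen G `<=` ideal_add (ideal_gen G) (hsE N q).
  exact: ideal_add_subl.
have NGR u : ideal_exp mQ N (pi u) -> ideal_add (ideal_gen G) (hsE N q) u.
  by move=> /qmax_exp_pi; apply: ideal_add_sub.
apply/seteqP; split.
- have H : ideal_add (ideal_exp m N) (ideal_frob m q) `<=`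
      [set a | forall u, pi u = th a -> ideal_add (ideal_gen G) (hsE N q) u].
    have iT : is_ideal [set a | forall u, pi u = th a ->
        ideal_add (ideal_gen G) (hsE N q) u].
      split=> [u|a b Ha Hb u ua|a b Hb u uab].
      + by rewrite rmorph0 => /quot_pi_eq0; apply: GR.
      + have [v va] := quot_pi_surj (th a).
        rewrite -[u](subrK v); apply: idealD => //; last exact: Ha.
        by apply: Hb; rewrite rmorphB /= ua va rmorphD addrC addKr.
      + have [v vb] := quot_pi_surj (th b); have [w wa] := quot_pi_surj (th a).
        rewrite -[u](subrK (w * v)); apply: idealD => //.
          by apply: GR; apply/quot_pi_eq0; rewrite rmorphB !rmorphM /= uab vb wa rmorphM subrr.
        by apply: ideal_mull => //; apply: Hb.
    apply: ideal_add_sub => //.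
      by move=> a /th_exp aN u ua; apply: NGR; rewrite ua.
    apply: ideal_frob_sub => // a ma u ua.
    have [v va] := quot_pi_surj (th a).
    rewrite -[u](subrK (v ^+ q)); apply: idealD => //.
      by apply: GR; apply/quot_pi_eq0; rewrite rmorphB !rmorphXn /= ua va rmorphXn subrr.
    apply: ideal_add_subr => //; apply: ideal_add_subr => //; apply: ideal_frob_pow.
    apply/(qmax_pi G1); rewrite va -[qmax G]ideal_exp1; last exact: qmax_ideal.
    by apply/th_exp; rewrite ideal_exp1.
  move=> u [a /H Ha ua]; have [v va] := quot_pi_surj (th a).
  rewrite -[u](subrK v); apply: idealD => //; last exact: Ha.
  by apply: NGR; rewrite rmorphB /= va.
- apply: ideal_add_sub; [exact: ext_ideal|exact: gen_sub_ext|].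
  apply: ideal_add_sub; [exact: ext_ideal|exact: ordge_sub_ext|].
  apply: ideal_frob_sub; first exact: ext_ideal.
  move=> v /(qmax_pi G1) mv; have [a va] := th_dense N (pi v).
  exists (a ^+ q).
    apply: ideal_add_subr => //; apply: ideal_frob_pow.
    rewrite -[m]ideal_exp1 //; apply/th_exp; rewrite ideal_exp1; last exact: qmax_ideal.
    apply: (idealBr (qmax_ideal G) mv).
    rewrite -[qmax G]ideal_exp1; last exact: qmax_ideal.
    exact: ideal_exp_leq va.
  by rewrite !rmorphXn /= subrXX; apply: ideal_mulr.
Qed.
End Extension.

(** * Noetherian local rings *)

Section Noetherian.
Variable A : comPzRingType.
Hypothesis nA : noetherian A.
Implicit Types (I J L P Q : set A) (l : seq (set A)).

Lemma noeth_max (Pr : set A -> Prop) I0 : is_ideal I0 -> Pr I0 ->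
  exists I, [/\ is_ideal I, Pr I & forall J, is_ideal J -> Pr J -> I `<=` J -> J `<=` I].
Proof.
move=> iI0 PI0; apply: contrapT => /forallNP H.
pose T := {I : set A | is_ideal I /\ Pr I}.
have step (x : T) : exists y : T, sval x `<` sval y.
  have [iI PI] := svalP x; apply: contrapT => nx; apply: (H (sval x)); split=> //.
  move=> J iJ PJ xJ; apply: contrapT => nJ; apply: nx.
  by exists (exist _ J (conj iJ PJ)).
have /choice[f Hf] := step.
pose s i : T := iter i f (exist _ I0 (conj iI0 PI0)).
have sS i j : (i <= j)%N -> sval (s i) `<=` sval (s j).
  move=> /subnK <-; elim: (j - i)%N => [//|k IH] a /IH; apply: (Hf _).1.
pose U : set A := [set a | exists i, sval (s i) a].
have iU : is_ideal U.
  split; first by exists 0%N; apply: ideal0; case: (svalP (s 0%N)).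
    move=> a b [i ai] [j bj]; exists (maxn i j); apply: idealD.
    - by case: (svalP (s (maxn i j))).
    - by apply: sS ai; apply: leq_maxl.
    - by apply: sS bj; apply: leq_maxr.
  by move=> a b [i bi]; exists i; apply: ideal_mull => //; case: (svalP (s i)).
have [gs Ugs] := nA iU.
have [i Ui] : exists i, forall a, a \in gs -> sval (s i) a.
  have : forall a, a \in gs -> U a by move=> a ags; rewrite Ugs; apply: sub_ideal_gen.
  elim: gs {Ugs} => [|g gs IH] Hg; first by exists 0%N.
  have [i Hi] := IH (fun a ags => Hg a (mem_behead (s := g :: gs) ags)).
  have [j gj] := Hg g (mem_head g gs).
  exists (maxn i j) => a; rewrite inE => /predU1P[->|/Hi].
    by apply: sS gj; apply: leq_maxr.
  by apply: sS; apply: leq_maxl.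
have [_ nf] := Hf (s i); apply: nf => a ai.
have : U a by exists i.+1.
by rewrite Ugs; apply: ideal_gen_sub => //; case: (svalP (s i)).
Qed.

Lemma proper_sub_max I : is_ideal I -> ~ I 1 ->
  exists M, is_maximal_ideal M /\ I `<=` M.
Proof.
move=> iI nI; have [M [iM [IM nM] mM]] :=
  @noeth_max (fun J => I `<=` J /\ ~ J 1) I iI (conj (fun _ => id) nI).
exists M; split=> //; split=> // J iJ nJ MJ; apply/seteqP; split=> //.
by apply: mM => //; split=> // a /IM /MJ.
Qed.

Lemma maximal_prime P : is_maximal_ideal P -> is_prime_ideal P.
Proof.
move=> [iP nP mP]; split=> // a b Pab.
have [Pa|nPa] := EM (P a); [by left|right].
have iA := adj_ideal a iP.
have [[c Pc [t E]]|nA1] := EM (adj P a 1).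
  rewrite -[b]mulr1 E mulrDr; apply: idealD => //; first exact: ideal_mull.
  by rewrite mulrCA mulrA; apply: ideal_mulr.
by case: nPa; rewrite -(mP _ iA nA1 (@sub_adj _ P a)); apply: mem_adj1.
Qed.

Definition prodI l : set A := foldr (@ideal_mul A) setT l.

Lemma prodI_ideal l : is_ideal (prodI l).
Proof. by case: l => //= *; exact: ideal_mul_ideal. Qed.
Hint Resolve prodI_ideal : core.

Lemma prodI_cat l1 l2 J : is_ideal J -> (forall x y, prodI l1 x -> prodI l2 y -> J (x * y)) ->
  prodI (l1 ++ l2) `<=` J.
Proof.
move=> iJ H; elim: l1 J iJ H => [|P l1 IH] J iJ H /=.
  by move=> x px; rewrite -[x]mul1r; apply: H.
apply: ideal_mul_sub => // x y Px l12y.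
apply: (IH (colon J x)) l12y; first exact: colon_ideal.
by move=> u v l1u l2v; rewrite /colon /= mulrA; apply: H => //; apply: mem_ideal_mul.
Qed.

Lemma prime_prodI P l : is_prime_ideal P -> prodI l `<=` P ->
  exists2 Q, Q \in l & Q `<=` P.
Proof.
move=> [iP nP pP]; elim: l => [|Q l IH] /= lP; first by case: nP; apply: lP.
have [QP|/existsNP[a /not_implyP[Qa nPa]]] := EM (Q `<=` P).
  by exists Q => //; rewrite mem_head.
have [|R Rl RP] := IH; last by exists R => //; rewrite inE Rl orbT.
by move=> b lb; have [] := pP a b (lP _ (mem_ideal_mul Qa lb)).
Qed.

(** Consider an ideal maximal among those with no such product of primes. It is proper
   and not prime, so it contains a product a b without a and b; adjoining a,
   respectively b, gives larger ideals, and the product of their two families of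
   primes lands in the ideal. *)
Lemma noeth_primes I : is_ideal I -> exists l,
  (forall P, P \in l -> is_prime_ideal P /\ I `<=` P) /\ prodI l `<=` I.
Proof.
move=> iI; apply: contrapT => nI.
have [J [iJ nJ mJ]] := @noeth_max (fun J => ~ exists l,
  (forall P, P \in l -> is_prime_ideal P /\ J `<=` P) /\ prodI l `<=` J) I iI nI.
have good L : is_ideal L -> J `<=` L -> ~ L `<=` J -> exists l,
    (forall P, P \in l -> is_prime_ideal P /\ L `<=` P) /\ prodI l `<=` L.
  by move=> iL JL nL; apply: contrapT => bL; apply: nL; exact: (mJ L iL bL JL).
have J1 : ~ J 1.
  by move=> J1; apply: nJ; exists [::]; split=> // a _; rewrite (ideal1T iJ J1).
have [pJ|npJ] := EM (is_prime_ideal J).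
  apply: nJ; exists [:: J]; split=> [P|]; first by rewrite inE => /eqP ->; split.
  by apply: ideal_mul_sub => // a b Ja _; apply: ideal_mulr.
have [a [b [Jab nJa nJb]]] : exists a b, [/\ J (a * b), ~ J a & ~ J b].
  apply: contrapT => H; apply: npJ; split=> // a b Jab.
  have [Ja|nJa] := EM (J a); [by left|right].
  by apply: contrapT => nJb; apply: H; exists a, b.
have notin c : ~ J c -> ~ adj J c `<=` J.
  by move=> nJc H; apply: nJc; apply: H; apply: mem_adj1.
have [l1 [H1 P1]] := good _ (adj_ideal a iJ) (@sub_adj _ J a) (notin a nJa).
have [l2 [H2 P2]] := good _ (adj_ideal b iJ) (@sub_adj _ J b) (notin b nJb).
apply: nJ; exists (l1 ++ l2); split.
  move=> P; rewrite mem_cat => /orP[/H1|/H2] [pP HP]; split=> // x Jx; apply: HP; exact: sub_adj.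
apply: prodI_cat => // x y /P1[u Ju [s ->]] /P2[v Jv [t ->]].
have -> : (u + a * s) * (v + b * t) = (v + b * t) * u + a * s * v + s * t * (a * b).
  by ring.
by apply: idealD => //; [apply: idealD => //|]; apply: ideal_mull.
Qed.

(** Induction on the number of primes, which may be assumed pairwise incomparable with
   the first one. Given g in I outside the other primes, if g lies in the first one
   then add an element of I that lies in all the others but not in the first one. *)
Lemma prime_avoidance l I : is_ideal I ->
  (forall P, P \in l -> is_prime_ideal P /\ ~ I `<=` P) ->
  exists2 f, I f & forall P, P \in l -> ~ P f.
Proof.
move=> iI; move: {2}(size l) (leqnn (size l)) => k; elim: k l => [|k IH] l.
  by case: l => // _ _; exists 0; [exact: ideal0|].
case: l => [|P l] ltk H; first by exists 0; [exact: ideal0|].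
have Hl Q : Q \in l -> is_prime_ideal Q /\ ~ I `<=` Q.
  by move=> Ql; apply: H; rewrite inE Ql orbT.
have [pP nIP] := H P (mem_head P l); have [iP nP1 PM] := pP.
have [[Q Ql QP]|nsub] := EM (exists2 Q, Q \in l & Q `<=` P).
  have [||f If Hf] := IH (P :: rem Q l).
  - by rewrite /= size_rem //; case: (l) Ql ltk.
  - move=> R; rewrite inE => /predU1P[-> //|/mem_rem]; exact: Hl.
  exists f => // R; rewrite inE => /predU1P[->|Rl]; first exact/Hf/mem_head.
  have [->|neq] := eqVneq R Q.
    by move=> /QP; apply: Hf; apply: mem_head.
  apply: Hf; rewrite inE; apply/orP; right; move: Rl.
  by rewrite (perm_mem (perm_to_rem Ql)) inE (negPf neq).
have [g Ig Hg] := IH l ltk Hl.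
have [Pg|nPg] := EM (P g); last first.
  by exists g => // R; rewrite inE => /predU1P[->|/Hg].
have [h [Ih nPh Hh]] : exists h, [/\ I h, ~ P h & forall Q, Q \in l -> Q h].
  have {}nsub Q : Q \in l -> ~ Q `<=` P by move=> Ql QP; apply: nsub; exists Q.
  elim: l nsub Hl {H ltk Hg IH} => [|Q l IHl] nsub Hl.
    by have /existsNP[h /not_implyP[Ih nPh]] := nIP; exists h.
  have [R Rl|R Rl|h [Ih nPh Hh]] := IHl.
  - by apply: nsub; rewrite inE Rl orbT.
  - by apply: Hl; rewrite inE Rl orbT.
  have /existsNP[c /not_implyP[Qc nPc]] := nsub Q (mem_head Q l).
  exists (h * c); split; first exact: ideal_mulr.
    by move=> /PM[].
  move=> R; rewrite inE => /predU1P[->|Rl].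
    by apply: ideal_mull => //; have [[]] := Hl Q (mem_head Q l).
  apply: ideal_mulr; last exact: Hh.
  by have [|[]] := Hl R => //; rewrite inE Rl orbT.
(* h avoids P and lies in the other primes, g the other way around. *)
exists (g + h); first exact: idealD.
move=> R; rewrite inE => /predU1P[->|Rl].
  move=> Pgh; apply: nPh; have -> : h = (g + h) - g by ring.
  exact: idealB.
move=> Rgh; apply: (Hg R Rl); have -> : g = (g + h) - h by ring.
by have [[iR _ _] _] := Hl R Rl; apply: idealB => //; apply: Hh.
Qed.

(** The dimension of A/I is at most d. *)
Definition dimle I d :=
  forall n (P : nat -> set A), prime_chain n P -> I `<=` P 0%N -> (n <= d)%N.

Section Local.
Variable m : set A.
Hypothesis mP : forall I, is_maximal_ideal I <-> I = m.

Let mm : is_maximal_ideal m. Proof. exact/mP. Qed.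
Let im : is_ideal m. Proof. by case: mm. Qed.

Lemma local_maxideal : maxideal A = m.
Proof. by rewrite /maxideal; case: xgetP => [I _ /mP|/(_ m)/(_ mm)]. Qed.

Lemma local_proper I : is_ideal I -> ~ I 1 -> I `<=` m.
Proof. by move=> iI nI; have [M [/mP -> IM]] := proper_sub_max iI nI. Qed.

Lemma local_unit a : ~ m a -> exists b, a * b = 1.
Proof.
move=> nma; have i0 := ideal_set0 A; have iA := adj_ideal a i0.
have [|nA1] := EM (adj [set 0] a 1).
  by move=> [_ /= -> [t E]]; exists t; rewrite E add0r.
by case: nma; apply: (local_proper iA nA1); apply: mem_adj1.
Qed.

Lemma prime_sub_local P : is_prime_ideal P -> P `<=` m.
Proof. by move=> [iP nP _]; apply: local_proper. Qed.

Lemma prime_eq_local P : is_prime_ideal P -> m `<=` P -> P = m.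
Proof. by move=> pP mP'; apply/seteqP; split=> //; apply: prime_sub_local. Qed.

Lemma prodI_local l : (forall P, P \in l -> P = m) -> prodI l = ideal_exp m (size l).
Proof.
elim: l => //= P l IH H; rewrite (H P) ?mem_head // IH // => Q Ql.
by apply: H; rewrite inE Ql orbT.
Qed.

Lemma local_exp_sub I : is_ideal I ->
  (forall P, is_prime_ideal P -> I `<=` P -> m `<=` P) ->
  exists t, ideal_exp m t `<=` I.
Proof.
move=> iI H; have [l [Hl lI]] := noeth_primes iI.
exists (size l); rewrite -prodI_local // => P Pl.
by have [pP IP] := Hl P Pl; apply: prime_eq_local => //; apply: H.
Qed.

Lemma dimle0_exp I : is_ideal I -> dimle I 0 -> exists t, ideal_exp m t `<=` I.
Proof.
move=> iI dI; apply: local_exp_sub => // P pP IP; apply: contrapT => nmP.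
suff: (1 <= 0)%N by [].
apply: (dI 1%N (fun i => if i is 0%N then P else m)) => //; split.
  by case=> [|[|]] // _; apply: maximal_prime.
by case=> // _; split=> //; apply: prime_sub_local.
Qed.

(** Prime avoidance provides f in m outside the minimal primes of I other than m. A
   chain of primes that contain I and f can be extended downwards by such a minimal
   prime. *)
Lemma dimle_parameter I d : is_ideal I -> dimle I d.+1 ->
  exists2 f, m f & dimle (adj I f) d.
Proof.
move=> iI dI; have [l [Hl lI]] := noeth_primes iI.
have [P|f mf Hf] := @prime_avoidance [seq P <- l | P != m] m im.
  rewrite mem_filter => /andP[/eqP nPm /Hl[pP _]]; split=> //.
  by move=> /(prime_eq_local pP).
exists f => // n Q [Qp Qs] IQ.
have Q0p := Qp 0%N (leq0n n).
have [P Pl PQ] : exists2 P, P \in l & P `<=` Q 0%N.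
  by apply: prime_prodI => // a /lI Ia; apply: IQ; apply: sub_adj.
have [Pm|nPm] := eqVneq P m.
  case: n Qp Qs => // n Qp Qs; have [_ []] := Qs 0%N isT.
  by apply: subset_trans (prime_sub_local (Qp 1%N isT)) _; rewrite -Pm.
have nPf : ~ P f by apply: Hf; rewrite mem_filter nPm.
have [pP IP] := Hl P Pl.
suff: (n.+1 <= d.+1)%N by [].
apply: (dI n.+1 (fun i => if i is i'.+1 then Q i' else P)) => //; split.
  by case.
case=> [_|i]; last exact: Qs.
split=> // QP; apply: nPf; apply: QP; apply: IQ; apply: mem_adj1.
exact: iI.
Qed.

(** Remove the generators one by one: a generator y satisfies y = u + c y + v with c
   in m, and 1 - c is invertible. *)
Lemma nakayama_adjs ys J : is_ideal J ->
  adjs J ys `<=` ideal_add (ideal_mul m (adjs J ys)) J -> adjs J ys `<=` J.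
Proof.
move=> iJ; elim: ys => [_ x|y ys IH] //=; set L := adjs J ys in IH *.
have iL : is_ideal L by apply: adjs_ideal.
have JL : J `<=` L by apply: sub_adjs.
have iA := adj_ideal y iL.
move=> H; suff Ly : L y.
  have E : adj L y = L by apply/seteqP; split; [exact: adj_sub|exact: sub_adj].
  by rewrite E in H *; apply: IH.
have sub : ideal_mul m (adj L y) `<=` [set a | exists2 u, L u & exists2 c, m c & a = u + c * y].
  apply: ideal_mul_sub => [|a _ ma [u Lu [t ->]]]; last first.
    exists (a * u); first exact: ideal_mull.
    by exists (a * t); [exact: ideal_mulr|ring].
  split.
  - by exists 0; [exact: ideal0|exists 0; [exact: ideal0|ring]].
  - move=> _ _ [u Lu [c mc ->]] [v Lv [e me ->]]; exists (u + v); first exact: idealD.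
    by exists (c + e); [exact: idealD|ring].
  - move=> b _ [u Lu [c mc ->]]; exists (b * u); first exact: ideal_mull.
    by exists (b * c); [exact: ideal_mull|ring].
have [_ /sub[u Lu [c mc ->]] [v /JL Lv E]] := H y (mem_adj1 y iL).
have [b Eb] : exists b, (1 - c) * b = 1.
  apply: local_unit => m1c; case: mm => _ + _; apply.
  by rewrite -[1](subrK c); apply: idealD.
have -> : y = b * (u + v).
  have -> : u + v = y * (1 - c).
    by transitivity (y - c * y); [rewrite -{1}E|]; ring.
  by rewrite mulrCA [b * _]mulrC Eb mulr1.
by apply: ideal_mull => //; apply: idealD.
Qed.

Lemma nakayama L J : is_ideal L -> is_ideal J -> J `<=` L ->
  L `<=` ideal_add (ideal_mul m L) J -> L `<=` J.
Proof.
move=> iL iJ JL; have [ys E] := nA iL.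
have -> : L = adjs J ys.
  apply/seteqP; split.
    rewrite E; apply: ideal_gen_sub; first exact: adjs_ideal.
    by move=> y /= yys; apply: mem_adjs.
  by apply: adjs_sub => // y yys; rewrite E; apply: sub_ideal_gen.
exact: nakayama_adjs.
Qed.

(** Let L be the intersection of the J + m^M; by Nakayama it is enough that L is
   contained in N = m L + J. Choose Q maximal among the ideals that contain N and meet
   L inside N. Every y in m has a power in Q: the ideals (Q : y^t) are eventually
   constant, and then Q + (y^t) still meets L inside N. So m^t is contained in Q for
   some t, and L, which is contained in J + m^t, is contained in Q. *)
Lemma krull_intersection J x : is_ideal J ->
  (forall M, ideal_add J (ideal_exp m M) x) -> J x.
Proof.
move=> iJ; pose L : set A := [set x | forall M, ideal_add J (ideal_exp m M) x].
have iD M : is_ideal (ideal_add J (ideal_exp m M)) by apply: ideal_add_ideal.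
have iL : is_ideal L.
  split=> [M|a b La Lb M|a b Lb M]; [exact: ideal0|exact: idealD|exact: ideal_mull].
have JL : J `<=` L by move=> a Ja M; apply: ideal_add_subl.
suff: L `<=` J by exact.
apply: nakayama => //.
pose N := ideal_add (ideal_mul m L) J.
have iN : is_ideal N by apply: ideal_add_ideal.
have JN : J `<=` N by apply: ideal_add_subr.
have [Q [iQ [NQ QLN] Qmax]] := @noeth_max (fun Q => N `<=` Q /\ Q `&` L `<=` N) N iN
  (conj (fun _ => id) (@subIsetl _ _ _)).
have powQ y : m y -> exists t, Q (y ^+ t).
  move=> my.
  have iCt t : is_ideal (colon Q (y ^+ t)) by apply: colon_ideal.
  have [_ [_ [t ->] tmax]] := @noeth_max (fun I => exists t, I = colon Q (y ^+ t))
    _ (iCt 0%N) (ex_intro _ 0%N erefl).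
  have st a : Q (y ^+ t.+1 * a) -> Q (y ^+ t * a).
    apply: (tmax _ (iCt t.+1) (ex_intro _ t.+1 erefl) _ a) => b Qb.
    by rewrite /colon /= exprS -mulrA; apply: ideal_mull.
  exists t; apply: (Qmax (adj Q (y ^+ t))); first exact: adj_ideal.
  - split; first by move=> a /NQ; apply: sub_adj.
    move=> _ [[q Qq [c ->]] Ll]; apply: QLN; split=> //.
    apply: idealD => //; apply: st.
    have : Q (y * (q + y ^+ t * c)).
      by apply: NQ; apply: ideal_add_subl => //; apply: mem_ideal_mul.
    have -> : y ^+ t.+1 * c = y * (q + y ^+ t * c) - y * q by rewrite exprS; ring.
    by move=> ?; apply: idealB => //; apply: ideal_mull.
  - exact: sub_adj.
  - exact: mem_adj1.
have [t tQ] : exists t, ideal_exp m t `<=` Q.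
  apply: local_exp_sub => // P [iP nP pP] QP y /powQ[t]; elim: t => [/QP//|t IH].
  by rewrite exprS => /QP/pP[//|]; elim: t {IH} => [//|t IH]; rewrite exprS => /pP[].
move=> a La; apply: QLN; split=> //.
by have := La t; apply: ideal_add_sub => // b /JN /NQ.
Qed.

End Local.
End Noetherian.

(** * Standard bases and the Artin-Rees lemma *)

Module ArtinRees.
Import mpoly.

Lemma increasing_leq (phi : nat -> nat) : (forall k, phi k < phi k.+1)%N ->
  forall i j, (i < j)%N -> (phi i < phi j)%N.
Proof.
move=> H i j /subnK <-; elim: (j - i.+1)%N => [|k IH]; first exact: H.
exact: ltn_trans IH (H _).
Qed.

Lemma nondecreasing_subseq (u : nat -> nat) : exists phi : nat -> nat,
  (forall k, phi k < phi k.+1)%N /\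
  (forall i j, (i <= j)%N -> (u (phi i) <= u (phi j))%N).
Proof.
have amin N : exists i, (N <= i)%N /\ forall j, (N <= j)%N -> (u i <= u j)%N.
  have ex : exists v, `[< exists2 i, (N <= i)%N & u i = v >].
    by exists (u N); apply/asboolP; exists N.
  case: (ex_minnP ex) => v /asboolP[i Ni <-] vmin; exists i; split=> // j Nj.
  by apply: vmin; apply/asboolP; exists j.
have /choice[f Hf] := amin.
pose phi := fix phi k := if k is k'.+1 then f (phi k').+1 else f 0%N.
exists phi; split=> [k /=|i j /subnK <-]; first by case: (Hf (phi k).+1).
elim: (j - i)%N => [//|k IH]; apply: leq_trans IH _ => /=.
have [lt _] := Hf (phi (k + i)%N).+1.
move: lt; set w := f _ => lt; case: (k + i)%N @w lt => [|l] /= lt.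
  by case: (Hf 0%N) => _; apply.
by case: (Hf (phi l).+1) => lt1; apply; apply: leq_trans (leq_trans lt1 (ltnW lt)).
Qed.

Section Dickson.
Variable n : nat.
Implicit Types (m : 'X_{1..n}) (E : set 'X_{1..n}).

(** Extract a subsequence for each coordinate in turn. *)
Lemma multinom_subseq (u : nat -> 'X_{1..n}) k : exists phi : nat -> nat,
  (forall k, phi k < phi k.+1)%N /\
  (forall i j (l : 'I_n), (i <= j)%N -> (l < k)%N -> (u (phi i) l <= u (phi j) l)%N).
Proof.
elim: k => [|k [phi [phiS Hphi]]]; first by exists id.
have [kn|nk] := ltnP k n; last first.
  exists phi; split=> // i j l ij _; apply: Hphi => //.
  exact: leq_trans (ltn_ord l) nk.
have [psi [psiS Hpsi]] := nondecreasing_subseq (fun i => u (phi i) (Ordinal kn)).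
exists (phi \o psi); split=> [i|i j l ij /=]; first exact: (increasing_leq phiS (psiS i)).
rewrite ltnS leq_eqVlt => /predU1P[lk|]; last first.
  apply: Hphi; move: ij; rewrite leq_eqVlt => /predU1P[->//|/(increasing_leq psiS)].
  exact: ltnW.
have -> : l = Ordinal kn by apply: val_inj.
exact: Hpsi.
Qed.

(** Otherwise choose, again and again, an element of E above none of the previous
   ones; this contradicts the existence of a subsequence that is nondecreasing in
   every coordinate. *)
Lemma dickson E : exists s : seq 'X_{1..n}, (forall a, a \in s -> E a) /\
  forall b, E b -> exists2 a, a \in s & (a <= b)%MM.
Proof.
apply: contrapT => /forallNP H.
have bad (s : seq 'X_{1..n}) : exists b, (forall a, a \in s -> E a) ->
    E b /\ forall a, a \in s -> ~~ (a <= b)%MM.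
  have [sE|nE] := EM (forall a, a \in s -> E a); last by exists 0%MM.
  have /not_andP[//|/existsNP[b /not_implyP[Eb nb]]] := H s.
  exists b => _; split=> // a sa; apply/negP => ab; apply: nb; by exists a.
have /choice[f Hf] := bad.
(* L k lists the first k elements of the bad sequence. *)
pose L := fix L k := if k is k'.+1 then f (L k') :: L k' else [::].
have LE k a : a \in L k -> E a.
  elim: k a => [//|k IH] a; rewrite inE => /predU1P[->|/IH//].
  by have [] := Hf _ IH.
have [phi [phiS Hphi]] := multinom_subseq (fun k => f (L k)) n.
have lt01 := phiS 0%N.
have [_ /(_ (f (L (phi 0%N))))] := Hf _ (LE (phi 1%N)).
suff -> : f (L (phi 0%N)) \in L (phi 1%N).
  by move=> /(_ isT)/negP; apply; apply/mnm_lepP => l; apply: Hphi.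
rewrite -(subnK lt01); elim: (_ - _)%N => [|k IH] /=; rewrite inE ?eqxx //.
by rewrite IH orbT.
Qed.
End Dickson.

Section Standard.
Variables (n : nat) (K : fieldType).
Notation S := (mpseries n K).
Implicit Types (f g u : S) (m a : 'X_{1..n}) (J : set S).

(** The initial monomial of a power series, the least one for a monomial order that
   refines the degree. So a series of order N has an initial monomial of degree at
   least N. *)
Definition lead f a := mpscoef f a != 0 /\ forall m, (m < a)%O -> mpscoef f m = 0.

Lemma lead_ex f : f != 0 -> exists a, lead f a.
Proof.
move=> f0; have [m0 fm0] : exists m, mpscoef f m != 0.
  apply: contrapT => /forallNP H; case/eqP: f0; apply: mpseriesP => m.
  by have /negP := H m; rewrite negbK => /eqP.
move: m0 fm0; apply: (well_founded_ind (@ltom_wf n)) => m IH fm.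
have [[m' ltm fm']|nm] := EM (exists2 m', (m' < m)%O & mpscoef f m' != 0).
  exact: IH ltm fm'.
exists m; split=> // m' ltm; apply/eqP; apply: contrapT => /negP fm'.
by apply: nm; exists m'.
Qed.

Lemma lead_monomM f a b m : lead f a -> (m < (a + b)%MM)%O ->
  mpscoef (monom K b * f) m = 0.
Proof.
move=> [_ H] lt; rewrite scoef_monomM; case: ifP => // bm; apply: H.
by rewrite -(ltmc_add2l _ _ b) submK.
Qed.

Lemma lead_monomM_coef f a b : mpscoef (monom K b * f) (a + b)%MM = mpscoef f a.
Proof. by rewrite scoef_monomM lem_addl addmK. Qed.

Section Division.
Variables (J : set S) (r : nat) (g : 'I_r -> S) (a : 'I_r -> 'X_{1..n}) (k : nat).
Hypotheses (iJ : is_ideal J) (Jg : forall i, J (g i)).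
Hypothesis ga : forall i, lead (g i) (a i).
Hypothesis aJ : forall u b, J u -> lead u b -> exists i, (a i <= b)%MM.
Hypothesis ak : forall i, (mdeg (a i) <= k)%N.

(** Reduction by the standard basis g: subtract multiples of the g i to cancel the
   initial monomial as long as it has degree N. There are finitely many monomials of
   degree N, and the multipliers have order at least N - k because the initial
   monomials of the basis have degree at most k. *)
Lemma division_step N u : J u -> ordge N u -> exists c : 'I_r -> S,
  (forall i, ordge (N - k) (c i)) /\ ordge N.+1 (u - \sum_i c i * g i).
Proof.
move=> Ju uN.
(* The monomials of degree at most N above the initial monomial of u: their number
   decreases with each reduction. *)
pose U (u : S) := [pred m : 'X_{1..n < N.+1} | `[< exists2 m', mpscoef u m' != 0 & (m' <= m)%O >]].
move: {2}#|U u| (leqnn #|U u|) => j; elim: j u Ju uN => [|j IH] u Ju uN Uj.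
  exists (fun _ => 0); split=> [i|]; first exact: ideal0.
  rewrite big1 ?subr0 => [|i _]; last by rewrite mul0r.
  move=> m mN; apply/eqP; apply: contraT => um; move: Uj; rewrite leqn0 => /eqP/card0_eq.
  move=> /(_ (BMultinom mN))/negbT/negP; case; apply/asboolP.
  by exists m.
have [uN1|nuN1] := EM (ordge N.+1 u).
  exists (fun _ => 0); split=> [i|]; first exact: ideal0.
  by rewrite big1 ?subr0 // => i _; rewrite mul0r.
have u0 : u != 0 by apply: contra_notN nuN1 => /eqP ->; apply: ideal0.
have [b [ub ubm]] := lead_ex u0.
have bN : mdeg b = N.
  apply/anti_leq/andP; split.
    have /existsNP[m /not_implyP[mN /eqP um]] := nuN1.
    rewrite -ltnS; apply: leq_ltn_trans mN; apply: lemc_mdeg.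
    by rewrite leNgt; apply: contraNN um => /ubm ->.
  by rewrite leqNgt; apply: contraNN ub => /uN ->.
have [i aib] := aJ Ju (conj ub ubm).
pose t : S := cst n (mpscoef u b / mpscoef (g i) (a i)) * monom K (b - a i)%MM.
have tN : ordge (N - k) t.
  apply: ordgeMl; apply: (@ordgeS _ _ _ (mdeg (b - a i)%MM)).
    rewrite leq_subLR -bN -{1}(submK aib) mdegD addnC leq_add2r; exact: ak.
  exact: ordge_monom.
have gi0 : mpscoef (g i) (a i) != 0 by case: (ga i).
have bE : (a i + (b - a i) = b)%MM by rewrite addmC submK.
have u'b m : (m <= b)%O -> mpscoef (u - t * g i) m = 0.
  rewrite scoefB -mulrA scoef_cstM le_eqVlt => /predU1P[->|mb].
    have := lead_monomM_coef (g i) (a i) (b - a i)%MM; rewrite bE => ->.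
    by rewrite divfK // subrr.
  by rewrite (ubm m) // (@lead_monomM _ (a i)) ?bE ?mulr0 ?subr0.
have Ju' : J (u - t * g i) by apply: idealB => //; apply: ideal_mull.
have u'N : ordge N (u - t * g i).
  by move=> m mN; apply: u'b; apply: ltW; apply: lt_mdeg_ltmc; rewrite bN.
have [|c [cN Hc]] := IH _ Ju' u'N.
  rewrite -ltnS; apply: leq_trans Uj; apply: proper_card; apply/properP; split.
    apply/fintype.subsetP => m /asboolP[m' um' m'm]; apply/asboolP.
    exists b => //; apply: le_trans m'm.
    by rewrite leNgt; apply: contraNN um' => m'b; rewrite u'b // ltW.
  have bN1 : (mdeg b < N.+1)%N by rewrite bN.
  exists (BMultinom bN1); first by apply/asboolP; exists b.
  by apply/negP => /asboolP[m' um' m'b]; move: um'; rewrite u'b ?eqxx.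
exists (fun l => c l + (if l == i then t else 0)); split=> [l|].
  by apply: ordgeD => //; case: ifP => // _; apply: ideal0.
congr (ordge _ _): Hc; rewrite -addrA -opprD; congr (_ - _).
rewrite (bigD1 i) //= [in RHS](bigD1 i) //= eqxx addrA; congr (_ + _).
  by rewrite mulrDl addrC.
by apply: eq_bigr => l /negPf ->; rewrite addr0.
Qed.

(** Iterate division_step and sum the multipliers, whose orders tend to infinity. *)
Lemma division N u : (k <= N)%N -> J u -> ordge N u -> exists c : 'I_r -> S,
  (forall i, ordge (N - k) (c i)) /\ u = \sum_i c i * g i.
Proof.
move=> kN Ju uN.
pose st (N : nat) (u : S) (c : 'I_r -> S) := J u -> ordge N u ->
  (forall i, ordge (N - k) (c i)) /\ ordge N.+1 (u - \sum_i c i * g i).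
have stP (x : nat * S) : exists c, st x.1 x.2 c.
  have [[Jx xN]|nx] := EM (J x.2 /\ ordge x.1 x.2).
    by have [c Hc] := division_step Jx xN; exists c.
  by exists (fun _ => 0) => Jx xN; case: nx.
have /choice[F HF] := stP.
pose w := fix w M := if M is M'.+1 then
  w M' - \sum_i F ((N + M')%N, w M') i * g i else u.
pose c M := F ((N + M)%N, w M).
have wP M : J (w M) /\ ordge (N + M) (w M).
  elim: M => [|M [JM oM]]; first by rewrite addn0.
  have [_ H] := HF (_, _) JM oM; rewrite addnS; split=> //=.
  by apply: idealB => //; apply: ideal_sum => // i _; apply: ideal_mull.
have cP M i : ordge (N + M - k) (c M i).
  by have [JM oM] := wP M; have [H _] := HF (_, _) JM oM; apply: H.
have lims i : exists L, forall M, ordge M (L - \sum_(j < M) c j i).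
  apply: series_lim => M; rewrite big_ord_recr /= addrAC subrr add0r.
  by apply: ordgeS (cP M i); rewrite addnC -addnBA // leq_addr.
have /choice[L HL] := lims.
have wE M : w M = u - \sum_i (\sum_(j < M) c j i) * g i.
  elim: M => [|M IH] /=.
    by rewrite big1 ?subr0 // => i _; rewrite big_ord0 mul0r.
  rewrite -/(c M) IH -addrA -opprD -big_split /=; congr (_ - _).
  by apply: eq_bigr => i _; rewrite big_ord_recr /= mulrDl.
exists L; split=> [i|].
  rewrite -[L i](subrK (\sum_(j < (N - k)%N) c j i)); apply: ordgeD => //.
  apply: ordge_sum => // j _; apply: ordgeS (cP j i).
  by apply: leq_sub2r; rewrite leq_addr.
apply: ordge_eq => M.
have -> : u - \sum_i L i * g i = w M - \sum_i (L i - \sum_(j < M) c j i) * g i.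
  rewrite wE -addrA -opprD -big_split /=; congr (_ - _); apply: eq_bigr => i _.
  by rewrite -mulrDl addrC subrK.
apply: ordgeB; first by apply: ordgeS (wP M).2; rewrite leq_addl.
by apply: ordge_sum => i _; apply: ordgeMr.
Qed.
End Division.

(** The ideal J has a finite standard basis by Dickson's lemma. If the initial
   monomials of this basis have degree at most k, division expresses an element of J
   of order N + k with multipliers of order N. *)
Lemma artin_rees J : is_ideal J -> exists k, forall N u, J u -> ordge (N + k) u ->
  ideal_mul (ordge N) J u.
Proof.
move=> iJ; have [s [sE Es]] := dickson [set a | exists2 f, J f & lead f a].
have sP (i : 'I_(size s)) : exists g, J g /\ lead g (tnth (in_tuple s) i).
  by have [f Jf fa] := sE _ (mem_tnth i (in_tuple s)); exists f.
have /choice[g Hg] := sP.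
pose k := \max_(i < size s) mdeg (tnth (in_tuple s) i).
exists k => N u Ju uN.
have [|||||||c [cN ->]] := @division J _ g (tnth (in_tuple s)) k iJ _ _ _ _ (N + k) u.
- by move=> i; case: (Hg i).
- by move=> i; case: (Hg i).
- move=> v b Jv vb; have [|a /(tnthP (in_tuple s))[i ->] ab] := Es b; first by exists v.
  by exists i.
- by move=> i; apply: (leq_bigmax (F := fun i => mdeg (tnth (in_tuple s) i))).
- exact: leq_addl.
- exact: Ju.
- exact: uN.
apply: ideal_sum => // i _; apply: mem_ideal_mul; last by case: (Hg i).
by have := cN i; rewrite addnK.
Qed.

(** If x u = -a + w with a in I and w of order N + k, then w lies in I + (x), hence in
   m^N (I + (x)); so w is congruent to x t modulo I for some t of order N, and u - t
   lies in I because x is regular modulo I. *)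
Lemma colon_artin_rees I x : is_ideal I -> (forall u, I (x * u) -> I u) ->
  exists k, forall N u, ideal_add I (ordge (N + k)) (x * u) -> ideal_add I (ordge N) u.
Proof.
move=> iI nz; have iA := adj_ideal x iI; have [k Hk] := artin_rees iA.
exists k => N u [a Ia [w wN E]].
have sub : ideal_mul (ordge N) (adj I x) `<=`
    [set v | exists2 b, I b & exists2 t, ordge N t & v = b + x * t].
  apply: ideal_mul_sub => [|t _ tN [b Ib [v ->]]]; last first.
    exists (t * b); first exact: ideal_mull.
    by exists (t * v); [apply: ordgeMr|ring].
  split.
  - by exists 0; [exact: ideal0|exists 0; [exact: ideal0|ring]].
  - move=> _ _ [b Ib [t tN ->]] [b' Ib' [t' tN' ->]]; exists (b + b'); first exact: idealD.
    by exists (t + t'); [apply: ordgeD|ring].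
  - move=> c _ [b Ib [t tN ->]]; exists (c * b); first exact: ideal_mull.
    by exists (c * t); [apply: ordgeMl|ring].
have [|b Ib [t tN wE]] := sub w; last first.
  exists (u - t); last by exists t => //; rewrite subrK.
  apply: nz; have -> : x * (u - t) = a + b by rewrite mulrBr -E wE; ring.
  exact: idealD.
apply: Hk => //; exists (- a); first exact: idealN.
by exists u; rewrite -E addKr.
Qed.

Lemma card_bmultinom N : (#|{: 'X_{1..n < N}}| <= N.+1 ^ n)%N.
Proof.
pose f (m : 'X_{1..n < N}) := [ffun i : 'I_n => inord (m i) : 'I_N.+1].
have fI : injective f.
  move=> m1 m2 /ffunP H; apply: val_inj; apply/mnmP => i.
  have mi (m : 'X_{1..n < N}) : (m i < N.+1)%N.
    rewrite ltnS; apply: leq_trans (ltnW (bmdeg m)).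
    by rewrite mdegE (bigD1 i) //= leq_addr.
  by have := congr1 val (H i); rewrite !ffunE /= !inordK.
by apply: leq_trans (leq_card f fI) _; rewrite card_ffun !card_ord.
Qed.
End Standard.
End ArtinRees.

(** * Hilbert functions *)

Section Growth.
Variables (n : nat) (K : fieldType).
Notation S := (mpseries n K).
Notation codimS := (cdim (@cst n K)).
Implicit Types (I J : set S) (x u : S).

(** The Hilbert-Samuel function of K[[x]]/I. *)
Definition hilb I N := codimS (ideal_add I (ordge N)).
Definition growth I d := exists C, forall N, (hilb I N <= C * N.+1 ^ d)%N.

Lemma ideal_add_ordge_ideal I N : is_ideal I -> is_ideal (ideal_add I (ordge N)).
Proof. by move=> iI; apply: ideal_add_ideal. Qed.

Lemma fincodim_hilb I N : is_ideal I -> fincodim (cst n) (ideal_add I (ordge N)).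
Proof.
move=> iI; apply: (fincodim_ordge (ideal_add_ordge_ideal N iI)).
exact: ideal_add_subr.
Qed.
Hint Resolve ideal_add_ordge_ideal fincodim_hilb : core.

Lemma hilb_leS I J N : is_ideal I -> is_ideal J -> I `<=` J -> (hilb J N <= hilb I N)%N.
Proof.
move=> iI iJ IJ; apply: cdimS; [exact/ideal_subspace/ideal_add_ordge_ideal| |exact: fincodim_hilb].
exact: ideal_addS.
Qed.

Lemma hilb_leq I M N : is_ideal I -> (M <= N)%N -> (hilb I M <= hilb I N)%N.
Proof.
move=> iI MN; apply: cdimS; [exact/ideal_subspace/ideal_add_ordge_ideal| |exact: fincodim_hilb].
by apply: ideal_addS => //; apply: ordgeS.
Qed.

Lemma growthS I J d : is_ideal I -> is_ideal J -> I `<=` J -> growth I d -> growth J d.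
Proof.
move=> iI iJ IJ [C H]; exists C => N.
by apply: leq_trans (H N); apply: hilb_leS.
Qed.

Lemma growth_set0 : growth [set 0] n.
Proof.
have i0 := ideal_set0 S.
exists 1%N => N; rewrite mul1n; apply: leq_trans (ArtinRees.card_bmultinom n N).
have sp := @spans_monom n K _ N (@ideal_add_subr _ _ (ordge N) i0).
by have [] := cdim_leq_spans (ideal_subspace (cst n) (ideal_add_ordge_ideal N i0)) sp.
Qed.

(** Multiplication by x on K[[x]]/(I + m^(N+k)): its cokernel gives the first term,
   and its kernel lies in m^N by colon_artin_rees. *)
Lemma hilb_regular I x : is_ideal I -> (forall u, I (x * u) -> I u) ->
  exists k, forall N, (hilb (adj I x) (N + k) + hilb I N <= hilb I (N + k))%N.
Proof.
move=> iI nz; have [k Hk] := ArtinRees.colon_artin_rees iI nz; exists k => N.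
have iA := adj_ideal x iI; have iN := ideal_add_ordge_ideal (N + k) iI.
rewrite [leqRHS]/hilb (cdim_adj_colon x iN) ?leq_add //; last exact: fincodim_hilb.
  apply: cdimS; [exact/ideal_subspace/ideal_add_ordge_ideal| |].
    apply: adj_sub => //; first exact: ideal_add_ordge_ideal.
      by apply: ideal_addS => //; apply: sub_adj.
    by apply: ideal_add_subl => //; apply: mem_adj1.
  apply: fincodimS (fincodim_hilb (N + k) iI); last exact: sub_adj.
  exact/ideal_subspace/adj_ideal.
apply: cdimS; [exact/ideal_subspace/ideal_add_ordge_ideal| |].
  by move=> u; apply: Hk.
exact/fincodim_colon/fincodim_hilb.
Qed.

Lemma hilb_regular_sum I x k N j : is_ideal I ->
  (forall N, (hilb (adj I x) (N + k) + hilb I N <= hilb I (N + k))%N) ->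
  (j * hilb (adj I x) N <= hilb I (N + j * k))%N.
Proof.
move=> iI H; elim: j => [|j IH]; first by rewrite mul0n.
rewrite mulSn mulSnr addnA; apply: leq_trans (H _); apply: leq_add => //.
by apply: hilb_leq; [exact: adj_ideal|rewrite -addnA leq_addr].
Qed.

(** Summing hilb_regular over N + 1 steps bounds N + 1 times the Hilbert function of I
   + (x) at N by that of I at N + (N + 1) k, which has order N^(d+1). *)
Lemma growth_regular I x d : is_ideal I -> (forall u, I (x * u) -> I u) ->
  growth I d.+1 -> growth (adj I x) d.
Proof.
move=> iI /(hilb_regular iI)[k Hk] [C HC].
exists (C * k.+1 ^ d.+1)%N => N.
have := leq_trans (hilb_regular_sum N N.+1 iI Hk) (HC _).
move=> le; rewrite -(leq_pmul2l (ltn0Sn N)); apply: leq_trans le _.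
rewrite mulnCA -mulnA -expnS -expnMn leq_mul2l leq_exp2r //; apply/orP; right.
by nia.
Qed.

(** Iterating hilb_regular at N = 1 makes the Hilbert function of I unbounded. *)
Lemma growth0_regular I x : is_ideal I -> (forall u, I (x * u) -> I u) ->
  growth I 0 -> adj I x `<=` ordge 1 -> False.
Proof.
move=> iI /(hilb_regular iI)[k Hk] [C HC] sub.
have := leq_trans (hilb_regular_sum 1 C.+1 iI Hk) (HC _).
rewrite expn0 muln1 leqNgt => /negP; apply.
have iA := adj_ideal x iI.
have : (0 < hilb (adj I x) 1)%N.
  apply: cdim_gt0; [exact: ideal_add_ordge_ideal|exact: fincodim_hilb|].
  by move=> H; apply: (@ordge1_1 n K); move: H; apply: ideal_add_sub.
by nia.
Qed.

Lemma ideal_gen_rcons (s : seq S) x :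
  ideal_gen [set` rcons s x] = adj (ideal_gen [set` s]) x.
Proof.
apply/seteqP; split.
  apply: ideal_gen_sub; first exact: adj_ideal.
  move=> y /=; rewrite mem_rcons inE => /predU1P[->|ys]; first exact: mem_adj1.
  by apply: sub_adj; apply: sub_ideal_gen.
apply: adj_sub => //; last by apply: sub_ideal_gen; rewrite /= mem_rcons mem_head.
apply: ideal_gen_sub => // y /= ys; apply: sub_ideal_gen.
by rewrite /= mem_rcons inE ys orbT.
Qed.

(** Each term lowers the degree of growth by one, starting from n; the degree cannot
   drop below zero. *)
Lemma growth_regular_sequence (fs : seq S) : regular_sequence fs ->
  (size fs <= n)%N /\ growth (ideal_gen [set` fs]) (n - size fs).
Proof.
move=> [reg prop].
have sub i : ideal_gen [set` take i fs] `<=` ideal_gen [set` fs].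
  by apply: ideal_gen_sub => // y /= /mem_take ys; apply: sub_ideal_gen.
have H i : (i <= size fs)%N -> (i <= n)%N /\ growth (ideal_gen [set` take i fs]) (n - i).
  elim: i => [_|i IH lti].
    split=> //; rewrite subn0; apply: growthS growth_set0 => //; first exact: ideal_set0.
    by move=> y /= ->; apply: ideal0.
  have [ltin g] := IH (ltnW lti).
  have iI := ideal_gen_ideal [set` take i fs].
  have nz u : ideal_gen [set` take i fs] (fs`_i * u) -> ideal_gen [set` take i fs] u.
    by rewrite mulrC; apply: reg.
  have E : ideal_gen [set` take i.+1 fs] = adj (ideal_gen [set` take i fs]) fs`_i.
    by rewrite (take_nth 0) // ideal_gen_rcons.
  have sub1 : ideal_gen [set` take i.+1 fs] `<=` ordge 1.
    by apply: subset_trans (sub _) _; apply: proper_sub_ordge1.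
  rewrite E in sub1 *; move: ltin; rewrite leq_eqVlt => /predU1P[E'|ltin]; last first.
    by split=> //; apply: growth_regular => //; rewrite subnSK.
  have n0 : (n - i = 0)%N by rewrite E' subnn.
  by case: (growth0_regular iI nz _ sub1); rewrite n0 in g.
by have [] := H (size fs) (leqnn _); rewrite take_size.
Qed.
End Growth.

(** * Dimension and growth *)

Section LocalGrowth.
Variables (A : comPzRingType) (m : set A).
Hypothesis nA : noetherian A.
Hypothesis mP : forall I, is_maximal_ideal I <-> I = m.
Variables (n : nat) (K : fieldType) (G : set (mpseries n K)).
Hypothesis G1 : ~ ideal_gen G 1.
Variable th : {rmorphism A -> quot G}.
Notation S := (mpseries n K).
Notation pi := (quot_pi G).
Notation mQ := (qmax G).
Hypothesis th_exp : forall N a, ideal_exp m N a <-> ideal_exp mQ N (th a).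
Hypothesis th_dense : forall N x, exists a, ideal_exp mQ N (x - th a).
Implicit Types (J P : set A) (u v : S).
Notation codimS := (cdim (@cst n K)).
Notation ext := (ext th).

Let mm : is_maximal_ideal m. Proof. exact/mP. Qed.
Let im : is_ideal m. Proof. by case: mm. Qed.

(** The filtration of A/J by powers of m, compared with multiplication by f: the map
   A/m^N -> A/m^(N+1) given by f is well defined. *)
Lemma ext_step J f N : is_ideal J -> m f ->
  (codimS (ext J N.+1) <= codimS (ext J N) + codimS (ext (adj J f) N.+1))%N.
Proof.
move=> iJ mf; have [u uf] := quot_pi_surj (th f).
have iE := ext_ideal th_dense N.+1 iJ.
have fE := fincodim_ext th_dense N.+1 iJ.
rewrite (ext_adj th_dense N.+1 iJ uf) (cdim_adj_colon u iE fE) addnC leq_add2r.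
apply: cdimS; [exact/ideal_subspace/colon_ideal| |exact: fincodim_ext].
move=> v [a Ja va]; exists (f * a); first exact: ideal_mull.
have -> : pi (u * v) - th (f * a) = th f * (pi v - th a).
  by rewrite !rmorphM /= uf; ring.
apply: (@ideal_expM _ mQ _ _ 1) => //; apply/th_exp.
by rewrite ideal_exp1.
Qed.

Lemma ext0 J : is_ideal J -> codimS (ext J 0) = 0%N.
Proof.
move=> iJ; have -> : ext J 0 = setT; last exact: cdim_setT.
by apply/seteqP; split=> // u _; exists 0; first exact: ideal0.
Qed.

Lemma expn_leq a b d : (a <= b)%N -> (a ^ d <= b ^ d)%N.
Proof. by case: d => // d; rewrite leq_exp2r. Qed.

(** Induction on d with a parameter f: the difference of consecutive values is bounded
   by the values for J + (f). *)
Lemma dimle_growth d J : is_ideal J -> dimle J d ->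
  exists C, forall N, (codimS (ext J N) <= C * N.+1 ^ d)%N.
Proof.
elim: d J => [|d IH] J iJ dJ.
  have [t tJ] := dimle0_exp nA mP iJ dJ.
  have iD N : is_ideal (ext J N) by apply: ext_ideal.
  exists (codimS (ordge t)) => N; rewrite expn0 muln1.
  apply: cdimS; [exact/ideal_subspace| |exact: (fincodim_ordge (@ordge_ideal n K t) (@subset_refl _ _))].
  move=> u ut; have [a ua] := th_dense (maxn N t) (pi u).
  exists a; last by apply: ideal_exp_leq ua; apply: leq_maxl.
  apply: tJ; apply/th_exp; apply: (@idealBr _ _ (pi u)) => //.
    by apply/qmax_exp_pi; apply: ideal_add_subr.
  by apply: ideal_exp_leq ua; apply: leq_maxr.
have [f mf df] := dimle_parameter nA mP iJ dJ.
have [C HC] := IH _ (adj_ideal f iJ) df.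
exists (C * 2 ^ d)%N; elim=> [|N IHN]; first by rewrite ext0.
apply: leq_trans (ext_step N iJ mf) _.
apply: leq_trans (leq_add IHN (HC _)) _.
rewrite -!mulnA -mulnDr leq_mul2l; apply/orP; right.
have H1 : (N.+2 ^ d <= 2 ^ d * N.+2 ^ d)%N by rewrite leq_pmull // expn_gt0.
have H2 : (2 ^ d * N.+1 ^ d <= 2 ^ d * N.+2 ^ d)%N.
  by rewrite leq_mul2l expn_leq ?orbT.
by rewrite !(expnS _.+1); nia.
Qed.

(** The ideals (P + m^M : x) + m^N decrease with M and have finite colength bounded by
   that of m^N, so they are eventually constant. An element of the stable value lies
   in P + x m^N up to m^M for all M once multiplied by x; Krull's intersection theorem
   removes m^M, and x is regular modulo P. Compared with the Artin-Rees lemma the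
   bound M is not linear in N, but this suffices for the completion. *)
Lemma weak_artin_rees P x N : is_ideal P -> (forall a, P (x * a) -> P a) ->
  exists M, forall a, ideal_add P (ideal_exp m M) (x * a) ->
    ideal_add P (ideal_exp m N) a.
Proof.
move=> iP nz.
have iPM M : is_ideal (ideal_add P (ideal_exp m M)) by apply: ideal_add_ideal.
pose D M := ideal_add (colon (ideal_add P (ideal_exp m M)) x) (ideal_exp m N).
have iD M : is_ideal (D M) by apply: ideal_add_ideal => //; apply: colon_ideal.
have DS M M' : (M <= M')%N -> D M' `<=` D M.
  move=> MM; apply: ideal_addS => // a; apply: ideal_addS => //.
  exact: ideal_exp_leq.
pose c M := codimS (ext (D M) N).
have cB M : (c M <= codimS (ordge N))%N.
  apply: cdimS; [exact/ideal_subspace/ext_ideal|exact: ordge_sub_ext|].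
  exact: (fincodim_ordge (@ordge_ideal n K N) (@subset_refl _ _)).
have [M0 M0max] : exists M0, forall M, (c M <= c M0)%N.
  have ex : exists w, `[< exists M, c M = w >] by exists (c 0%N); apply/asboolP; exists 0%N.
  have bd w : `[< exists M, c M = w >] -> (w <= codimS (ordge N))%N.
    by move=> /asboolP[M <-].
  case: (ex_maxnP ex bd) => w /asboolP[M0 <-] H; exists M0 => M.
  by apply: H; apply/asboolP; exists M.
have DM M : D M0 `<=` D M.
  have [le|lt] := leqP M M0; first exact: DS.
  have sub : ext (D M0) N `<=` ext (D M) N.
    apply: (@cdim_eq_sub _ _ (cst n)); [exact/ideal_subspace/ext_ideal|exact/ideal_subspace/ext_ideal| | |exact: M0max].
      by apply: extS; apply: DS; apply: ltnW.
    exact: fincodim_ext.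
  move=> a Da; have [u ua] := quot_pi_surj (th a).
  apply: (ext_mem th_exp (iD M) _ (sub u _) ua); first exact: ideal_add_subr (colon_ideal _ _).
  exact: mem_ext Da ua.
exists M0 => a xa.
pose J := [set y | exists2 b, P b & exists2 t, ideal_exp m N t & y = b + x * t].
have iJ : is_ideal J.
  split.
  - by exists 0; [exact: ideal0|exists 0; [exact: ideal0|ring]].
  - move=> _ _ [b Ib [t tN ->]] [b' Ib' [t' tN' ->]]; exists (b + b'); first exact: idealD.
    by exists (t + t'); [apply: idealD|ring].
  - move=> e _ [b Ib [t tN ->]]; exists (e * b); first exact: ideal_mull.
    by exists (e * t); [apply: ideal_mull|ring].
have [b Pb [t tN E]] : J (x * a).
  apply: (krull_intersection nA mP iJ) => M.
  have [|b [d Pd [e eM E]] [t tN <-]] := DM M a.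
    by apply: ideal_add_subl.
  exists (d + x * t); first by exists d => //; exists t.
  by exists e => //; rewrite mulrDr -E; ring.
exists (a - t); last by exists t => //; rewrite subrK.
by apply: nz; rewrite mulrBr E addrK.
Qed.

(** The extension of P to the completion, pulled back to K[[x]]. *)
Definition hat P : set S := [set u | forall N, ext P N u].

Lemma hat_ideal P : is_ideal P -> is_ideal (hat P).
Proof.
move=> iP; have iE N := ext_ideal th_dense N iP.
split=> [N|u v Hu Hv N|u v Hv N].
- exact: ideal0 (iE N).
- exact: idealD (iE N) (Hu N) (Hv N).
- exact: ideal_mull (iE N) (Hv N).
Qed.

(** A nonzerodivisor modulo P stays one modulo the extension of P: this is the part of
   the flatness of the completion that dimension theory needs. *)
Lemma hat_regular P x u : is_ideal P -> (forall a, P (x * a) -> P a) -> pi u = th x ->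
  forall v, hat P (u * v) -> hat P v.
Proof.
move=> iP nz ux v Hv N; have [M HM] := weak_artin_rees N iP nz.
have [a va] := th_dense (maxn M N) (pi v).
have [b Pb uvb] := Hv M.
have [|c Pc [e eN E]] := HM a.
  exists b => //; exists (x * a - b); last by rewrite addrC subrK.
  apply/th_exp; rewrite rmorphB rmorphM -ux.
  have -> : pi u * th a - th b = (pi (u * v) - th b) - pi u * (pi v - th a).
    by rewrite rmorphM /=; ring.
  apply: idealB => //; apply: ideal_mull => //.
  by apply: ideal_exp_leq va; apply: leq_maxl.
exists c => //.
have -> : pi v - th c = (pi v - th a) + th e by rewrite -E rmorphD; ring.
apply: idealD => //; last by apply/th_exp.
by apply: ideal_exp_leq va; apply: leq_maxr.
Qed.

Lemma hat_sub1 P : is_ideal P -> P `<=` m -> hat P `<=` ordge 1.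
Proof.
move=> iP Pm; apply: proper_sub_ordge1; first exact: hat_ideal.
move=> /(_ 1%N)[a /Pm ma H]; apply: (qmax1 G1); rewrite -(rmorph1 pi).
have iq : is_ideal mQ := qmax_ideal G.
rewrite -[mQ]ideal_exp1 //; apply: idealBl H => //.
by apply/th_exp; rewrite ideal_exp1.
Qed.

(** Choose x in P_(i+1) outside P_i. It is regular modulo P_i, hence regular modulo
   the extension of P_i to K[[x]], so the degree of growth drops by at least one at
   each step of the chain. *)
Lemma prime_chain_growth d (P : nat -> set A) r :
  prime_chain d P -> growth (ideal_gen G) r -> (d <= r)%N.
Proof.
move=> [Pp Ps] gG.
have iP i : (i <= d)%N -> is_ideal (P i) by case/Pp.
have H i : (i <= d)%N -> (i <= r)%N /\ growth (hat (P i)) (r - i).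
  elim: i => [_|i IH ltid].
    split=> //; rewrite subn0; apply: growthS gG => //; first exact/hat_ideal/iP.
    by move=> u Gu N; apply: gen_sub_ext => //; exact: iP.
  have [leir g] := IH (ltnW ltid).
  have [PP /existsNP[x /not_implyP[Px nPx]]] := Ps i ltid.
  have [u ux] := quot_pi_surj (th x).
  have [iPi _ pP] := Pp i (ltnW ltid).
  have iH := hat_ideal iPi.
  have nz a : P i (x * a) -> P i a by move=> /pP[].
  have reg := hat_regular iPi nz ux.
  have sub : adj (hat (P i)) u `<=` hat (P i.+1).
    apply: adj_sub; first exact/hat_ideal/iP.
      by move=> v Hv N; apply: extS (Hv N).
    by move=> N; apply: mem_ext ux.
  have sub1 : adj (hat (P i)) u `<=` ordge 1.
    apply: subset_trans sub _; apply: hat_sub1; first exact: iP.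
    exact: prime_sub_local nA _ mP _ (Pp _ ltid).
  move: leir; rewrite leq_eqVlt => /predU1P[E|ltir]; last first.
    split=> //; apply: growthS sub _; [exact: adj_ideal|exact/hat_ideal/iP|].
    by apply: growth_regular => //; rewrite subnSK.
  have r0 : (r - i = 0)%N by rewrite E subnn.
  by case: (growth0_regular iH reg _ sub1); rewrite r0 in g.
by have [] := H d (leqnn d).
Qed.

End LocalGrowth.

(** * Frobenius powers *)

Module Frobenius.
Import mpoly.

Lemma frobD (R : comNzRingType) p (pR : p \in [pchar R]) e (x y : R) :
  (x + y) ^+ (p ^ e) = x ^+ (p ^ e) + y ^+ (p ^ e).
Proof.
elim: e => [|e IH]; first by rewrite expn0 !expr1.
by rewrite expnSr !exprM IH -!(pFrobenius_autE pR); apply: pFrobenius_autD_comm; apply: mulrC.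
Qed.

Lemma frobD1 (R : comNzRingType) p (pR : p \in [pchar R]) (x y : R) :
  (x + y) ^+ p = x ^+ p + y ^+ p.
Proof. by have := frobD pR 1 x y; rewrite expn1. Qed.

Lemma frob_sum (R : comNzRingType) p (pR : p \in [pchar R]) e (I : Type)
    (r : seq I) (P : pred I) (F : I -> R) :
  (\sum_(i <- r | P i) F i) ^+ (p ^ e) = \sum_(i <- r | P i) F i ^+ (p ^ e).
Proof.
apply: (big_morph (fun x : R => x ^+ (p ^ e))); first exact: frobD.
by rewrite expr0n expn_eq0 -leqn0 leqNgt (prime_gt0 (pcharf_prime pR)).
Qed.

(** A K^p-linear form on K with values in K^p that takes the value 1 at e, read
   through the p-th root. Zorn's lemma gives a maximal K^p-subspace that avoids e; it
   is a hyperplane, and f d is the p-th root of the coordinate of d along e modulo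
   this hyperplane. *)
Lemma frob_functional (K : fieldType) p (pK : p \in [pchar K]) (e : K) :
  e != 0 -> exists f : K -> K,
  [/\ forall x y, f (x + y) = f x + f y,
      forall c x, f (c ^+ p * x) = c * f x & f e = 1].
Proof.
move=> e0; have p0 : (0 < p)%N := prime_gt0 (pcharf_prime pK).
pose Pr (H : set K) := [/\ forall a b, H a -> H b -> H (a + b),
  forall c a, H a -> H (c ^+ p * a) & ~ H e].
have [F FP tot|A [[AD AM nAe] Amax]] := @Zorn_bigcup _ Pr.
  split=> [a b [X FX Xa] [Y FY Yb]|c a [X FX Xa]|[X FX Xe]].
  - have [XY|YX] := tot _ _ FX FY.
      by exists Y => //; have [YD _ _] := FP _ FY; apply: YD => //; apply: XY.
    by exists X => //; have [XD _ _] := FP _ FX; apply: XD => //; apply: YX.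
  - by exists X => //; have [_ XM _] := FP _ FX; apply: XM.
  - by have [_ _] := FP _ FX; apply.
(* The members of Pr may be empty, as the union of the empty chain is; adding 0 makes
   a subspace of A. *)
pose B : set K := [set x | x = 0 \/ A x].
have BD a b : B a -> B b -> B (a + b).
  move=> [->|Aa] [->|Ab]; rewrite ?addr0 ?add0r; [by left|by right|by right|].
  by right; apply: AD.
have BM c a : B a -> B (c ^+ p * a).
  by move=> [->|Aa]; [left; rewrite mulr0|right; apply: AM].
have nBe : ~ B e by move=> [/eqP|//]; rewrite (negPf e0).
have BN a : B a -> B (- a).
  have -> : - a = (-1) ^+ p * a.
    have /eqP := frobD1 pK 1 (-1); rewrite subrr expr0n gtn_eqF // expr1n.
    by rewrite eq_sym addrC addr_eq0 => /eqP ->; rewrite mulN1r.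
  exact: BM.
have dec d : exists c, B (d - c ^+ p * e).
  have [Ad|nAd] := EM (A d).
    by exists 0; rewrite expr0n gtn_eqF // mul0r subr0; right.
  pose D : set K := [set x | exists c, exists2 b, B b & x = c ^+ p * d + b].
  have : ~ Pr D.
    apply: Amax; split=> [a Aa|/(_ d)].
      by exists 0; exists a; [right|rewrite expr0n gtn_eqF // mul0r add0r].
    by move=> H; apply: nAd; apply: H; exists 1; exists 0; [left|rewrite expr1n mul1r addr0].
  apply: contra_notP => /forallNP H; split.
  - move=> _ _ [c [b Bb ->]] [c' [b' Bb' ->]]; exists (c + c'); exists (b + b').
      exact: BD.
    by rewrite frobD1 // mulrDl addrACA.
  - move=> t _ [c [b Bb ->]]; exists (t * c); exists (t ^+ p * b); first exact: BM.
    by rewrite mulrDr exprMn mulrA.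
  - move=> [c [b Bb E]]; have [c0|c0] := eqVneq c 0.
      by apply: nBe; rewrite E c0 expr0n gtn_eqF // mul0r add0r.
    apply: (H c^-1); rewrite E exprVn mulrDr mulKf ?expf_neq0 //.
    by rewrite opprD addrA subrr add0r -exprVn -mulrN; apply: BM; apply: BN.
have /choice[f Hf] := dec.
have uniq d c : B (d - c ^+ p * e) -> f d = c.
  move=> H; apply/eqP; rewrite -subr_eq0; apply: contraT => n0; exfalso; apply: nBe.
  have H2 : B ((f d - c) ^+ p * e).
    have -> : (f d - c) ^+ p * e = (d - c ^+ p * e) + - (d - f d ^+ p * e).
      have /eqP := frobD1 pK (f d - c) c; rewrite subrK -subr_eq => /eqP <-.
      by ring.
    by apply: BD => //; apply: BN.
  rewrite -[e](mulKf (expf_neq0 p n0)) -exprVn; exact: BM.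
exists f; split=> [x y|c x|].
- apply: uniq; rewrite frobD1 //.
  have -> : x + y - (f x ^+ p + f y ^+ p) * e = (x - f x ^+ p * e) + (y - f y ^+ p * e) by ring.
  exact: BD.
- by apply: uniq; rewrite exprMn -mulrA -mulrBr; apply: BM.
- by apply: uniq; rewrite expr1n mul1r subrr; left.
Qed.

Section Cartier.
Variables (n : nat) (K : fieldType) (p : nat).
Hypothesis pK : p \in [pchar K].
Notation S := (mpseries n K).
Implicit Types (f g s : S) (m a b : 'X_{1..n}) (I : set S).

Let p0 : (0 < p)%N. Proof. exact: prime_gt0 (pcharf_prime pK). Qed.

Lemma series_pchar : p \in [pchar S].
Proof.
rewrite inE /= (pcharf_prime pK) /=.
by rewrite -(rmorph_nat (cst n)) (pcharf0 pK) rmorph0.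
Qed.

Variables (phi : K -> K) (al : 'X_{1..n}).
Hypotheses (phiD : forall x y, phi (x + y) = phi x + phi y)
  (phiM : forall c x, phi (c ^+ p * x) = c * phi x).
Hypothesis alp : forall i, (al i < p)%N.

Let phi0 : phi 0 = 0.
Proof. by have := phiM 0 0; rewrite mulr0 mul0r. Qed.

(** A p^-1-linear operator on power series: it picks the monomials whose exponent is
   congruent to al modulo p and applies phi to their coefficients. *)
Definition cartier s : S := MPSeries (fun m => phi (mpscoef s (m *+ p + al)%MM)).

Lemma cartierD s t : cartier (s + t) = cartier s + cartier t.
Proof. by apply: mpseriesP => m /=; rewrite phiD. Qed.

Lemma scoef_cartier s m : mpscoef (cartier s) m = phi (mpscoef s (m *+ p + al)%MM).
Proof. by []. Qed.

Lemma cartier_monom c b s :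
  cartier ((cst n c * monom K b) ^+ p * s) = cst n c * monom K b * cartier s.
Proof.
apply: mpseriesP => m; rewrite scoef_cartier exprMn -rmorphXn -monomMn -!mulrA.
rewrite !scoef_cstM !scoef_monomM scoef_cartier.
have -> : (b *+ p <= m *+ p + al)%MM = (b <= m)%MM.
  apply/mnm_lepP/mnm_lepP => H i; have := H i.
    rewrite mnmDE !mulmnE; have := alp i.
    by move=> h1 h2; rewrite -ltnS -(ltn_pmul2r p0); apply: leq_ltn_trans h2 _; rewrite mulSn addnC ltn_add2r.
  by move=> h; rewrite mnmDE !mulmnE (leq_trans _ (leq_addr _ _)) // leq_mul2r h orbT.
case: ifP => [bm|_]; last by rewrite !mulr0 phi0.
rewrite phiM /=; congr (_ * phi (mpscoef s _)).
apply/mnmP => i; rewrite !(mnmDE, mnmBE, mulmnE).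
by rewrite mulnBl addnBAC // leq_mul2r (mnm_lepP bm) orbT.
Qed.

(** Checked on monomials with scalars, hence on polynomials, hence on series since the
   coefficient at a given monomial depends on finitely many coefficients. *)
Lemma cartierM f s : cartier (f ^+ p * s) = f * cartier s.
Proof.
apply: mpseriesP => m; pose N := (mdeg m * p + mdeg al).+1.
pose t := of_mpoly (strunc N f); pose r := f - t.
have rN : ordge N r by apply: strunc_ordge.
have -> : f = t + r by rewrite addrC subrK.
have tE g : cartier (t ^+ p * g) = t * cartier g.
  rewrite /t rmorph_sum /= -{1}(expn1 p) frob_sum ?series_pchar //.
  rewrite mulr_suml (big_morph cartier (id1 := 0) (op1 := +%R)); last 2 first.
  - exact: cartierD.
  - by apply: mpseriesP => k /=; rewrite phi0.
  rewrite mulr_suml; apply: eq_bigr => b _; rewrite expn1 -mul_mpolyC rmorphM.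
  exact: cartier_monom.
clearbody r t; rewrite (frobD1 series_pchar t r) (mulrDl (t ^+ p) (r ^+ p) s) cartierD tE.
rewrite (mulrDl t r) !scoefD; congr (_ + _).
have p_gt0 := p0.
rewrite scoef_cartier [X in phi X](_ : _ = 0); last first.
  have : ordge N (r ^+ p * s).
    by apply: ordgeMr; rewrite -(prednK p_gt0) exprS; apply: ordgeMr.
  by apply; rewrite /N ltnS mdegD mdegMn.
rewrite phi0; apply/esym; have : ordge N (r * cartier s) by apply: ordgeMr.
apply; rewrite /N ltnS; apply: leq_trans (leq_addr _ _).
exact: leq_pmulr.
Qed.

(** By p^-1-linearity, a combination of p-th powers of elements of I is sent into I.
   *)
Lemma cartier_frob I w : is_ideal I -> ideal_frob I p w -> I (cartier w).
Proof.
move=> iI; suff H : ideal_frob I p `<=` [set w | forall s, I (cartier (s * w))].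
  by move=> /H/(_ 1); rewrite mul1r.
apply: ideal_frob_sub => [|a Ia s]; last by rewrite mulrC cartierM; apply: ideal_mulr.
split=> [s|v w' Hv Hw s|v w' Hw s].
- rewrite mulr0; have -> : cartier 0 = 0 by apply: mpseriesP => m /=; rewrite phi0.
  exact: ideal0.
- by rewrite mulrDr cartierD; apply: idealD.
- by rewrite mulrA.
Qed.

Lemma cartier_cst_monom c b : (forall i, (b i < p)%N) ->
  cartier (cst n c * monom K b) = if b == al then cst n (phi c) else 0.
Proof.
move=> bp; apply: mpseriesP => m.
rewrite scoef_cartier scoef_cstM [mpscoef (monom _ _) _]/= mcoeffX.
have m0p : ((0%MM : 'X_{1..n}) *+ p)%MM = 0%MM.
  by apply/mnmP => i; rewrite mulmnE !mnm0E.
have E : (b == (m *+ p + al)%MM) = (m == 0%MM) && (b == al).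
  apply/eqP/andP => [E|[/eqP -> /eqP ->]]; last by rewrite m0p add0m.
  have m0 : m = 0%MM.
    apply/mnmP => i; rewrite mnm0E; have := bp i.
    by rewrite E mnmDE mulmnE; case: (m i) => // k; rewrite mulSn -addnA ltnNge leq_addr.
  by rewrite m0 eqxx E m0 m0p add0m.
rewrite E; have [_|_] := eqVneq b al; last by rewrite andbF mulr0 phi0.
rewrite andbT /= mcoeffC; case: (m == 0%MM); first by rewrite !mulr1.
by rewrite !mulr0 phi0.
Qed.
End Cartier.

Section FrobeniusCodim.
Variables (n : nat) (K : fieldType) (p : nat).
Hypothesis pK : p \in [pchar K].
Notation S := (mpseries n K).
Implicit Types (I J : set S).
Notation codimS := (cdim (@cst n K)).

Let p0 : (0 < p)%N. Proof. exact: prime_gt0 (pcharf_prime pK). Qed.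

(** If the v_i form a basis modulo I, the products of v_i^p and a monomial with
   exponents less than p are independent modulo I^[p]: apply to a relation the Cartier
   operator that isolates one of its nonzero coefficients. When K is perfect this is
   the freeness of K[[x]] of rank p^n over its p-th powers. *)
Lemma cdim_frob I : is_ideal I -> fincodim (cst n) I ->
  fincodim (cst n) (ideal_frob I p) -> (p ^ n * codimS I <= codimS (ideal_frob I p))%N.
Proof.
move=> iI fI fIp; have [v [_ iv]] := fincodimP fI.
pose al (a : {ffun 'I_n -> 'I_p}) : 'X_{1..n} := [multinom (a i : nat) | i < n].
have alp a i : (al a i < p)%N by rewrite mnmE.
have alI : injective al.
  by move=> a b /mnmP H; apply/ffunP => i; apply: val_inj; have := H i; rewrite !mnmE.
pose w (x : 'I_(codimS I) * {ffun 'I_n -> 'I_p}) := v x.1 ^+ p * monom K (al x.2).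
have <- : #|{: 'I_(codimS I) * {ffun 'I_n -> 'I_p}}| = (p ^ n * codimS I)%N.
  by rewrite card_prod card_ffun !card_ord mulnC.
apply: (@cdim_geq_indep _ _ (cst n) _ _ w) => //; first exact/ideal_subspace.
move=> c Ic [i0 a0]; apply/eqP; apply: contraT => c0; exfalso.
have [phi [phiD phiM phi1]] := frob_functional pK c0.
have phi0 : phi 0 = 0 by have := phiM 0 0; rewrite mulr0 mul0r.
have := cartier_frob pK phiD phiM (alp a0) iI Ic.
have -> : cartier p phi (al a0) (lincomb (cst n) w c) =
    lincomb (cst n) v (fun i => phi (c (i, a0))).
  rewrite /lincomb (big_morph (cartier p phi (al a0)) (id1 := 0) (op1 := +%R)); last 2 first.
  - exact: cartierD.
  - by apply: mpseriesP => k /=; rewrite phi0.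
  transitivity (\sum_i \sum_a cartier p phi (al a0) (cst n (c (i, a)) * w (i, a))).
    by rewrite pair_bigA; apply: eq_bigr => -[i a].
  apply: eq_bigr => i _; rewrite (bigD1 a0) //= big1 ?addr0 => [|a na].
    rewrite /w /= mulrCA (cartierM pK phiD phiM (alp a0)).
    by rewrite cartier_cst_monom // eqxx mulrC.
  rewrite /w /= mulrCA (cartierM pK phiD phiM (alp a0)) cartier_cst_monom //.
  by rewrite (inj_eq alI) (negPf na) mulr0.
by move=> /iv/(_ i0)/eqP; rewrite phi1 oner_eq0.
Qed.

(** Filter J + (f^j) by the powers of f. *)
Lemma cdim_adj_pow J f j : is_ideal J -> fincodim (cst n) J ->
  (codimS (adj J (f ^+ j)) <= j * codimS (adj J f))%N.
Proof.
move=> iJ fJ; have fA g : fincodim (cst n) (adj J g).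
  by apply: fincodimS fJ; [exact/ideal_subspace/adj_ideal|exact: sub_adj].
elim: j => [|j IH].
  rewrite expr0 (_ : adj J 1 = setT) ?cdim_setT //.
  by apply: ideal1T; [exact: adj_ideal|exact: mem_adj1].
have iI := adj_ideal (f ^+ j.+1) iJ.
apply: leq_trans (eq_leq (cdim_adj_colon (f ^+ j) iI (fA _))) _.
have -> : (j.+1 * codimS (adj J f) = j * codimS (adj J f) + codimS (adj J f))%N.
  exact: mulSnr.
apply: leq_add; last first.
  apply: cdimS; [exact/ideal_subspace/colon_ideal| |exact: fA].
  apply: adj_sub; [exact: colon_ideal| |].
    by move=> x Jx; apply: sub_colon => //; apply: sub_adj.
  by rewrite /colon /= -exprSr; apply: mem_adj1.
apply: leq_trans IH; apply: cdimS; [exact/ideal_subspace/adj_ideal| |exact: fA].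
by apply: adjS; apply: sub_adj.
Qed.

Lemma fincodim_adjs J s : is_ideal J -> fincodim (cst n) J -> fincodim (cst n) (adjs J s).
Proof.
by move=> iJ; apply: fincodimS; [exact/ideal_subspace/adjs_ideal|exact: sub_adjs].
Qed.

Lemma adjs_adj J f s : is_ideal J -> adjs (adj J f) s = adj (adjs J s) f.
Proof.
move=> iJ; have iA := adj_ideal f iJ; have iS := adjs_ideal s iJ.
apply/seteqP; split.
  apply: adjs_sub; [exact: adj_ideal|apply: adjS; exact: sub_adjs|].
  by move=> x xs; apply/sub_adj/mem_adjs.
apply: adj_sub; [exact: adjs_ideal|apply: adjsS; exact: sub_adj|].
exact/sub_adjs/mem_adj1.
Qed.

Lemma cdim_adjs_pow J s : is_ideal J -> fincodim (cst n) J ->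
  (codimS (adjs J [seq f ^+ p | f <- s]) <= p ^ size s * codimS (adjs J s))%N.
Proof.
move=> iJ fJ; elim: s J iJ fJ => [|f s IH] J iJ fJ /=; first by rewrite mul1n.
rewrite -adjs_adj // expnSr -mulnA.
have iA := adj_ideal (f ^+ p) iJ.
apply: leq_trans (IH _ iA _) _.
  by apply: fincodimS fJ; [exact/ideal_subspace|exact: sub_adj].
rewrite leq_mul2l adjs_adj //; apply/orP; right.
by apply: cdim_adj_pow; [exact: adjs_ideal|exact: fincodim_adjs].
Qed.

(** Division with remainder by p of the exponents of a monomial of degree (N + n) p
   loses less than p in each variable, so the quotient has degree at least N. *)
Lemma hsE_frob_step (I : set S) N q : is_ideal I -> hsE N q `<=` I ->
  hsE ((N + n) * p) (q * p) `<=` ideal_frob I p.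
Proof.
move=> iI EI; apply: ideal_add_sub => //.
  apply: ordge_sub_monom => // m mN.
  pose b : 'X_{1..n} := [multinom (m i %/ p)%N | i < n].
  pose c : 'X_{1..n} := [multinom (m i %% p)%N | i < n].
  have -> : m = (b *+ p + c)%MM.
    by apply/mnmP => i; rewrite mnmDE mulmnE !mnmE -divn_eq.
  rewrite monomD monomMn; apply: (@ideal_mulr _ (ideal_frob I p)) => //.
  apply: ideal_frob_pow.
  apply: EI; apply: ideal_add_subl => //; apply: (@ordgeS n K N (mdeg b) _ _ (@ordge_monom n K b)).
  rewrite -(leq_add2r n) -(leq_pmul2r p0) -mN mdegE mdegE.
  rewrite -[X in (_ <= (_ + X) * p)%N](card_ord n) -sum1_card -big_split big_distrl /=.
  apply: leq_sum => i _; rewrite !mnmE addn1 {1}(divn_eq (m i) p) mulSn addnC leq_add2r.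
  by rewrite ltnW // ltn_pmod.
apply: ideal_frob_sub => // v v1; rewrite exprM; apply: ideal_frob_pow.
by apply: EI; apply: ideal_add_subr => //; apply: ideal_frob_pow.
Qed.

(** Passing to p-th powers multiplies the codimension by at least p^n, and replacing
   the equations by their p-th powers by at most p to the number of equations. *)
Lemma hs_frob_step (fs : seq S) N q : (size fs <= n)%N ->
  (p ^ (n - size fs) * codimS (ideal_add (ideal_gen [set` fs]) (hsE N q)) <=
   codimS (ideal_add (ideal_gen [set` fs]) (hsE ((N + n) * p) (q * p))))%N.
Proof.
move=> sfs; rewrite -!adjsE; try exact: hsE_ideal.
have iE N' q' := @hsE_ideal n K N' q'.
have fE N' q' : fincodim (cst n) (hsE N' q' : set S).
  apply: (@fincodim_ordge _ _ _ N' (iE N' q')); exact: ideal_add_subl.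
set I := adjs (hsE N q) fs; have iI : is_ideal I by apply: adjs_ideal.
have EI : hsE N q `<=` I by apply: sub_adjs.
have EF := hsE_frob_step iI EI.
have fF : fincodim (cst n) (ideal_frob I p).
  by apply: (fincodimS _ EF) => //; apply: ideal_subspace.
have fI : fincodim (cst n) I by apply: fincodim_adjs.
have H1 := cdim_frob iI fI fF.
have H2 : (codimS (ideal_frob I p) <= codimS (adjs (hsE ((N + n) * p) (q * p)) [seq f ^+ p | f <- fs]))%N.
  apply: cdimS; [exact/ideal_subspace| |exact: fincodim_adjs].
  apply: adjs_sub => // _ /mapP[f ffs ->]; apply: ideal_frob_pow; exact: mem_adjs.
have H3 := cdim_adjs_pow fs (iE ((N + n) * p)%N (q * p)%N) (fE _ _).
have := leq_trans H1 (leq_trans H2 H3).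
have -> : (p ^ n = p ^ size fs * p ^ (n - size fs))%N by rewrite -expnD subnKC.
by rewrite -mulnA leq_pmul2l // expn_gt0 p0.
Qed.
End FrobeniusCodim.
End Frobenius.

(** * Completing squares *)

Section AdjoinFamily.
Variables (A : comPzRingType) (F : finType).
Implicit Types (J L : set A) (f : F -> A).

Definition adjf J f : set A :=
  [set x | exists2 a, J a & exists t : F -> A, x = a + \sum_i f i * t i].

Lemma adjf_ideal J f : is_ideal J -> is_ideal (adjf J f).
Proof.
move=> iJ; split.
- exists 0; first exact: ideal0.
  by exists (fun _ => 0); rewrite big1 ?addr0 // => i _; rewrite mulr0.
- move=> _ _ [a Ja [s ->]] [b Jb [t ->]]; exists (a + b); first exact: idealD.
  exists (fun i => s i + t i); rewrite addrACA -big_split /=.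
  by congr (_ + _); apply: eq_bigr => i _; rewrite mulrDr.
- move=> c _ [a Ja [t ->]]; exists (c * a); first exact: ideal_mull.
  exists (fun i => c * t i); rewrite mulrDr mulr_sumr.
  by congr (_ + _); apply: eq_bigr => i _; rewrite mulrCA.
Qed.

Lemma sub_adjf J f : J `<=` adjf J f.
Proof.
move=> a Ja; exists a => //; exists (fun _ => 0).
by rewrite big1 ?addr0 // => i _; rewrite mulr0.
Qed.

Lemma mem_adjf J f i : is_ideal J -> adjf J f (f i).
Proof.
move=> iJ; exists 0; first exact: ideal0.
exists (fun j => if j == i then 1 else 0); rewrite (bigD1 i) //= eqxx mulr1 add0r.
by rewrite big1 ?addr0 // => j /negPf ->; rewrite mulr0.
Qed.

Lemma adjf_sub J f L : is_ideal L -> J `<=` L -> (forall i, L (f i)) -> adjf J f `<=` L.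
Proof.
move=> iL JL fL _ [a /JL La [t ->]]; apply: idealD => //.
by apply: ideal_sum => // i _; apply: ideal_mulr.
Qed.
End AdjoinFamily.

Section CompleteSquares.
Variables (R : comNzRingType) (e : nat) (X : 'I_e -> R) (u half : R).
Hypothesis half2 : half * 2%:R = 1.

Definition lin (w : R) := exists t : 'I_e -> R, w = \sum_j X j * t j.

(** The square of the ideal generated by the X j, which is the predicate lin. *)
Definition sq (h : R) := exists2 w : 'I_e -> R, (forall i, lin (w i)) & h = \sum_i X i * w i.

Lemma linM a w : lin w -> lin (a * w).
Proof.
move=> [t ->]; exists (fun j => a * t j); rewrite mulr_sumr.
by apply: eq_bigr => j _; rewrite mulrCA.
Qed.
Lemma linD w w' : lin w -> lin w' -> lin (w + w').
Proof.
move=> [t ->] [t' ->]; exists (fun j => t j + t' j); rewrite -big_split.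
by apply: eq_bigr => j _; rewrite mulrDr.
Qed.
Lemma lin0 : lin 0.
Proof. by exists (fun _ => 0); rewrite big1 // => j _; rewrite mulr0. Qed.

Lemma sq0 : sq 0.
Proof. by exists (fun _ => 0) => [i|]; [exact: lin0|rewrite big1 // => i _; rewrite mulr0]. Qed.
Lemma sqD h h' : sq h -> sq h' -> sq (h + h').
Proof.
move=> [w lw ->] [w' lw' ->]; exists (fun i => w i + w' i) => [i|]; first exact: linD.
by rewrite -big_split; apply: eq_bigr => i _; rewrite mulrDr.
Qed.
Lemma sqM a h : sq h -> sq (a * h).
Proof.
move=> [w lw ->]; exists (fun i => a * w i) => [i|]; first exact: linM.
by rewrite mulr_sumr; apply: eq_bigr => i _; rewrite mulrCA.
Qed.
Lemma sq_sum (I : Type) (r : seq I) (F : I -> R) :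
  (forall i, sq (F i)) -> sq (\sum_(i <- r) F i).
Proof. by move=> H; apply: big_ind => // [|x y]; [exact: sq0|exact: sqD]. Qed.
Lemma sq_lin2 w w' : lin w -> lin w' -> sq (w * w').
Proof.
move=> [t ->] lw'; exists (fun i => t i * w') => [i|]; first exact: linM.
by rewrite mulr_suml; apply: eq_bigr => i _; rewrite mulrA.
Qed.

(** Newton iteration in u: if the error is u^(k+1) g with g the sum of the X_i w_i,
   the correction -1/2 u^k w_j of z_j kills its leading part. *)
Lemma complete_squares h k : sq h -> exists z : 'I_e -> R, (forall j, lin (z j)) /\
  exists2 g, sq g &
  \sum_j (X j + u * z j) ^+ 2 - \sum_j X j ^+ 2 - u * h = u ^+ k.+1 * g.
Proof.
move=> sh; elim: k => [|k [z [lz [g [w lw ->] E]]]].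
  exists (fun _ => 0); split=> [j|]; first exact: lin0.
  exists (- h); first by rewrite -mulN1r; apply: sqM.
  under eq_bigr do rewrite mulr0 addr0.
  by rewrite subrr expr1; ring.
exists (fun j => z j - u ^+ k * half * w j); split=> [j|].
  by apply: linD => //; rewrite -mulNr; apply: linM.
exists (\sum_j (u ^+ k * half ^+ 2 * (w j * w j) - z j * w j)).
  apply: sq_sum => j; apply: sqD; first by apply/sqM/sq_lin2.
  by rewrite -mulN1r; apply/sqM/sq_lin2.
have -> : \sum_j (X j + u * (z j - u ^+ k * half * w j)) ^+ 2 =
    \sum_j (X j + u * z j) ^+ 2 - u ^+ k.+1 * (\sum_j X j * w j) +
    u ^+ k.+2 * \sum_j (u ^+ k * half ^+ 2 * (w j * w j) - z j * w j).
  rewrite !mulr_sumr -sumrB -big_split /=; apply: eq_bigr => j _.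
  have -> : (X j + u * (z j - u ^+ k * half * w j)) ^+ 2 =
    (X j + u * z j) ^+ 2 - (half * 2%:R) * (u * u ^+ k) * (X j + u * z j) * w j +
     (u * u ^+ k) * (u * u ^+ k) * half ^+ 2 * (w j * w j) by ring.
  by rewrite half2 !exprS; ring.
have -> : u ^+ k.+1 * (\sum_j X j * w j) =
  \sum_j (X j + u * z j) ^+ 2 - \sum_j X j ^+ 2 - u * h by [].
by ring.
Qed.

Section Eliminate.
Variables (w : nat) (W y : 'I_w -> R) (f : option 'I_w -> R).
Hypothesis yE : forall i, y i = W i + u * f (Some i).
Hypothesis fE : forall o, exists2 h, sq h & exists c, f o = h + \sum_i W i * c i.

(** Replace W i by y i - u f i in the expression of f o, again and again: each round
   gains a factor u in front of the part that is not yet in the desired form. *)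
Lemma eliminate_linear k o : exists2 h, sq h & exists s v,
  f o = h + \sum_i y i * s i + u ^+ k * v.
Proof.
elim: k o => [|k IH] o.
  exists 0; first exact: sq0.
  exists (fun _ => 0), (f o); rewrite big1 ?add0r ?expr0 ?mul1r // => i _.
  by rewrite mulr0.
have [h sh [c ->]] := fE o.
have /choice[H HP] i : exists h, sq h /\ exists s v,
    f (Some i) = h + \sum_i y i * s i + u ^+ k * v.
  by have [h' ? ?] := IH (Some i); exists h'.
have /choice[s sP] i : exists s, exists v, f (Some i) = H i + \sum_i y i * s i + u ^+ k * v.
  exact: (HP i).2.
have /choice[v vP] := sP.
exists (h - u * \sum_i H i * c i).
  apply: sqD => //; rewrite -mulNr; apply: sqM; apply: sq_sum => i.
  by rewrite mulrC; apply: sqM; case: (HP i).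
exists (fun j => c j - u * \sum_i s i j * c i), (- \sum_i v i * c i).
have -> : \sum_j y j * (c j - u * \sum_i s i j * c i) =
    \sum_j y j * c j - u * \sum_i (\sum_j y j * s i j) * c i.
  under eq_bigr do rewrite mulrBr; rewrite sumrB; congr (_ - _).
  rewrite mulr_sumr; under [RHS]eq_bigr do rewrite mulr_suml mulr_sumr.
  rewrite exchange_big /=; apply: eq_bigr => j _.
  by rewrite mulrCA !mulr_sumr; apply: eq_bigr => i _; ring.
have -> : \sum_i W i * c i = \sum_i y i * c i - u * (\sum_i H i * c i) -
    u * (\sum_i (\sum_j y j * s i j) * c i) - u ^+ k.+1 * \sum_i v i * c i.
  rewrite !mulr_sumr -!sumrB; apply: eq_bigr => i _.
  have -> : W i = y i - u * f (Some i) by rewrite yE addrK.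
  by rewrite vP exprS; ring.
by ring.
Qed.

(** A Morse lemma with parameter: modulo u^(k+1) and the modified linear forms y i,
   the perturbed quadric is the sum of the squares of modified coordinates. *)
Lemma morse k : exists z : 'I_e -> R, (forall j, lin (z j)) /\
  exists s v, \sum_j X j ^+ 2 + u * f None =
    \sum_j (X j + u * z j) ^+ 2 + \sum_i y i * s i + u ^+ k.+1 * v.
Proof.
have [h sh [s [v E]]] := eliminate_linear k None.
have [z [lz [g _ Eg]]] := complete_squares k sh.
exists z; split=> //; exists (fun i => u * s i), (v - g).
have -> : \sum_i y i * (u * s i) = u * \sum_i y i * s i.
  by rewrite mulr_sumr; apply: eq_bigr => i _; rewrite mulrCA.
rewrite mulrBr -Eg E exprS; ring.
Qed.
End Eliminate.
End CompleteSquares.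

(** * Deformation to a quadric *)

Module Deformation.
Import mpoly.

Section Monomials.
Variables (n : nat) (K : fieldType).
Notation P := {mpoly K[n]}.
Variables (N q : nat).

(** The polynomial counterpart of m^N + m^[q]. In this finite-dimensional setting
   there is room for a further variable u. *)
Definition expI : set P := ideal_gen
  [set f | (exists2 m, (N <= mdeg m)%N & f = 'X_[m]) \/ (exists i, f = 'X_i ^+ q)].

Let iE : is_ideal expI. Proof. exact: ideal_gen_ideal. Qed.

Lemma expI_monom m f : (N <= mdeg m)%N -> expI ('X_[m] * f).
Proof.
by move=> Nm; apply: (ideal_mulr _ iE); apply: sub_ideal_gen; left; exists m.
Qed.

Lemma expI_pow i f : expI ('X_i ^+ q * f).
Proof. by apply: (ideal_mulr _ iE); apply: sub_ideal_gen; right; exists i. Qed.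

Lemma spans_expI : spans (@mpolyC n K) expI (fun m : 'X_{1..n < N} => 'X_[m]).
Proof.
move=> f; exists (fun m : 'X_{1..n < N} => f@_m).
have -> : lincomb (@mpolyC n K) (fun m : 'X_{1..n < N} => 'X_[m]) (fun m : 'X_{1..n < N} => f@_m) =
    \sum_(m : 'X_{1..n < N}) f@_m *: 'X_[m].
  by apply: eq_bigr => m _; rewrite mul_mpolyC.
set g := \sum_(m : _) _.
rewrite [f - g]mpolyE; apply: (ideal_sum _ iE) => m _.
rewrite -mul_mpolyC mulrC.
have [Nm|mN] := leqP N (mdeg m); first exact: expI_monom.
by rewrite mcoeffB /g (mcoeff_mpoly (fun m => f@_m)) // subrr mpolyC0 mulr0; apply: (ideal0 iE).
Qed.
End Monomials.
Arguments expI {n K} N q _.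

Section Deformation.
Variables (K : fieldType) (p w e : nat).
Hypotheses (pK : p \in [pchar K]) (two : 2%:R != 0 :> K).
Notation n := (w + e)%N.
Notation P := {mpoly K[n]}.
Notation T := {poly P}.
Definition cP : K -> P := @mpolyC n K.
HB.instance Definition _ := GRing.RMorphism.on cP.
Definition cT : K -> T := @polyC P \o cP.
HB.instance Definition _ := GRing.RMorphism.on cT.

Variables (N e0 : nat).
Notation q := (p ^ e0)%N.
Notation E := (@expI n K N q).
Notation xT := (fun i : 'I_n => ('X_i)%:P : T).

Let iE : is_ideal E. Proof. exact: ideal_gen_ideal. Qed.

Lemma spansE : spans cP E (fun m : 'X_{1..n < N} => 'X_[m]).
Proof. exact: spans_expI. Qed.

Lemma fincodimE : fincodim cP E.
Proof. by have [] := cdim_leq_spans (ideal_subspace cP iE) spansE. Qed.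

Lemma polyT_pchar : p \in [pchar T].
Proof.
rewrite inE /= (pcharf_prime pK) /=.
by rewrite -(rmorph_nat cT) (pcharf0 pK) rmorph0.
Qed.

(** The ideal generated by J and u^L in P[u], the variable of {poly P} being called u.
   *)
Definition lowI (J : set P) L : set T := [set t | forall j, (j < L)%N -> J t`_j].

Lemma lowI_ideal J L : is_ideal J -> is_ideal (lowI J L).
Proof.
move=> iJ; split=> [j _|a b Ha Hb j jL|a b Hb j jL].
- by rewrite coef0; apply: ideal0.
- by rewrite coefD; apply: idealD => //; [exact: Ha|exact: Hb].
- rewrite coefM; apply: ideal_sum => // i _; apply: ideal_mull => //; apply: Hb.
  exact: leq_ltn_trans (leq_subr _ _) jL.
Qed.

Lemma lowI_C J L a t : is_ideal J -> (forall f, J (a * f)) -> lowI J L (a%:P * t).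
Proof. by move=> iJ H j _; rewrite coefCM. Qed.

Lemma lowI_Xn J L t : is_ideal J -> lowI J L ('X^L * t).
Proof. by move=> iJ j jL; rewrite coefXnM jL; apply: ideal0. Qed.

Section Substitution.
Variables (L : nat) (y : 'I_n -> T).
Hypothesis ylin : forall i, lin xT (y i).
Variables (U V : 'M[K]_n) (v : 'I_n -> T).
Hypothesis VU : V *m U = 1%:M.
Hypothesis yU : forall i, y i = \sum_j cT (U i j) * xT j + 'X * v i.
Notation ET := (lowI E L).

Let iET : is_ideal ET. Proof. exact: lowI_ideal. Qed.

(** The change of variables x_i -> y_i, where y_i agrees at u = 0 with the invertible
   linear change given by U. *)
Definition subP : P -> T := mmap cT y.
HB.instance Definition _ := GRing.RMorphism.on subP.
Definition subT : T -> T := horner_eval 'X \o map_poly subP.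
HB.instance Definition _ := GRing.RMorphism.on subT.

Lemma subT_C f : subT f%:P = subP f.
Proof. by rewrite /subT /= map_polyC /horner_eval hornerC. Qed.
Lemma subT_X : subT 'X = 'X.
Proof. by rewrite /subT /= map_polyX /horner_eval hornerX. Qed.
Lemma subP_X i : subP 'X_i = y i.
Proof. by rewrite /subP mmapX mmap1U. Qed.
Lemma subT_cT c : subT (cT c) = cT c.
Proof. by rewrite /cT /= subT_C /subP mmapC. Qed.

(** A monomial of degree at least N goes to a combination of products of the y_i,
   which are combinations of the x_j: replace these one at a time. *)
Lemma subP_monom m m' t : (N <= mdeg m + mdeg m')%N ->
  ET (('X_[m'] : P)%:P * subP 'X_[m] * t).
Proof.
move: {2}(mdeg m) (erefl (mdeg m)) => k; elim: k m m' t => [|k IH] m m' t mk Nm.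
  rewrite -mulrA; apply: lowI_C => // f; apply: expI_monom.
  by move: Nm; rewrite mk.
have [i mi] : exists i, m i != 0%N.
  apply: contrapT => /forallNP H; have : mdeg m = 0%N.
    by rewrite mdegE big1 // => i _; apply/eqP; rewrite -[_ == _]negbK; apply/negP/H.
  by rewrite mk.
have Em : m = (m - U_(i) + U_(i))%MM by rewrite submK // lep1mP.
have dm : mdeg (m - U_(i))%MM = k.
  by move: mk; rewrite {1}Em mdegD mdeg1 addn1 => -[].
have [s ys] := ylin i.
rewrite Em mpolyXD rmorphM /= subP_X ys mulr_sumr mulr_sumr mulr_suml.
apply: (ideal_sum _ iET) => j _.
have -> : ('X_[m'] : P)%:P * (subP 'X_[m - U_(i)] * (('X_j)%:P * s j)) * t =
    ('X_[m' + U_(j)] : P)%:P * subP 'X_[m - U_(i)] * (s j * t).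
  rewrite mpolyXD polyCM; move: (subP _) => c; ring.
apply: IH => //; rewrite mdegD mdeg1; move: Nm; rewrite mk dm.
by rewrite addnA addn1 addSn addnC.
Qed.

(** Here it matters that q is a power of the characteristic: the q-th power of a
   combination of the x_j is a combination of their q-th powers. *)
Lemma subP_E f : E f -> ET (subP f).
Proof.
suff: E `<=` [set f | ET (subP f)] by exact.
apply: ideal_gen_sub; first exact: (@preimage_ideal _ _ subP).
move=> _ [[m Nm ->]|[i ->]] /=.
  have := @subP_monom m 0%MM 1; rewrite mpolyX0 mul1r mulr1; apply.
  by rewrite mdeg0 addn0.
rewrite rmorphXn /= subP_X; have [s ->] := ylin i.
rewrite (Frobenius.frob_sum polyT_pchar); apply: (ideal_sum _ iET) => j _.
by rewrite exprMn -rmorphXn; apply: lowI_C => // g; apply: expI_pow.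
Qed.

Lemma poly_low_split L' (t : T) : exists s, t = \sum_(j < L') (t`_j)%:P * 'X^j + 'X^L' * s.
Proof.
elim: L' => [|k [s IH]]; first by exists t; rewrite big_ord0 add0r expr0 mul1r.
have [s' Es] : exists s', s = 'X * s' + (s`_0)%:P.
  by elim/poly_ind: s {IH} => [|s c _]; [exists 0; rewrite coef0 mulr0 addr0|exists s; rewrite coefD coefMX coefC /= add0r commr_polyX].
exists s'; rewrite big_ord_recr /= {1}IH {1}Es mulrDr exprSr -!mulrA addrA addrAC.
congr (_ + _ + _); rewrite mulrC; congr (_ %:P * _).
rewrite [in RHS]IH coefD coef_sum big1 => [|i _]; last first.
  by rewrite coefCM coefXn gtn_eqF ?mulr0.
by rewrite add0r coefXnM ltnn subnn.
Qed.

Lemma subT_ET t : ET t -> ET (subT t).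
Proof.
move=> Ht; have [s ->] := poly_low_split L t.
rewrite rmorphD rmorph_sum rmorphM rmorphXn /= subT_X.
apply: (idealD iET); last exact: lowI_Xn.
apply: (ideal_sum _ iET) => j _; rewrite rmorphM /= subT_C; apply: (ideal_mulr _ iET).
by apply: subP_E; apply: Ht.
Qed.

(** At u = 0 the substitution is invertible, with inverse V. *)
Lemma subT_surj1 t : exists a b, t = subT a + 'X * b.
Proof.
pose Z : set T := [set t | exists a b, t = subT a + 'X * b].
have ZD s s' : Z s -> Z s' -> Z (s + s').
  move=> [a [b ->]] [a' [b' ->]]; exists (a + a'), (b + b').
  by rewrite rmorphD /=; move: (subT a) (subT a') => c c'; ring.
have ZM s s' : Z s -> Z s' -> Z (s * s').
  move=> [a [b ->]] [a' [b' ->]].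
  exists (a * a'), (subT a * b' + b * subT a' + 'X * b * b').
  by rewrite rmorphM /=; move: (subT a) (subT a') => c c'; ring.
have ZC c : Z (cT c) by exists (cT c), 0; rewrite subT_cT mulr0 addr0.
have Zx j : Z (xT j).
  exists (\sum_i cT (V j i) * xT i), (- \sum_i cT (V j i) * v i).
  rewrite rmorph_sum mulrN mulr_sumr -sumrB.
  have -> : \sum_i (subT (cT (V j i) * xT i) - 'X * (cT (V j i) * v i)) =
      \sum_i \sum_l cT (V j i * U i l) * xT l.
    apply: eq_bigr => i _; rewrite rmorphM /= subT_cT subT_C subP_X yU.
    rewrite mulrDr mulrCA addrK mulr_sumr; apply: eq_bigr => l _.
    by rewrite rmorphM mulrA.
  rewrite exchange_big.
  have -> : \sum_l \sum_i cT (V j i * U i l) * xT l = \sum_l cT ((j == l)%:R) * xT l.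
    apply: eq_bigr => l _; rewrite -mulr_suml -rmorph_sum.
    by have /matrixP/(_ j l) := VU; rewrite !mxE => ->.
  rewrite (bigD1 j) // eqxx rmorph1 mul1r big1; first exact/esym/addr0.
  move=> l lj.
  by rewrite eq_sym (negPf lj) rmorph0 mul0r.
have ZP f : Z f%:P.
  rewrite [f]mpolyE rmorph_sum; apply: (big_ind Z) => [||m _]; [|exact: ZD|].
    by rewrite -(rmorph0 cT).
  rewrite -mul_mpolyC rmorphM; apply: (ZM); first exact: ZC.
  rewrite mpolyXE_id rmorph_prod; apply: (big_ind Z) => [||i _]; [|exact: ZM|].
    by rewrite -(rmorph1 cT).
  rewrite rmorphXn /=; elim: (m i) => [|k IH]; first by rewrite expr0 -(rmorph1 cT).
  by rewrite exprS; apply: (ZM).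
suff: Z t by [].
elim/poly_ind: t => [|t c _]; first by rewrite -(rmorph0 cT); apply: ZC.
apply: (ZD); last exact: ZP.
by exists 0, t; rewrite rmorph0 add0r commr_polyX.
Qed.

Lemma subT_surj t : exists a, ET (t - subT a).
Proof.
suff H k : exists a b, t = subT a + 'X^k * b.
  have [a [b ->]] := H L; exists a; rewrite addrC addKr; exact: lowI_Xn.
elim: k => [|k [a [b ->]]]; first by exists 0, t; rewrite rmorph0 add0r expr0 mul1r.
have [a' [b' ->]] := subT_surj1 b; exists (a + 'X^k * a'), b'.
rewrite rmorphD rmorphM rmorphXn /= subT_X exprS.
by move: (subT a) (subT a') => c c'; ring.
Qed.

Hypothesis fET : fincodim cT ET.

(** The substitution induces a surjective endomorphism of the finite-dimensional space
   P[u]/(E, u^L), which is therefore bijective. *)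
Lemma subT_ETE t : ET t <-> ET (subT t).
Proof.
split=> [|H]; first exact: subT_ET.
pose Z : set T := [set t | ET (subT t)].
have iZ : is_ideal Z by apply: (@preimage_ideal _ _ subT).
have sub : ET `<=` Z by move=> s; apply: subT_ET.
have sZ := ideal_subspace cT iZ; have sE := ideal_subspace cT iET.
have fZ := fincodimS sZ sub fET.
have [_ c] := cdim_transport subT_cT sZ sE fZ (fun a => conj id id) subT_surj.
by apply: (cdim_eq_sub sE sZ sub fET) H; rewrite c.
Qed.

Lemma cdim_subT (F : finType) (g : F -> T) :
  cdim cT (adjf ET (fun i => subT (g i))) = cdim cT (adjf ET g).
Proof.
have iG := adjf_ideal g iET; have iS := adjf_ideal (fun i => subT (g i)) iET.
have sG := ideal_subspace cT iG; have sS := ideal_subspace cT iS.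
have fG := fincodimS sG (@sub_adjf _ _ ET g) fET.
have H t : adjf ET g t <-> adjf ET (fun i => subT (g i)) (subT t).
  split=> [[a Ea [s ->]]|[a Ea [s E1]]].
    exists (subT a); first exact: subT_ET.
    exists (fun i => subT (s i)); rewrite rmorphD rmorph_sum; congr (_ + _).
    by apply: eq_bigr => i _; rewrite rmorphM.
  have /choice[r Hr] i := subT_surj (s i).
  exists (t - \sum_i g i * r i); last by exists r; rewrite subrK.
  apply/subT_ETE; rewrite rmorphB /= E1 rmorph_sum -addrA -sumrB.
  apply: (idealD iET) => //; apply: (ideal_sum _ iET) => i _.
  by rewrite rmorphM -mulrBr; apply: (ideal_mull _ iET).
have hd t : exists a, adjf ET (fun i => subT (g i)) (t - subT a).
  by have [a Ha] := subT_surj t; exists a; apply: sub_adjf.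
by have [_] := cdim_transport subT_cT sG sS fG H hd.
Qed.
End Substitution.

Section LowCodim.
Variables (J : set P) (L : nat) (F : finType) (v : F -> P).
Hypothesis iJ : is_ideal J.
Let vT (x : 'I_L * F) : T := (v x.2)%:P * 'X^(x.1).

Lemma lincomb_low c (j : 'I_L) :
  (lincomb cT vT c)`_j = lincomb cP v (fun i => c (j, i)).
Proof.
rewrite /lincomb coef_sum.
transitivity (\sum_(l < L) \sum_i (cT (c (l, i)) * vT (l, i))`_j).
  by rewrite pair_bigA; apply: eq_bigr => -[l i].
have E1 l i : (cT (c (l, i)) * vT (l, i))`_j = cP (c (l, i)) * v i * (j == l)%:R.
  rewrite /vT /= mulrA -polyCM coefCM coefXn.
  by congr (_ * (_ : bool)%:R); rewrite -val_eqE.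
rewrite (bigD1 j) //= [X in _ + X]big1 => [|l lj].
  rewrite [LHS]addr0; apply: eq_bigr => i _; by rewrite E1 eqxx mulr1.
by apply: big1 => i _; rewrite E1 eq_sym (negPf lj) mulr0.
Qed.

Lemma spans_low : spans cP J v -> spans cT (lowI J L) vT.
Proof.
move=> sv t; have /choice[c Hc] j := sv t`_j.
exists (fun x : 'I_L * F => c x.1 x.2) => j jL.
by rewrite coefB (lincomb_low _ (Ordinal jL)).
Qed.

Lemma indep_low : indep cP J v -> indep cT (lowI J L) vT.
Proof.
move=> iv c Hc [j i]; apply: (iv (fun i => c (j, i))).
by rewrite -lincomb_low; apply: Hc.
Qed.
End LowCodim.

(** P[u]/(J, u^L) has the basis v_i u^j, for v a basis of P/J and j < L. *)
Lemma cdim_low J L : is_ideal J -> fincodim cP J ->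
  fincodim cT (lowI J L) /\ cdim cT (lowI J L) = (L * cdim cP J)%N.
Proof.
move=> iJ /fincodimP[v [sv iv]].
have sL := ideal_subspace cT (lowI_ideal L iJ).
have c := basis_codim (spans_low L sv) (indep_low iv).
rewrite card_prod !card_ord in c.
by split; [eexists; exact: c|exact: cdimE].
Qed.

Section Family.
Variables (f : option 'I_w -> P) (U V : 'M[K]_n).
Hypothesis VU : V *m U = 1%:M.
Notation lf := (fun i : 'I_n => \sum_j cP (U i j) * 'X_j : P).
Hypothesis fdec : forall o, exists2 h, sq (fun j : 'I_e => lf (rshift w j)) h &
  exists c, f o = h + \sum_i lf (lshift e i) * c i.

(** The equations of the quadric in the coordinates themselves; quadL is the same
   quadric in the coordinates given by U. *)
Definition quadG (o : option 'I_w) : P :=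
  if o is Some i then 'X_(lshift e i) else \sum_(j < e) 'X_(rshift w j) ^+ 2.
Definition quadL (o : option 'I_w) : P :=
  if o is Some i then lf (lshift e i) else \sum_(j < e) lf (rshift w j) ^+ 2.

(** The line that joins the quadric, at u = 0, to the family f, at infinity. *)
Definition pencil (o : option 'I_w) : T := (quadL o)%:P + 'X * (f o)%:P.

(** By morse, the pencil is contained, modulo u^L, in the image of the ideal of the
   quadric under a change of variables that depends on u, and such a change preserves
   codimensions. *)
Lemma pencil_trivial L : (0 < L)%N ->
  (cdim cT (adjf (lowI E L) (fun o => (quadG o)%:P : T)) <=
   cdim cT (adjf (lowI E L) pencil))%N.
Proof.
case: L => // L _.
pose X j : T := (lf (rshift w j))%:P.
pose W i : T := (lf (lshift e i))%:P.
pose F o : T := (f o)%:P.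
pose yW i : T := W i + 'X * F (Some i).
have half2 : cT (2%:R^-1) * 2%:R = 1.
  by rewrite -(rmorph_nat cT) -rmorphM mulVf // rmorph1.
have decT o : exists2 h, sq X h & exists c, F o = h + \sum_i W i * c i.
  have [h [v lv ->] [c Ec]] := fdec o.
  exists (\sum_i X i * (v i)%:P).
    exists (fun i => (v i)%:P) => // i; have [t ->] := lv i.
    exists (fun j => (t j)%:P); rewrite rmorph_sum; apply: eq_bigr => j _.
    exact: polyCM.
  exists (fun i => (c i)%:P); rewrite /F Ec polyCD !rmorph_sum; congr (_ + _).
    by apply: eq_bigr => i _; apply: polyCM.
  by apply: eq_bigr => i _; apply: polyCM.
have [z [lz [s [r Es]]]] := morse half2 (fun i => erefl (yW i)) decT L.
(* The new coordinates: the first w members of the pencil and the square roots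
   provided by morse. *)
pose y (i : 'I_n) : T := match split i with inl a => yW a | inr b => X b + 'X * z b end.
have linlf i : lin xT (lf i)%:P.
  exists (fun j => cT (U i j)); rewrite rmorph_sum; apply: eq_bigr => j _.
  exact: (etrans (polyCM _ _) (mulrC _ _)).
have linX c : lin X c -> lin xT c.
  move=> [t ->]; apply: (big_ind (lin xT)) => [||j _]; first exact: lin0.
    exact: linD.
  by rewrite mulrC; apply/linM/linlf.
have linF o : lin xT (F o).
  have [_ [h lh ->] [c ->]] := decT o; apply: linD.
    apply: (big_ind (lin xT)) => [||j _]; [exact: lin0|exact: linD|].
    by rewrite mulrC; apply/linM/linlf.
  apply: (big_ind (lin xT)) => [||j _]; [exact: lin0|exact: linD|].
  by rewrite mulrC; apply/linM/linlf.
have ylin i : lin xT (y i).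
  rewrite /y; case: split => a; apply: linD; try exact: linlf.
    exact/linM/linF.
  exact/linM/linX.
pose v (i : 'I_n) : T := match split i with inl a => F (Some a) | inr b => z b end.
have yU i : y i = \sum_j cT (U i j) * xT j + 'X * v i.
  have lfE : \sum_j cT (U i j) * xT j = (lf i)%:P.
    by rewrite rmorph_sum; apply: eq_bigr => j _; apply/esym/polyCM.
  by rewrite lfE -(splitK i) /y /v unsplitK; case: split.
have iET := lowI_ideal L.+1 iE.
have [fET _] := cdim_low L.+1 iE fincodimE.
have HT := cdim_subT ylin VU yU fET.
rewrite -HT; apply: cdimS.
- exact/ideal_subspace/adjf_ideal.
- pose I := adjf (lowI E L.+1) (fun o => subT y (quadG o)%:P).
  have iI : is_ideal I by apply: adjf_ideal.
  have IW i : I (yW i).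
    have := mem_adjf (fun o => subT y (quadG o)%:P) (Some i) iET.
    by rewrite subT_C /quadG subP_X /y (unsplitK (inl i : 'I_w + 'I_e)).
  have IQ : I (\sum_j (X j + 'X * z j) ^+ 2).
    have := mem_adjf (fun o => subT y (quadG o)%:P) None iET.
    rewrite subT_C /quadG rmorph_sum; congr (I _); apply: eq_bigr => j _.
    by rewrite rmorphXn /= subP_X /y (unsplitK (inr j : 'I_w + 'I_e)).
  apply: adjf_sub => //; first exact: sub_adjf.
  case=> [i|]; first exact: IW.
  have -> : pencil None = \sum_j X j ^+ 2 + 'X * F None.
    by rewrite /pencil /quadL rmorph_sum; congr (_ + _); apply: eq_bigr => j _; rewrite rmorphXn.
  rewrite Es; apply: (idealD iI); first apply: (idealD iI) => //.
    by apply: (ideal_sum _ iI) => i _; apply: (ideal_mulr _ iI).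
  by apply: sub_adjf; apply: lowI_Xn.
- by apply: fincodimS fET; [exact/ideal_subspace/adjf_ideal|exact: sub_adjf].
Qed.

(** With b = t o, c = 'X^j and y the variable: multiplying a member of the pencil by a
   multiple of u^j trades a multiple of f o in degree j + 1 for one of quadL o in
   degree j. *)
Lemma pencil_identity (a b c x y : T) :
  b * c * (x * y) = (a + x * b) * (c * y) + - (a * c) * y.
Proof. by ring. Qed.

(** Modulo the pencil, u f_o lies in P. So a multiple of u^(j+1) can be reduced to a
   combination of b_i u^(j+1), where b is a basis modulo the ideal of f, at the cost
   of a multiple of u^j; in degree 0 the monomials of degree less than N generate. The
   excess over L times the codimension of f is thus independent of L. *)
Lemma cdim_pencil L : (cdim cT (adjf (lowI E L) pencil) <=
  L * cdim cP (adjf E f) + #|{: 'X_{1..n < N}}|)%N.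
Proof.
have iA := adjf_ideal f iE; have sA := ideal_subspace cP iA.
have fA := fincodimS sA (@sub_adjf _ _ E f) fincodimE.
have [b [sb _]] := fincodimP fA.
have iET := lowI_ideal L iE.
pose I := adjf (lowI E L) pencil; have iI : is_ideal I by apply: adjf_ideal.
have sI := ideal_subspace cT iI.
pose fam (x : ('I_L * 'I_(cdim cP (adjf E f))) + {: 'X_{1..n < N}}) : T :=
  match x with inl x => (b x.2)%:P * 'X^(x.1) | inr m => ('X_[m])%:P end.
suff sp : spans cT I fam.
  have [_] := cdim_leq_spans sI sp.
  by rewrite card_sum card_prod !card_ord.
pose Z : set T := [set t | exists c, I (t - lincomb cT fam c)].
have ZD s t : Z s -> Z t -> Z (s + t).
  move=> [c Hc] [d Hd]; exists (fun x => c x + d x).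
  have -> : lincomb cT fam (fun x => c x + d x) = lincomb cT fam c + lincomb cT fam d.
    by rewrite /lincomb -big_split; apply: eq_bigr => x _; rewrite rmorphD mulrDl.
  by rewrite opprD addrACA; exact: (idealD iI Hc Hd).
have ZI t : I t -> Z t.
  move=> It; exists (fun _ => 0); rewrite /lincomb big1 ?subr0 // => x _.
  by rewrite rmorph0 mul0r.
have Zf c x : Z (cT c * fam x).
  exists (fun x' => if x' == x then c else 0).
  rewrite /lincomb (bigD1 x) // eqxx big1 => [|x' /negPf ->].
    by rewrite [X in _ - X]addr0 subrr; apply: (ideal0 iI).
  by rewrite rmorph0 mul0r.
have Zsum (T' : finType) (g : T' -> T) : (forall i, Z (g i)) -> Z (\sum_i g i).
  move=> H; apply: (big_ind Z) => //; by apply: ZI; apply: (ideal0 iI).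
have ZX j a : Z ((a : P)%:P * 'X^j).
  elim: j a => [|j IH] a.
    have [c Hc] := spansE a; rewrite -[a](subrK (lincomb cP (fun m : 'X_{1..n < N} => 'X_[m]) c)).
    rewrite expr0 mulr1 polyCD; apply: (ZD).
      apply: ZI; apply: sub_adjf; rewrite -[_%:P]mulr1; apply: lowI_C => // g.
      exact: (ideal_mulr _ iE).
    rewrite rmorph_sum; apply: Zsum => m.
    have := Zf (c m) (inr m); congr (Z _); exact/esym/polyCM.
  have [jL|Lj] := ltnP j.+1 L; last first.
    apply/ZI/sub_adjf; rewrite -(subnK Lj) exprD mulrA mulrC.
    exact: lowI_Xn.
  have [c [g Eg [t Ec]]] := sb a.
  have -> : a = g + \sum_o f o * t o + lincomb cP b c by rewrite -Ec subrK.
  rewrite polyCD mulrDl; apply: (ZD); last first.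
    rewrite rmorph_sum mulr_suml; apply: Zsum => i.
    have := Zf (c i) (inl (Ordinal jL, i)); congr (Z _).
    by rewrite mulrA; congr (_ * _); apply/esym/polyCM.
  rewrite polyCD mulrDl; apply: (ZD).
    apply/ZI/sub_adjf; apply: lowI_C => // g'; exact: (ideal_mulr _ iE).
  rewrite rmorph_sum mulr_suml; apply: Zsum => o.
  have -> : (f o * t o)%:P * 'X^(j.+1) =
      pencil o * ((t o)%:P * 'X^j) + (- (quadL o * t o))%:P * 'X^j.
    rewrite /pencil polyCN !polyCM exprS; exact: pencil_identity.
  apply: (ZD); last exact: IH.
  by apply: ZI; apply: (ideal_mulr _ iI); apply: mem_adjf.
move=> t; suff: Z t by [].
rewrite -[t]coefK poly_def; apply: Zsum => j.
by rewrite -mul_polyC; apply: ZX.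
Qed.

(** L times the left-hand side is at most L times the right-hand side plus a constant,
   for every L. *)
Theorem cdim_quadric_le : (cdim cP (adjf E quadG) <= cdim cP (adjf E f))%N.
Proof.
rewrite leqNgt; apply/negP => lt.
(* L = C + 1 already gives a contradiction. *)
set C := #|{: 'X_{1..n < N}}|.
have iG := adjf_ideal quadG iE; have sG := ideal_subspace cP iG.
have fG := fincodimS sG (@sub_adjf _ _ E quadG) fincodimE.
have [fL cL] := cdim_low C.+1 iG fG.
have H1 := pencil_trivial (ltn0Sn C).
have H2 := cdim_pencil C.+1.
have H3 : (cdim cT (lowI (adjf E quadG) C.+1) <=
    cdim cT (adjf (lowI E C.+1) (fun o => (quadG o)%:P : T)))%N.
  have iET := lowI_ideal C.+1 iE; have [fET _] := cdim_low C.+1 iE fincodimE.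
  apply: cdimS; first exact/ideal_subspace/lowI_ideal.
    apply: adjf_sub; first exact: lowI_ideal.
      by move=> t Ht j jL; apply: sub_adjf; apply: Ht.
    move=> o; rewrite -[_%:P]mulr1; apply: lowI_C => // g.
    by apply: (ideal_mulr _ iG); apply: mem_adjf.
  apply: fincodimS fET; first exact/ideal_subspace/adjf_ideal.
  exact: sub_adjf.
have := leq_trans H3 (leq_trans H1 H2); rewrite cL.
move: lt; rewrite -/C; nia.
Qed.
End Family.
End Deformation.
End Deformation.

(** * From power series to the quadric *)

Module Comparison.
Import mpoly.

Section SeriesToPoly.
Variables (K : fieldType) (n p : nat) (pK : p \in [pchar K]) (N e0 : nat).
Notation S := (mpseries n K).
Notation P := {mpoly K[n]}.
Notation q := (p ^ e0)%N.
Notation E := (@Deformation.expI n K N q).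
Let iE : is_ideal E. Proof. exact: ideal_gen_ideal. Qed.
Let iH : is_ideal (hsE N q : set S). Proof. exact: hsE_ideal. Qed.

Lemma expI_of_ordge (g : P) : ordge N (of_mpoly g) -> E g.
Proof.
move=> gN; rewrite [g]mpolyE; apply: (ideal_sum _ iE) => m _.
rewrite -mul_mpolyC mulrC; have [Nm|mN] := leqP N (mdeg m).
  exact: Deformation.expI_monom.
by have := gN m mN; rewrite /= => ->; rewrite mpolyC0 mulr0; apply: (ideal0 iE).
Qed.

Lemma expI_sub_hsE (g : P) : E g -> hsE N q (of_mpoly g).
Proof.
suff: E `<=` [set g | hsE N q (of_mpoly g : S)] by exact.
apply: ideal_gen_sub; first exact: (@preimage_ideal _ _ (@of_mpoly n K)).
move=> _ [[m Nm ->]|[i ->]] /=.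
  apply: ideal_add_subl => //; apply: (@ordgeS n K N (mdeg m)) => //.
  exact: (@ordge_monom n K m).
apply: ideal_add_subr => //; rewrite rmorphXn /=; apply: ideal_frob_pow.
by rewrite -/(monom K U_(i)%MM) monomE; apply: ordge_X.
Qed.

(** Modulo terms of order N, the q-th power of a series without constant term is a
   combination of the q-th powers of the variables. *)
Lemma hsE_expI (x : S) : hsE N q x -> exists2 g : P, E g & ordge N (x - of_mpoly g).
Proof.
pose Z := [set s : S | exists2 g : P, E g & ordge N (s - of_mpoly g)].
suff: hsE N q `<=` Z by apply.
have iZ : is_ideal Z.
  split.
  - by exists 0; [exact: (ideal0 iE)|rewrite rmorph0 subr0; apply: (ideal0 (@ordge_ideal n K N))].
  - move=> s t [g Eg sg] [h Eh th]; exists (g + h); first exact: (idealD iE).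
    by rewrite rmorphD opprD addrACA; apply: ordgeD.
  - move=> a s [g Eg sg]; exists (strunc N a * g); first exact: (ideal_mull _ iE).
    rewrite rmorphM /=.
    have -> : a * s - of_mpoly (strunc N a) * of_mpoly g =
        (a - of_mpoly (strunc N a)) * of_mpoly g + a * (s - of_mpoly g).
      by move: (of_mpoly _) (of_mpoly _) => b c; ring.
    by apply: ordgeD; [apply/ordgeMr/strunc_ordge|apply: ordgeMl].
apply: ideal_add_sub => //.
  by move=> s sN; exists 0; [exact: (ideal0 iE)|rewrite rmorph0 subr0].
apply: ideal_frob_sub => // v /ordgeSP[g _ ->].
exists (\sum_i 'X_i ^+ q * strunc N (g i ^+ q)).
  by apply: (ideal_sum _ iE) => i _; apply: Deformation.expI_pow.
rewrite (Frobenius.frob_sum (Frobenius.series_pchar n pK)) rmorph_sum -sumrB.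
apply: ordge_sum => i _.
rewrite rmorphM rmorphXn /= -/(monom K U_(i)%MM) monomE exprMn -mulrBr.
exact/ordgeMl/strunc_ordge.
Qed.

(** Truncating the equations and their multipliers at order N changes nothing modulo
   expI. *)
Lemma cdim_series_poly (F : finType) (f : F -> S) (g : F -> P) :
  (forall i, ordge N (f i - of_mpoly (g i))) ->
  (cdim (@mpolyC n K) (adjf E g) <= cdim (cst n) (adjf (hsE N q) f))%N.
Proof.
move=> fg; have iA := adjf_ideal f iH; have sA := ideal_subspace (cst n) iA.
pose I := [set h : P | adjf (hsE N q) f (of_mpoly h)].
have iI : is_ideal I by apply: (@preimage_ideal _ _ (@of_mpoly n K)).
have sI := ideal_subspace (@mpolyC n K) iI.
have fE : fincodim (@mpolyC n K) E.
  by have [] := cdim_leq_spans (ideal_subspace (@mpolyC n K) iE) (@Deformation.spans_expI n K N q).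
have fI : fincodim (@mpolyC n K) I.
  by apply: fincodimS fE => // h Eh; apply: sub_adjf; apply: expI_sub_hsE.
have NA : ordge N `<=` adjf (hsE N q) f.
  by move=> s sN; apply: sub_adjf; apply: ideal_add_subl.
have dense (s : S) : exists h, adjf (hsE N q) f (s - of_mpoly h).
  by exists (strunc N s); apply/NA/strunc_ordge.
have [_ ->] := @cdim_transport _ _ _ (@mpolyC n K) (cst n) (@of_mpoly n K)
  (fun _ => erefl) _ _ sI sA fI (fun _ => conj id id) dense.
apply: cdimS => //; first exact/ideal_subspace/adjf_ideal.
move=> h [s sE [t Et]]; have [g0 Eg0 sg0] := hsE_expI sE.
exists (h - \sum_i g i * strunc N (t i)); last first.
  by exists (fun i => strunc N (t i)); rewrite subrK.
rewrite -[_ - _](subrK g0); apply: (idealD iE) => //; apply: expI_of_ordge.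
rewrite !rmorphB /= Et rmorph_sum /=.
have H : \sum_i ((f i - of_mpoly (g i)) * t i +
      of_mpoly (g i) * (t i - of_mpoly (strunc N (t i)))) =
    \sum_i f i * t i - \sum_i of_mpoly (g i * strunc N (t i)).
  rewrite -sumrB; apply: eq_bigr => i _.
  by rewrite rmorphM mulrBl mulrBr addrA subrK.
have -> : s + \sum_i f i * t i - \sum_i of_mpoly (g i * strunc N (t i)) - of_mpoly g0 =
    (s - of_mpoly g0) + (\sum_i f i * t i - \sum_i of_mpoly (g i * strunc N (t i))).
  by move: (\sum_i f i * t i) (\sum_i of_mpoly _) (of_mpoly g0) => a b c; ring.
rewrite -H.
apply: ordgeD => //; apply: ordge_sum => i _; apply: ordgeD.
  exact: ordgeMr.
exact/ordgeMl/strunc_ordge.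
Qed.
End SeriesToPoly.

Section PolyToQuadric.
Variables (K k : fieldType) (sg : {rmorphism K -> k}).
Hypothesis sgs : forall c, exists b, sg b = c.
Variables (w e p N e0 : nat).
Notation n := (w + e)%N.
Notation q := (p ^ e0)%N.
Notation P := {mpoly K[n]}.
Notation S := (mpseries e k).
Notation E := (@Deformation.expI n K N q).
Notation Q := (\sum_(j < e) (mpsX k j : S) ^+ 2).

Definition cst_along : K -> S := @cst e k \o sg.
HB.instance Definition _ := GRing.RMorphism.on cst_along.

(** The map to the power series in the last e variables over the field k that kills
   the first w variables. *)
Definition retract : P -> S :=
  mmap cst_along (fun i => match split i with inl _ => 0 | inr j => mpsX k j end).
HB.instance Definition _ := GRing.RMorphism.on retract.

Lemma retract_X i : retract 'X_i = match split i with inl _ => 0 | inr j => mpsX k j end.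
Proof. by rewrite /retract mmapX mmap1U. Qed.

Lemma retract_C c : retract c%:MP = cst_along c.
Proof. by rewrite /retract mmapC. Qed.

Lemma retract_ordge1 i : ordge 1 (retract 'X_i).
Proof.
rewrite retract_X; case: split => j; first exact: (ideal0 (@ordge_ideal e k 1)).
exact: ordge_X.
Qed.

Lemma retract_monom m : ordge (mdeg m) (retract 'X_[m]).
Proof.
rewrite mpolyXE_id rmorph_prod mdegE.
apply: (big_ind2 (fun (s : S) d => ordge d s)) => [|s a t b|i _].
- by rewrite ordge0.
- exact: ordgeM.
- by rewrite rmorphXn; apply/ordgeX/retract_ordge1.
Qed.

Lemma retract_E f : E f -> hsE N q (retract f).
Proof.
suff: E `<=` [set g | hsE N q (retract g)] by exact.
apply: ideal_gen_sub; first exact: (@preimage_ideal _ _ retract _ (@hsE_ideal e k N q)).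
move=> _ [[m Nm ->]|[i ->]] /=.
  by apply: ideal_add_subl => //; apply: (ordgeS Nm); apply: retract_monom.
apply: ideal_add_subr => //; rewrite rmorphXn; apply: ideal_frob_pow.
exact: retract_ordge1.
Qed.

Lemma retract_dense (s : S) : exists f, ordge N (s - retract f).
Proof.
have /choice[tau Ht] := sgs.
pose lift (m : 'X_{1..e < N}) : P := \prod_(j < e) 'X_(rshift w j) ^+ m j.
exists (\sum_(m : 'X_{1..e < N}) (tau (mpscoef s m))%:MP * lift m).
have -> : retract (\sum_(m : 'X_{1..e < N}) (tau (mpscoef s m))%:MP * lift m) =
    of_mpoly (strunc N s); last exact: strunc_ordge.
rewrite !rmorph_sum; apply: eq_bigr => m _; rewrite rmorphM -mul_mpolyC rmorphM.
congr (_ * _).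
  by rewrite -[RHS]/(cst e (mpscoef s m)) -[in RHS](Ht (mpscoef s m)); apply: retract_C.
rewrite rmorph_prod; apply: (etrans _ (esym (@monom_prod e k m))); apply: eq_bigr => j _.
by rewrite rmorphXn /= retract_X (unsplitK (inr j : 'I_w + 'I_e)).
Qed.

Lemma cdim_quadric_poly :
  (cdim cst_along (adj (hsE N q) Q) <=
   cdim (@mpolyC n K) (adjf E (@Deformation.quadG K w e)))%N.
Proof.
have iE : is_ideal E by apply: ideal_gen_ideal.
have iH := @hsE_ideal e k N q.
have iA := adj_ideal Q iH; have sA := ideal_subspace cst_along iA.
have iG := adjf_ideal (@Deformation.quadG K w e) iE.
pose I := [set h : P | adj (hsE N q) Q (retract h)].
have iI : is_ideal I by apply: (@preimage_ideal _ _ retract).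
have sI := ideal_subspace (@mpolyC n K) iI.
have fE : fincodim (@mpolyC n K) E.
  by have [] := cdim_leq_spans (ideal_subspace (@mpolyC n K) iE) (@Deformation.spans_expI n K N q).
have GI : adjf E (@Deformation.quadG K w e) `<=` I.
  apply: adjf_sub => //; first by move=> f Ef; apply: sub_adj; apply: retract_E.
  case=> [i|]; rewrite /I /=.
    rewrite retract_X (unsplitK (inl i : 'I_w + 'I_e)); exact: (ideal0 iA).
  rewrite rmorph_sum; have -> : \sum_(j < e) retract ('X_(rshift w j) ^+ 2) = Q.
    by apply: eq_bigr => j _; rewrite rmorphXn /= retract_X (unsplitK (inr j : 'I_w + 'I_e)).
  exact: mem_adj1.
have fG : fincodim (@mpolyC n K) (adjf E (@Deformation.quadG K w e)).
  by apply: fincodimS fE; [exact: ideal_subspace|exact: sub_adjf].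
have fI := fincodimS sI GI fG.
have dense (s : S) : exists h, adj (hsE N q) Q (s - retract h).
  have [h H] := retract_dense s; exists h; apply: sub_adj.
  by apply: ideal_add_subl.
have [_ ->] := cdim_transport retract_C sI sA fI (fun _ => conj id id) dense.
exact: cdimS.
Qed.
End PolyToQuadric.

Definition linear_part (n : nat) (K : fieldType) (F : finType) (f : F -> mpseries n K) :
    'M[K]_(#|F|, n) :=
  \matrix_(i, j) mpscoef (f (enum_val i)) U_(j)%MM.

Section LinearParts.
Variables (K : fieldType) (w e : nat).
Notation n := (w + e)%N.
Notation S := (mpseries n K).
Notation P := {mpoly K[n]}.

(** If the rank is at most w, the extended row basis of the Gaussian elimination is a
   coordinate system whose first w rows span the linear parts. *)
Lemma linear_part_span (F : finType) (f : F -> S) : (\rank (linear_part f) <= w)%N ->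
  exists (U V : 'M[K]_n) (a : F -> 'I_w -> K), V *m U = 1%:M /\
    forall o j, mpscoef (f o) U_(j)%MM = \sum_i a o i * U (lshift e i) j.
Proof.
move=> rw; set M := linear_part f; set r := \rank M in rw.
pose U : 'M_n := row_ebase M.
pose B : 'M_(#|F|, w) := col_ebase M *m pid_mx r.
exists U, (invmx U), (fun o i => B (enum_rank o) i); split.
  by rewrite mulVmx // row_ebase_unit.
move=> o j; have -> : mpscoef (f o) U_(j)%MM = M (enum_rank o) j.
  by rewrite mxE enum_rankK.
have -> : M = B *m usubmx U.
  have uU : usubmx U = (pid_mx w : 'M_(w, n)) *m U.
    by rewrite pid_mx_row -{2}[U]vsubmxK mul_row_col mul1mx mul0mx addr0.
  rewrite uU mulmxA -[in RHS](mulmxA (col_ebase M)) mul_pid_mx.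
  by rewrite (minn_idPl rw) (minn_idPr rw) mulmx_ebase.
by rewrite mxE; apply: eq_bigr => i _; rewrite [usubmx U _ _]mxE.
Qed.

Variables (U V : 'M[K]_n).
Hypothesis VU : V *m U = 1%:M.
Notation lf := (fun i : 'I_n => \sum_j Deformation.cP w e (U i j) * 'X_j : P).
Notation X := (fun j : 'I_e => lf (rshift w j)).
Notation W := (fun i : 'I_w => lf (lshift e i)).

(** The ideal of P generated by the W i and by the products of two of the X j: the
   form that the deformation argument asks for. *)
Definition sqlin (g : P) := exists2 h, sq X h & exists c, g = h + \sum_i W i * c i.

Lemma sqlinD g g' : sqlin g -> sqlin g' -> sqlin (g + g').
Proof.
move=> [h sh [c ->]] [h' sh' [c' ->]]; exists (h + h'); first exact: sqD.
exists (fun i => c i + c' i); rewrite addrACA -big_split; congr (_ + _).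
by apply: eq_bigr => i _; rewrite mulrDr.
Qed.

Lemma sqlinM a g : sqlin g -> sqlin (a * g).
Proof.
move=> [h sh [c ->]]; exists (a * h); first exact: sqM.
exists (fun i => a * c i); rewrite mulrDr mulr_sumr; congr (_ + _).
by apply: eq_bigr => i _; rewrite mulrCA.
Qed.

Lemma sqlin0 : sqlin 0.
Proof.
exists 0; first exact: sq0.
by exists (fun _ => 0); rewrite big1 ?addr0 // => i _; rewrite mulr0.
Qed.

Lemma sqlin_sum (I : Type) (r : seq I) (F : I -> P) :
  (forall i, sqlin (F i)) -> sqlin (\sum_(i <- r) F i).
Proof. by move=> H; apply: (big_ind sqlin) => // [|x y]; [exact: sqlin0|exact: sqlinD]. Qed.

Lemma sqlinW i : sqlin (W i).
Proof.
exists 0; first exact: sq0.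
exists (fun l => if l == i then 1 else 0); rewrite (bigD1 i) //= eqxx mulr1.
rewrite [X in _ = 0 + (_ + X)]big1 => [|l /negPf ->]; first by rewrite addr0 add0r.
exact: mulr0.
Qed.

Lemma sqlinXX a b : sqlin ('X_a * 'X_b).
Proof.
have dec c : 'X_c = \sum_i (V c (lshift e i))%:MP * W i + \sum_j (V c (rshift w j))%:MP * X j :> P.
  transitivity (\sum_i (V c i)%:MP * lf i); last by rewrite big_split_ord.
  transitivity (\sum_j ((V *m U) c j)%:MP * 'X_j : P).
    rewrite VU (bigD1 c) //= mxE eqxx mpolyC1 mul1r big1 ?addr0 // => j jc.
    by rewrite mxE eq_sym (negPf jc) mpolyC0 mul0r.
  under eq_bigr do rewrite mxE rmorph_sum mulr_suml.
  rewrite exchange_big; apply: eq_bigr => i _; rewrite mulr_sumr; apply: eq_bigr => j _.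
  by rewrite rmorphM mulrA.
rewrite {1}(dec a) mulrDl; apply: sqlinD.
  by rewrite mulr_suml; apply: sqlin_sum => i; rewrite mulrC; apply/sqlinM/sqlinM/sqlinW.
have linX c : lin X (\sum_j (V c (rshift w j))%:MP * X j).
  by exists (fun j => (V c (rshift w j))%:MP); apply: eq_bigr => j _; rewrite mulrC.
rewrite (dec b) mulrDr; apply: sqlinD.
  apply: sqlinM; apply: sqlin_sum => i; apply: sqlinM; exact: sqlinW.
exists ((\sum_j (V a (rshift w j))%:MP * X j) * (\sum_j (V b (rshift w j))%:MP * X j)).
  exact: sq_lin2.
exists (fun _ => 0); rewrite [X in _ = _ + X]big1 ?addr0 // => i _; exact: mulr0.
Qed.

(** The linear part is a combination of the W i, and all products of two variables
   belong to the ideal. *)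
Lemma sqlin_dec (g : P) (a : 'I_w -> K) : g@_0%MM = 0 ->
  (forall j, g@_U_(j)%MM = \sum_i a i * U (lshift e i) j) -> sqlin g.
Proof.
move=> g0 g1; pose l : P := \sum_i (a i)%:MP * W i.
have sl : sqlin l by apply: sqlin_sum => i; apply: sqlinM; apply: sqlinW.
have lE m : l@_m = \sum_j (\sum_i a i * U (lshift e i) j) * (U_(j)%MM == m)%:R.
  rewrite raddf_sum /=; under [RHS]eq_bigr do rewrite mulr_suml.
  rewrite exchange_big; apply: eq_bigr => i _; rewrite mulr_sumr raddf_sum.
  by apply: eq_bigr => j _; rewrite /= mulrA -rmorphM mul_mpolyC mcoeffZ mcoeffX.
rewrite -[g](subrK l); apply: sqlinD => //.
rewrite [g - l]mpolyE; apply: sqlin_sum => m; rewrite -mul_mpolyC.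
have [m2|] := leqP 2 (mdeg m).
  apply: sqlinM.
  have nz (m' : 'X_{1..n}) : mdeg m' != 0%N -> exists i, m' i != 0%N.
    move=> d0; apply: contrapT => /forallNP H; case/eqP: d0.
    by rewrite mdegE big1 // => i _; apply/eqP; rewrite -[_ == _]negbK; apply/negP/H.
  have [i mi] : exists i, m i != 0%N by apply: nz; rewrite -lt0n ltnW.
  have Em : m = (m - U_(i) + U_(i))%MM by rewrite submK // lep1mP.
  have d1 : (mdeg m = mdeg (m - U_(i))%MM + 1)%N by rewrite {1}Em mdegD mdeg1.
  have [j mj] : exists j, (m - U_(i))%MM j != 0%N.
    by apply: nz; rewrite -lt0n; move: m2; rewrite d1 addn1.
  have -> : m = ((m - U_(i) - U_(j)) + (U_(j) + U_(i)))%MM.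
    by rewrite addmA submK ?lep1mP.
  by rewrite !mpolyXD; apply/sqlinM/sqlinXX.
rewrite ltnS => m1; rewrite (_ : (g - l)@_m = 0); last first.
  rewrite mcoeffB lE; move: m1; rewrite leq_eqVlt ltnS leqn0.
  rewrite mdeg_eq1 mdeg_eq0 => /orP[/existsP[j /eqP ->]|/eqP ->].
    rewrite g1 (bigD1 j) //= eqxx mulr1 [X in _ - (_ + X)]big1 ?addr0 ?subrr // => j' jj.
    by rewrite eq_mnm1 (negPf jj) mulr0.
  by rewrite g0 big1 ?subr0 // => j _; rewrite mnm1_eq0 mulr0.
by rewrite mpolyC0 mul0r; apply: sqlin0.
Qed.
End LinearParts.

(** Truncate the equations beyond order N + 2 to polynomials, which keeps their linear
   parts, deform them to a quadric, and kill the w linear forms. *)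
Theorem cdim_quadric_series (K k : fieldType) (sg : {rmorphism K -> k})
    (sgs : forall c, exists b, sg b = c) (p w e N e0 : nat)
    (pK : p \in [pchar K]) (two : 2%:R != 0 :> K)
    (f : option 'I_w -> mpseries (w + e) K) :
  (forall o, ordge 1 (f o)) -> (\rank (linear_part f) <= w)%N ->
  (cdim (cst_along sg e) (adj (hsE N (p ^ e0)) (\sum_(j < e) (mpsX k j) ^+ 2)) <=
   cdim (cst (w + e)) (adjf (hsE N (p ^ e0)) f))%N.
Proof.
move=> f1 rk; have [U [V [a [VU Ha]]]] := linear_part_span rk.
pose g o := strunc (N + 2) (f o).
have N2 m : (mdeg m < 2)%N -> forall o, (g o)@_m = mpscoef (f o) m.
  by move=> m2 o; rewrite /g scoef_trunc // ltn_addl.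
have dec o : sqlin U (g o).
  apply: (@sqlin_dec _ _ _ U V VU (g o) (a o)).
    by rewrite N2 ?mdeg0 //; apply/ordge1P.
  by move=> j; rewrite N2 ?mdeg1 // Ha.
apply: leq_trans (cdim_quadric_poly sgs w e p N e0) _.
apply: leq_trans (Deformation.cdim_quadric_le pK two N e0 VU dec) _.
apply: (cdim_series_poly pK) => o.
exact: (ordgeS (leq_addr 2 N) (@strunc_ordge _ _ (N + 2) (f o))).
Qed.
End Comparison.

(** * Lengths in a complete intersection *)

Section LocalRingOfSeries.
Variables (A : comPzRingType) (m : set A).
Hypothesis nA : noetherian A.
Hypothesis mP : forall I, is_maximal_ideal I <-> I = m.
Variables (n : nat) (K : fieldType) (G : set (mpseries n K)).
Hypothesis G1 : ~ ideal_gen G 1.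
Variable th : {rmorphism A -> quot G}.
Notation S := (mpseries n K).
Notation pi := (quot_pi G).
Notation mQ := (qmax G).
Hypothesis th_exp : forall N a, ideal_exp m N a <-> ideal_exp mQ N (th a).
Hypothesis th_dense : forall N x, exists a, ideal_exp mQ N (x - th a).
Notation codimS := (cdim (@cst n K)).
Notation ext := (ext th).
Notation hsS N q := (ideal_add (ideal_gen G) (hsE N q)).

Let mm : is_maximal_ideal m. Proof. exact/mP. Qed.
Let im : is_ideal m. Proof. by case: mm. Qed.

Lemma hsS_ideal N q : is_ideal (hsS N q).
Proof. by apply: ideal_add_ideal; [exact: ideal_gen_ideal|exact: hsE_ideal]. Qed.

Lemma ordge_sub_hsS N q : ordge N `<=` hsS N q.
Proof.
move=> u uN; apply: ideal_add_subr; first exact: ideal_gen_ideal.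
by apply: ideal_add_subl => //; exact: ideal_frob_ideal.
Qed.

Lemma fincodim_hsS N q : fincodim (@cst n K) (hsS N q).
Proof. exact: (fincodim_ordge (hsS_ideal N q) (@ordge_sub_hsS N q)). Qed.

Lemma length_hsS (N q : nat) :
  ring_length (quot (ideal_add (ideal_exp m N) (ideal_frob m q))) = codimS (hsS N q).
Proof.
have iL : is_ideal (ideal_add (ideal_exp m N) (ideal_frob m q)) by apply: ideal_add_ideal.
apply: ring_lengthE => //.
apply/(colength_ext th_exp th_dense _ iL (ideal_add_subl (ideal_frob_ideal m q))).
rewrite ext_hs //; apply: (@colength_cdim _ _ (@cst n K) (ordge 1) _ _ _ _ N).
- exact: ordge_ideal.
- exact: ordge1_1.
- exact: cst_residue.
- exact: hsS_ideal.
- by rewrite ordge_exp; apply: ordge_sub_hsS.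
- exact: fincodim_hsS.
Qed.

Lemma ext_frob N q : ext (ideal_frob m q) N = hsS N q.
Proof.
rewrite -(ext_hs im G1 th_exp th_dense); apply/seteqP; split.
  by apply: extS; apply: ideal_add_subr.
move=> u [_ [a ma [b mb <-]] uab]; exists b => //.
have -> : pi u - th b = (pi u - th (a + b)) + th a by rewrite rmorphD; ring.
by apply: (idealD (ideal_exp_ideal mQ N)) => //; apply/th_exp.
Qed.

Lemma ext_set0 N : ext [set 0] N = ideal_add (ideal_gen G) (ordge N).
Proof.
apply/seteqP; split=> [u [_ /= ->]|u /qmax_exp_pi H].
  by rewrite rmorph0 subr0 => /qmax_exp_pi.
by exists 0; rewrite // rmorph0 subr0.
Qed.

Section Dimension.
Variable d : nat.
Hypothesis dimA : is_krull_dim A d.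

Let dim0 : dimle [set (0 : A)] d.
Proof. by move=> k P cP _; case: dimA => _; apply; exact: cP. Qed.

(** The lengths for m^N + m^[q] are bounded by those for m^N, whatever q is. *)
Lemma hsS_upper : exists C, forall N q, (codimS (hsS N q) <= C * N.+1 ^ d)%N.
Proof.
have [C HC] := dimle_growth nA mP th_exp th_dense (ideal_set0 A) dim0.
exists C => N q; apply: leq_trans (HC N); rewrite ext_set0.
apply: cdimS; [exact/ideal_subspace/hsS_ideal| |].
  apply: ideal_addS => //; apply: ideal_add_subl; exact: ideal_frob_ideal.
by apply: fincodim_hilb.
Qed.

(** By ext_step with a parameter f, the step from N to N + 1 costs at most the length
   modulo f, which grows in one degree less. *)
Lemma hsS_layer d' : d = d'.+1 -> exists C, forall N q,
  (codimS (hsS N.+1 q) <= codimS (hsS N q) + C * N.+2 ^ d')%N.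
Proof.
move=> dd; have dim0' := dim0; rewrite dd in dim0'.
have [f mf df] := dimle_parameter nA mP (ideal_set0 A) dim0'.
have iA := adj_ideal f (ideal_set0 A).
have [C HC] := dimle_growth nA mP th_exp th_dense iA df.
exists C => N q; rewrite -!ext_frob.
apply: leq_trans (ext_step mP th_exp th_dense N (ideal_frob_ideal m q) mf) _.
rewrite leq_add2l; apply: leq_trans (HC N.+1).
have iF := adj_ideal f (ideal_frob_ideal m q).
apply: cdimS; [exact/ideal_subspace/ext_ideal| |exact: fincodim_ext].
apply: extS; apply: adjS => x /= ->; exact: ideal0 (ideal_frob_ideal m q).
Qed.
End Dimension.
End LocalRingOfSeries.

Section LocalCompleteIntersection.
Variables (n p : nat) (K : fieldType) (fs : seq (mpseries n K)).
Hypotheses (pK : p \in [pchar K]) (cn : (size fs <= n)%N).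
Hypothesis G1 : ~ ideal_gen [set` fs] 1.
Notation S := (mpseries n K).
Notation codimS := (cdim (@cst n K)).
Notation G := [set` fs].
Notation hsS N q := (ideal_add (ideal_gen G) (hsE N q)).
Notation c := (size fs).

Let p1 : (1 < p)%N. Proof. exact: prime_gt1 (pcharf_prime pK). Qed.

Lemma hsS_mono N N' q : (N <= N')%N -> (codimS (hsS N q) <= codimS (hsS N' q))%N.
Proof.
move=> le; apply: cdimS; [exact/ideal_subspace/hsS_ideal| |exact: fincodim_hsS].
by apply: ideal_addS => //; apply: ideal_addS => //; apply: ordgeS.
Qed.

Lemma hsS_frob N N' q : ((N + n) * p <= N')%N ->
  (p ^ (n - c) * codimS (hsS N q) <= codimS (hsS N' (q * p)))%N.
Proof.
move=> le; exact: leq_trans (Frobenius.hs_frob_step pK N q cn) (hsS_mono (q * p) le).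
Qed.

Lemma hsS_zero q : codimS (hsS 0 q) = 0%N.
Proof.
rewrite (_ : hsS 0 q = setT) ?cdim_setT //.
apply: (ideal1T (hsS_ideal G 0 q)); apply: ordge_sub_hsS; by rewrite ordge0.
Qed.

Lemma hsS_one q : (0 < q)%N -> (0 < codimS (hsS 1 q))%N.
Proof.
move=> q0; apply: cdim_gt0; [exact: hsS_ideal|exact: fincodim_hsS|].
move=> H; apply: (@ordge1_1 n K); move: H; apply: ideal_add_sub => //.
  exact: gen_sub_ordge1.
apply: ideal_add_sub => //; apply: ideal_frob_sub => // v v1.
by rewrite -(prednK q0) exprS; apply: ordgeMr.
Qed.

(** Start from the residue field at q = 1 and apply hsS_frob e times; the exponent
   solves the recurrence N' = (N + n) p up to an inequality, and is 1 for e = 0. *)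
Lemma hsS_lower e : (p ^ (e * (n - c)) <= codimS (hsS (p ^ e * (1 + 2 * n) - 2 * n) (p ^ e)))%N.
Proof.
elim: e => [|e IH].
  rewrite mul0n expn0 mul1n addnK; exact: hsS_one.
have -> : (p ^ (e.+1 * (n - c)) = p ^ (n - c) * p ^ (e * (n - c)))%N by rewrite mulSn expnD.
rewrite expnSr; apply: leq_trans (leq_mul (leqnn _) IH) _; apply: hsS_frob.
have : (1 <= p ^ e)%N by rewrite expn_gt0 ltnW.
by nia.
Qed.

(** The inequality d <= n - c follows from the growth of K[[x]]/(fs) and a chain of
   primes. If it were strict, the lower bound p^(e (n - c)) of the lengths would
   contradict their upper bound of order p^(e d). *)
Lemma complete_intersection_dim (A : comPzRingType) (m : set A) d (nA : noetherian A)
    (mP : forall I, is_maximal_ideal I <-> I = m) (th : {rmorphism A -> quot G})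
    (th_exp : forall N a, ideal_exp m N a <-> ideal_exp (qmax G) N (th a))
    (th_dense : forall N x, exists a, ideal_exp (qmax G) N (x - th a)) :
  regular_sequence fs -> is_krull_dim A d -> (n = c + d)%N.
Proof.
move=> reg dA; have [_ gr] := growth_regular_sequence reg.
have dle : (d <= n - c)%N.
  by have [[P cP] _] := dA; apply: (prime_chain_growth nA mP G1 th_exp th_dense cP gr).
suff : (n - c <= d)%N by move: dle (cn); lia.
rewrite leqNgt; apply/negP => lt.
have [C HC] := hsS_upper nA mP th_exp th_dense dA.
pose B := (C * (2 + 2 * n) ^ d)%N.
have H e : (p ^ e <= B)%N.
  have H1 := leq_trans (hsS_lower e) (HC _ _).
  have pe : (0 < p ^ e)%N by rewrite expn_gt0 ltnW.
  have H2 : ((p ^ e * (1 + 2 * n) - 2 * n).+1 <= p ^ e * (2 + 2 * n))%N by nia.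
  have H3 : (p ^ e * p ^ (e * d) <= p ^ (e * (n - c)))%N.
    rewrite -expnD leq_exp2l // -mulnS leq_mul2l lt orbT //.
  have H4 := leq_trans H3 H1.
  have H5 : (C * (p ^ e * (1 + 2 * n) - 2 * n).+1 ^ d <= B * p ^ (e * d))%N.
    rewrite /B -mulnA leq_mul2l; apply/orP; right.
    by rewrite expnM [leqRHS]mulnC -expnMn; apply: expn_leq.
  have := leq_trans H4 H5; rewrite leq_pmul2r // expn_gt0 ltnW //.
have := H B; rewrite leqNgt => /negP; apply; exact: ltn_expl.
Qed.
End LocalCompleteIntersection.

(** * Embedding dimension and residue field *)

Module EmbeddingDimension.
Import mpoly.
Section EmbeddingDimension.
Variables (A : comPzRingType) (m : set A).
Hypothesis nA : noetherian A.
Hypothesis mP : forall I, is_maximal_ideal I <-> I = m.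
Variables (n : nat) (K : fieldType) (G : set (mpseries n K)).
Hypothesis G1 : ~ ideal_gen G 1.
Variable th : {rmorphism A -> quot G}.
Notation S := (mpseries n K).
Notation pi := (quot_pi G).
Notation mQ := (qmax G).
Hypothesis th_exp : forall N a, ideal_exp m N a <-> ideal_exp mQ N (th a).
Hypothesis th_dense : forall N x, exists a, ideal_exp mQ N (x - th a).

Let mm : is_maximal_ideal m. Proof. exact/mP. Qed.
Let im : is_ideal m. Proof. by case: mm. Qed.
Let iq : is_ideal mQ. Proof. exact: qmax_ideal. Qed.

Lemma linear_dual (r : nat) (L : 'M[K]_(r, n)) : exists (B : 'M[K]_(n - \rank L, n))
  (u1 : 'M[K]_(n, r)) (u2 : 'M[K]_(n, n - \rank L)), 1%:M = u1 *m L + u2 *m B.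
Proof.
have E : \rank (L^C)%MS = (n - \rank L)%N by rewrite mxrank_compl.
rewrite -E.
have : (1%:M <= L + row_base L^C)%MS.
  rewrite (adds_eqmx (eqmx_refl L) (eq_row_base _)) sub1mx; exact: addsmx_compl_full.
by case/sub_addsmxP => -[u1 u2] /= H; exists (row_base L^C)%MS, u1, u2.
Qed.

(** The linear parts of the f o together with n - r further linear forms b span all
   linear forms. So the classes of the b generate the maximal ideal of K[[x]]/(G)
   modulo its square; lift them to A and apply Nakayama. *)
Lemma maxideal_generators (F : finType) (f : F -> S) : (forall o, ideal_gen G (f o)) ->
  exists s : seq A, size s = (n - \rank (Comparison.linear_part f))%N /\
    ideal_gen [set` s] = m.
Proof.
move=> fG; set L := Comparison.linear_part f; set r := (n - \rank L)%N.
have [B [u1 [u2 E]]] := linear_dual L.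
pose b (t : 'I_r) : S := \sum_l cst n (B t l) * mpsX K l.
have b1 t : ordge 1 (b t) by apply: ordge_sum => l _; apply/ordgeMl/ordge_X.
have f1 o : ordge 1 (f o) by apply: (gen_sub_ordge1 G1).
pose lin j : S := \sum_o cst n (u1 j o) * f (enum_val o) + \sum_t cst n (u2 j t) * b t.
have bE t l : mpscoef (b t) U_(l)%MM = B t l.
  have cX l' : mpscoef (cst n (B t l') * mpsX K l') U_(l)%MM = B t l' * (l == l')%:R.
    by rewrite scoef_cstM /= eq_mnm1.
  rewrite scoef_sum; under eq_bigr do rewrite cX.
  rewrite (bigD1 l) //= eqxx mulr1 big1 ?addr0 // => l' ll.
  by rewrite eq_sym (negPf ll) mulr0.
have xE j : ordge 2 (mpsX K j - lin j).
  have lin1 : ordge 1 (lin j).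
    by apply: ordgeD; apply: ordge_sum => o _; apply: ordgeMl.
  move=> k; rewrite ltnS leq_eqVlt ltnS leqn0 mdeg_eq1 mdeg_eq0.
  case/orP => [/existsP[l /eqP ->]|/eqP ->]; last first.
    by apply/ordge1P/ordgeB => //; apply: ordge_X.
  have /matrixP/(_ j l) := E; rewrite !mxE => El.
  rewrite scoefB /lin scoefD !scoef_sum [mpscoef (mpsX _ _) _]/= eq_mnm1 eq_sym El.
  apply/eqP; rewrite subr_eq0; apply/eqP; congr (_ + _); apply: eq_bigr => o _.
    by rewrite scoef_cstM mxE.
  by rewrite scoef_cstM bE.
have /choice[a aP] t : exists a, ideal_exp mQ 2 (pi (b t) - th a).
  exact: th_dense.
have ma t : m (a t).
  rewrite -[m]ideal_exp1 //; apply/th_exp; rewrite ideal_exp1 //.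
  have : mQ (pi (b t)) by apply/qmax_pi.
  move=> /(idealBr iq); apply; rewrite -[mQ]ideal_exp1 //.
  exact: ideal_exp_leq (aP t).
exists [seq a t | t <- enum 'I_r]; split; first by rewrite size_map size_enum_ord.
set J := ideal_gen _; have iJ : is_ideal J by apply: ideal_gen_ideal.
have aJ t : J (a t) by apply: sub_ideal_gen; apply/mapP; exists t => //; rewrite mem_enum.
have Jm : J `<=` m by apply: ideal_gen_sub => // _ /= /mapP[t _ ->].
apply/seteqP; split=> //; apply: (nakayama nA mP) => // y my.
have [v vy] := quot_pi_surj (th y).
have v1 : ordge 1 v.
  apply/(qmax_pi G1); rewrite vy -[mQ]ideal_exp1 //; apply/th_exp.
  by rewrite ideal_exp1.
have [g _ vE] := ordgeSP v1.
pose h t := \sum_j g j * cst n (u2 j t).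
have /choice[al alP] t : exists al, ideal_exp mQ 1 (pi (h t) - th al).
  exact: th_dense.
pose z := \sum_t a t * al t.
have Jz : J z by apply: (ideal_sum _ iJ) => t _; apply: (ideal_mulr _ iJ).
rewrite -[y](subrK z).
have i2 := ideal_exp_ideal mQ 2.
suff H : ideal_exp m 2 (y - z).
  exists (y - z); last by exists z.
  by rewrite -[X in ideal_mul m X](ideal_exp1 im).
apply/th_exp; rewrite rmorphB -vy.
have -> : pi v - th z = pi (v - \sum_t b t * h t) +
    \sum_t (pi (b t) * (pi (h t) - th (al t)) + (pi (b t) - th (a t)) * th (al t)).
  rewrite rmorphB rmorph_sum /z rmorph_sum -[RHS]addrA; congr (_ + _).
  rewrite -sumrN -sumrN -big_split; apply: eq_bigr => t _; rewrite !rmorphM /=; ring.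
apply: (idealD i2); last first.
  apply: (ideal_sum _ i2) => t _; apply: (idealD i2); last exact: (ideal_mulr _ i2).
  apply: (@ideal_expM _ mQ _ _ 1 1) => //; rewrite ideal_exp1 //; exact/qmax_pi.
apply/qmax_exp_pi.
have iGN : is_ideal (ideal_add (ideal_gen G) (ordge 2)) by apply: ideal_add_ideal.
have -> : v - \sum_t b t * h t = \sum_j g j * (mpsX K j - lin j) +
    \sum_j \sum_o g j * (cst n (u1 j o) * f (enum_val o)).
  have -> : \sum_t b t * h t = \sum_j \sum_t g j * (cst n (u2 j t) * b t).
    rewrite exchange_big; apply: eq_bigr => t _; rewrite /h mulr_sumr.
    by apply: eq_bigr => j _; rewrite mulrC mulrA.
  rewrite vE -sumrB -big_split; apply: eq_bigr => j _ /=.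
  by rewrite -!mulr_sumr /lin; move: (\sum_o _) (\sum_t _) => p q; ring.
apply: (idealD iGN).
  apply: (ideal_sum _ iGN) => j _; apply: (ideal_mull _ iGN).
  by apply: ideal_add_subr.
apply: (ideal_sum _ iGN) => j _; apply: (ideal_sum _ iGN) => o _.
do 2 apply: (ideal_mull _ iGN); by apply: ideal_add_subl.
Qed.

(** Both fields are residue fields of the same ring: send c to the class in A/m of an
   element of A whose image in K[[x]]/(G) is congruent to c. Surjectivity is what the
   comparison with the quadric over k uses. *)
Lemma residue_rmorphism (k : fieldType) (tau : {rmorphism quot m -> k}) :
  bijective tau -> exists sg : {rmorphism K -> k}, forall y, exists c, sg c = y.
Proof.
move=> taub; have i1 := ideal_exp_ideal mQ 1.
pose R c a := ideal_exp mQ 1 (pi (cst n c) - th a).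
have /choice[a aP] c : exists a, R c a by apply: th_dense.
have uniq c b : R c b -> quot_pi m (a c) = quot_pi m b.
  move=> cb; apply/quot_eqP; rewrite ideal_gen_id // -[m]ideal_exp1 //.
  apply/th_exp; rewrite rmorphB.
  have -> : th (a c) - th b = (pi (cst n c) - th b) - (pi (cst n c) - th (a c)) by ring.
  exact: (idealB i1 cb (aP c)).
pose s c := tau (quot_pi m (a c)).
have sE c b : R c b -> s c = tau (quot_pi m b) by move=> /uniq H; rewrite /s H.
have sB : zmod_morphism s.
  move=> x y; rewrite (sE _ (a x - a y)); first by rewrite !rmorphB.
  rewrite /R; have -> : pi (cst n (x - y)) - th (a x - a y) =
      (pi (cst n x) - th (a x)) - (pi (cst n y) - th (a y)).
    by rewrite !rmorphB /=; ring.
  exact: (idealB i1 (aP x) (aP y)).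
have sM : monoid_morphism s.
  split=> [|x y]; first by rewrite (sE _ 1) ?rmorph1 // /R !rmorph1 subrr; apply: (ideal0 i1).
  rewrite (sE _ (a x * a y)); first by rewrite !rmorphM.
  rewrite /R; have -> : pi (cst n (x * y)) - th (a x * a y) =
      pi (cst n x) * (pi (cst n y) - th (a y)) + th (a y) * (pi (cst n x) - th (a x)).
    by rewrite !rmorphM /=; ring.
  by apply: (idealD i1); apply: (ideal_mull _ i1); apply: aP.
pose M1 := GRing.isZmodMorphism.Build K k s sB.
pose M2 := GRing.isMonoidMorphism.Build K k s sM.
pose sg : {rmorphism K -> k} := HB.pack s M1 M2.
exists sg => y; have [g _ gK] := taub; have [b bg] := quot_pi_surj (g y).
have [u ub] := quot_pi_surj (th b); have [c uc] := cst_residue u.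
exists c; rewrite -[LHS]/(s c) (sE c b) ?bg ?gK //.
rewrite /R -ub -rmorphB; apply/qmax_exp_pi; apply: ideal_add_subr => //.
by rewrite -opprB; apply: (idealN (@ordge_ideal n K 1)).
Qed.
End EmbeddingDimension.
End EmbeddingDimension.

(** * Comparison of lengths *)

Definition hs_length (B : comPzRingType) (N q : nat) : nat :=
  ring_length (quot (ideal_add (ideal_exp (maxideal B) N) (ideal_frob (maxideal B) q))).

Section QuotientLength.
Variables (n : nat) (k : fieldType) (G : set (mpseries n k)).
Hypothesis G1 : ~ ideal_gen G 1.

Lemma hs_length_quot (K : fieldType) (kappa : {rmorphism K -> mpseries n k}) N q :
  (forall x, exists c, ordge 1 (x - kappa c)) ->
  fincodim kappa (ideal_add (ideal_gen G) (hsE N q)) ->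
  hs_length (quot G) N q = cdim kappa (ideal_add (ideal_gen G) (hsE N q)).
Proof.
move=> res fin; rewrite /hs_length (maxideal_quot G1).
have iq := @qmax_ideal _ _ G.
apply: ring_lengthE; first exact: (ideal_add_ideal (ideal_exp_ideal _ _) (ideal_frob_ideal _ _)).
apply/colength_qmax_hs.
apply: (@colength_cdim _ _ kappa (ordge 1) _ _ _ _ N).
- exact: ordge_ideal.
- exact: ordge1_1.
- exact: res.
- exact: hsS_ideal.
- by rewrite ordge_exp; apply: ordge_sub_hsS.
- exact: fin.
Qed.

(** A spanning family over k is one over K, because the scalars of K surject onto
   those of k. *)
Lemma fincodim_along (K : fieldType) (sg : {rmorphism K -> k}) (I : set (mpseries n k)) :
  is_ideal I -> (forall y, exists c, sg c = y) -> fincodim (@cst n k) I ->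
  fincodim (Comparison.cst_along sg n) I.
Proof.
move=> iI sgs fI; have /choice[tau Ht] := sgs; have [v [sv _]] := fincodimP fI.
suff sv' : spans (Comparison.cst_along sg n) I v.
  by have [] := cdim_leq_spans (ideal_subspace _ iI) sv'.
move=> x; have [c cx] := sv x; exists (fun i => tau (c i)).
rewrite (_ : lincomb _ _ _ = lincomb (@cst n k) v c) //.
by apply: eq_bigr => i _; rewrite /Comparison.cst_along /= Ht.
Qed.
End QuotientLength.

Section Quadric.
Variables (k : fieldType) (d p : nat).
Hypothesis pk : p \in [pchar k].
Notation S := (mpseries d.+1 k).
Notation Q := (\sum_(i < d.+1) (mpsX k i : S) ^+ 2).
Notation G := [set` [:: Q]].

Lemma quadric_proper : ~ ideal_gen [set` [:: Q]] (1 : S).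
Proof.
move=> H; apply: (@ordge1_1 d.+1 k); move: H.
apply: ideal_gen_sub; first exact: ordge_ideal.
move=> x /=; rewrite inE => /eqP ->; apply: ordge_sum => i _.
by rewrite expr2; apply/ordgeMl/ordge_X.
Qed.

Lemma quadricE : quadric k d = quot G.
Proof. by rewrite /quadric; congr quot; apply/seteqP; split=> x /=; rewrite inE => /eqP. Qed.

Lemma hs_length_quadric N q :
  hs_length (quadric k d) N q = cdim (@cst d.+1 k) (ideal_add (ideal_gen G) (hsE N q)).
Proof.
rewrite quadricE; apply: hs_length_quot; [exact: quadric_proper|exact: cst_residue|].
exact: fincodim_hsS.
Qed.

Lemma hs_length_quadric_along (K : fieldType) (sg : {rmorphism K -> k}) N q :
  (forall y, exists c, sg c = y) ->
  hs_length (quadric k d) N q =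
    cdim (Comparison.cst_along sg d.+1) (adj (hsE N q) Q).
Proof.
move=> sgs; have -> : adj (hsE N q) Q = ideal_add (ideal_gen G) (hsE N q).
  by rewrite -adjsE //; exact: hsE_ideal.
rewrite quadricE; apply: hs_length_quot; first exact: quadric_proper.
  move=> x; have [c xc] := cst_residue x; have [b bc] := sgs c.
  by exists b; rewrite /Comparison.cst_along /= bc.
apply: fincodim_along => //; [exact: hsS_ideal|exact: fincodim_hsS].
Qed.
End Quadric.

(** What the passage to the limit needs of the lengths a N q of a local ring of
   dimension d.+1 and of the lengths b N q of the quadric, for m^N + m^[q]. *)
Record hs_bounds (n C p d : nat) (a b : nat -> nat -> nat) : Prop := HsBounds {
  hsb_le : forall N e, (b N (p ^ e) <= a N (p ^ e))%N;
  hsb_monol : forall N N' q, (N <= N')%N -> (a N q <= a N' q)%N;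
  hsb_monor : forall N N' q, (N <= N')%N -> (b N q <= b N' q)%N;
  hsb_frobl : forall N N' q, ((N + n) * p <= N')%N -> (p ^ d.+1 * a N q <= a N' (q * p))%N;
  hsb_frobr : forall N N' q, ((N + n) * p <= N')%N -> (p ^ d.+1 * b N q <= b N' (q * p))%N;
  hsb_one : forall q, (0 < q)%N -> (0 < b 1 q)%N;
  hsb_zero : forall q, a 0 q = 0%N;
  hsb_layer : forall N q, (a N.+1 q <= a N q + C * N.+2 ^ d)%N;
  hsb_upper : forall N q, (a N q <= C * N.+1 ^ d.+1)%N
}.

Lemma krull_dimE (B : comPzRingType) d' : is_krull_dim B d' -> krull_dim B = d'.
Proof.
move=> H; rewrite /krull_dim; case: xgetP => [e _ He|/(_ d')/(_ H)//].
have [[P cP] le] := H; have [[P' cP'] le'] := He.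
by apply/eqP; rewrite eqn_leq (le _ _ cP') (le' _ _ cP).
Qed.

Section LocalSetup.
Variables (A : comNzRingType) (k : fieldType) (d p : nat).
Hypotheses (locA : noetherian_local A) (ciA : complete_intersection A)
  (resA : has_residue_field A k).

Let m := maxideal A.

Lemma complete_intersection_presentation : exists (K : fieldType) (n : nat)
    (fs : seq (mpseries n K)) (th : {rmorphism A -> quot [set` fs]}),
  [/\ regular_sequence fs,
      (forall N a, ideal_exp m N a <-> ideal_exp (qmax [set` fs]) N (th a)),
      (forall N x, exists a, ideal_exp (qmax [set` fs]) N (x - th a)) &
      exists sg : {rmorphism K -> k}, forall y, exists c, sg c = y].
Proof.
have [nA [M MP]] := locA; have mE := local_maxideal MP.
have mP : forall I, is_maximal_ideal I <-> I = m by rewrite /m mE.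
have [im m1 _] : is_maximal_ideal m by apply/mP.
have [ys mys] := nA m im.
have mV a : ~ m a -> exists b, m (a * b - 1).
  move=> /(local_unit nA mP)[b ab]; exists b; rewrite ab subrr; exact: (ideal0 im).
have [K [n [fs [reg [phi phib]]]]] := ciA.
have G1 : ~ ideal_gen [set` fs] 1 by case: reg.
have te := theta_exp im m1 mV mys G1 phib; have td := theta_dense im m1 mV mys G1 phib.
exists K, n, fs, (theta phi); split=> //.
have [tau taub] := resA.
exact: (EmbeddingDimension.residue_rmorphism mP te td taub).
Qed.

Hypotheses (pk : p \in [pchar k]) (p2 : (2 < p)%N) (singA : ~ regular A).
Hypothesis dimA : is_krull_dim A d.+1.

(** If the linear parts had rank size fs, then A would be regular by
   maxideal_generators; so the rank is at most w = size fs - 1, and n = w + (d + 2)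
   leaves room for the quadric in d + 2 variables. *)
Lemma hs_length_bounds : exists n C,
  hs_bounds n C p d (hs_length A) (hs_length (quadric k d.+1)).
Proof.
have [K [n [fs [th [reg te td [sg sgs]]]]]] := complete_intersection_presentation.
have [nA [M MP]] := locA; have mE := local_maxideal MP.
have mP : forall I, is_maximal_ideal I <-> I = m by rewrite /m mE.
have G1 : ~ ideal_gen [set` fs] 1 by case: reg.
have pK : p \in [pchar K].
  rewrite inE (pcharf_prime pk); apply/eqP/(fmorph_inj sg).
  by rewrite rmorph_nat rmorph0; apply: pcharf0.
have two : 2%:R != 0 :> K.
  by rewrite -(dvdn_pcharf pK); apply/negP => /(dvdn_leq (isT : 0 < 2)%N); rewrite leqNgt p2.
have cn : (size fs <= n)%N.
  by have [] := growth_regular_sequence reg.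
have nE := complete_intersection_dim pK cn G1 nA mP te td reg dimA.
have dE : (n - size fs = d.+1)%N by rewrite [X in (X - _)%N]nE addKn.
have aE N q : hs_length A N q = cdim (@cst n K) (ideal_add (ideal_gen [set` fs]) (hsE N q)).
  exact: (length_hsS mP G1 te td).
have fsG i : (i < size fs)%N -> ideal_gen [set` fs] fs`_i.
  by move=> ic; apply: sub_ideal_gen; apply: (mem_nth 0 ic).
have rank_lt (F : finType) (f : F -> mpseries n K) : (forall o, ideal_gen [set` fs] (f o)) ->
    \rank (Comparison.linear_part f) <> size fs.
  move=> fG rk; apply: singA.
  have [s [sz sm]] := EmbeddingDimension.maxideal_generators nA mP G1 te td fG.
  exists s; rewrite sm; split=> //.
  by rewrite sz rk dE (krull_dimE dimA).
have [C1 up] := hsS_upper nA mP te td dimA.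
have [C2 lay] := hsS_layer nA mP G1 te td dimA erefl.
have [w E] : exists w, (size fs = w.+1)%N.
  case E : (size fs) => [|w]; last by exists w.
  exfalso; apply: (@rank_lt 'I_0 (fun _ => 0)).
    by move=> o; apply: (ideal0 (ideal_gen_ideal _)).
  have := rank_leq_row (Comparison.linear_part (fun _ : 'I_0 => 0 : mpseries n K)).
  by rewrite [X in (_ <= X)%N]card_ord leqn0 E => /eqP.
have le N e : (hs_length (quadric k d.+1) N (p ^ e) <= hs_length A N (p ^ e))%N.
  rewrite (hs_length_quadric_along _ _ _ sgs) aE.
  pose fo (o : option 'I_w) := if o is Some i then fs`_i.+1 else fs`_0.
  have foG o : ideal_gen [set` fs] (fo o).
    by case: o => [i|]; apply: fsG; rewrite E // ltnS.
  have fo1 o : ordge 1 (fo o) by apply: (gen_sub_ordge1 G1).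
  have rk : (\rank (Comparison.linear_part fo) <= w)%N.
    have := rank_leq_row (Comparison.linear_part fo).
    rewrite [X in (_ <= X)%N]card_option card_ord leq_eqVlt => /predU1P[|//].
    by rewrite -E => /(rank_lt _ _ foG).
  have nw : (n = w + d.+2)%N by rewrite nE E addSnnS.
  have H : (cdim (@cst n K) (adjf (hsE N (p ^ e)) fo) <=
      cdim (@cst n K) (ideal_add (ideal_gen [set` fs]) (hsE N (p ^ e))))%N.
    apply: cdimS; [exact/ideal_subspace/adjf_ideal/hsE_ideal| |exact: fincodim_hsS].
    apply: ideal_add_sub; first exact/adjf_ideal/hsE_ideal; last exact: sub_adjf.
    apply: ideal_gen_sub; first exact/adjf_ideal/hsE_ideal.
    move=> x /= /(nthP 0)[[|i] ic <-].
      exact: (mem_adjf fo None (@hsE_ideal n K N (p ^ e))).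
    rewrite E ltnS in ic; exact: (mem_adjf fo (Some (Ordinal ic)) (@hsE_ideal n K N (p ^ e))).
  apply: leq_trans H; move: fo fo1 rk {foG}; rewrite nw => fo fo1 rk.
  exact: (Comparison.cdim_quadric_series sgs N e pK two fo1 rk).
exists (n + d.+2)%N, (C1 + C2)%N; split=> //.
- by move=> N N' q NN; rewrite !aE; apply: hsS_mono.
- by move=> N N' q NN; rewrite !hs_length_quadric; apply: hsS_mono.
- move=> N N' q NN; rewrite !aE -dE; apply: hsS_frob => //.
  by apply: leq_trans NN; rewrite leq_mul2r leq_add2l leq_addr orbT.
- move=> N N' q NN; rewrite !hs_length_quadric.
  apply: (@hsS_frob d.+2 p k [:: _] pk) => //.
  by apply: leq_trans NN; rewrite leq_mul2r leq_add2l leq_addl orbT.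
- move=> q q0; rewrite hs_length_quadric; apply: hsS_one => //; exact: quadric_proper.
- by move=> q; rewrite aE hsS_zero.
- by move=> N q; rewrite !aE; apply: leq_trans (lay N q) _; rewrite leq_add2l leq_mul2r leq_addl orbT.
- by move=> N q; rewrite aE; apply: leq_trans (up N q) _; rewrite leq_mul2r leq_addr orbT.
Qed.
End LocalSetup.

(** * Growth along the powers of Frobenius *)

Section HsGrowth.
Variables (n C p d : nat) (a b : nat -> nat -> nat).
Hypotheses (p1 : (1 < p)%N) (ab : hs_bounds n C p d a b).
Variables (N : nat -> nat) (T : nat).
Hypotheses (Np : forall e, (p * N e < N e.+1 + p)%N)
  (NT : forall e, (N e <= T * p ^ e)%N) (Nlarge : forall M, exists e, (M < N e)%N).

Notation D := (2 * n + 2)%N.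

(** Lowering the exponents N e by the constant D compensates for the rounding in N e
   and for the shift by n in hsb_frobl, so that the Frobenius step applies exactly; 2
   n + 2 is enough for every p > 1. *)
Definition hs_core (u : nat -> nat -> nat) e := u (N e - D)%N (p ^ e)%N.

Let Dstep e : (D <= N e)%N -> ((N e - D + n) * p <= N e.+1 - D)%N.
Proof.
by move=> DN; have := Np e; move: (subnK DN); set M := (N e - D)%N => <-; nia.
Qed.

Lemma hs_core_step (u : nat -> nat -> nat) : (forall e, u 0 (p ^ e) = 0)%N ->
  (forall M M' q, ((M + n) * p <= M')%N -> (p ^ d.+1 * u M q <= u M' (q * p))%N) ->
  forall e, (p ^ d.+1 * hs_core u e <= hs_core u e.+1)%N.
Proof.
move=> u0 uf e; rewrite /hs_core; have [DN|/ltnW/eqP ->] := leqP D (N e).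
  by rewrite [(p ^ e.+1)%N]expnSr; apply: uf; apply: Dstep.
by rewrite u0 muln0.
Qed.

Lemma hs_corel_step e : (p ^ d.+1 * hs_core a e <= hs_core a e.+1)%N.
Proof.
apply: hs_core_step => [e'|M M' q]; [exact: hsb_zero ab _|exact: (hsb_frobl ab)].
Qed.

Lemma hs_corer_step e : (p ^ d.+1 * hs_core b e <= hs_core b e.+1)%N.
Proof.
apply: hs_core_step => [e'|M M' q]; last exact: (hsb_frobr ab).
by apply/eqP; rewrite -leqn0; have := hsb_le ab 0 e'; rewrite (hsb_zero ab).
Qed.

Lemma hs_core_le e : (hs_core a e <= a (N e) (p ^ e))%N.
Proof. by apply: (hsb_monol ab); rewrite leq_subr. Qed.

(** Going back from N e - D to N e costs D layers, each of lower order. *)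
Lemma hs_core_ge e :
  (a (N e) (p ^ e) <= hs_core a e + D * C * T.+1 ^ d * p ^ (e * d))%N.
Proof.
have H j : (a (N e) (p ^ e) <= a (N e - j) (p ^ e) + j * C * (N e).+1 ^ d)%N.
  elim: j => [|j IH]; first by rewrite subn0 leq_addr.
  apply: leq_trans IH _; rewrite mulSn mulnDl addnA leq_add2r subnS.
  case E : (N e - j)%N => [|M] /=; first exact: leq_addr.
  apply: leq_trans (hsb_layer ab M (p ^ e)) _; rewrite leq_add2l leq_mul2l.
  by apply/orP; right; apply: expn_leq; rewrite ltnS -E leq_subr.
apply: leq_trans (H D) _; rewrite leq_add2l -[leqRHS]mulnA leq_mul2l; apply/orP; right.
rewrite expnM -expnMn; apply: expn_leq.
by have := NT e; have : (0 < p ^ e)%N by [rewrite expn_gt0 ltnW]; nia.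
Qed.

Lemma hs_upper e : (a (N e) (p ^ e) <= C * T.+1 ^ d.+1 * p ^ (e * d.+1))%N.
Proof.
apply: leq_trans (hsb_upper ab _ _) _; rewrite -mulnA leq_mul2l; apply/orP; right.
rewrite expnM -expnMn; apply: expn_leq.
by have := NT e; have : (0 < p ^ e)%N by [rewrite expn_gt0 ltnW]; nia.
Qed.

Lemma hs_lower : exists e0, forall e,
  (p ^ (e * d.+1) <= b (N (e0 + e)) (p ^ (e0 + e)))%N.
Proof.
have [e0 De] := Nlarge D; exists e0 => e.
have {De} : (0 < hs_core b e0)%N.
  apply: leq_trans (hsb_one ab (_ : 0 < p ^ e0)%N) _; first by rewrite expn_gt0 ltnW.
  by apply: (hsb_monor ab); rewrite subn_gt0.
move=> c0; suff H : (p ^ (e * d.+1) <= hs_core b (e0 + e))%N.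
  by apply: leq_trans H _; apply: (hsb_monor ab); rewrite leq_subr.
elim: e => [|e IH]; first by rewrite addn0.
rewrite mulSn expnD addnS; apply: leq_trans (hs_corer_step _).
by rewrite leq_mul2l IH orbT.
Qed.
End HsGrowth.

From mathcomp Require Import all_classical all_reals all_analysis.
Import numFieldNormedType.Exports.

(** * Limits of normalized lengths *)

Section CeilGrowth.
Variables (R : realType) (s : R) (p : nat).
Hypotheses (s0 : 0 < s) (p1 : (1 < p)%N).

Definition hs_exponent (e : nat) : nat := `|Num.ceil (s * (p ^ e)%:R)|%N.

Let spe_gt0 e : 0 < s * (p ^ e)%:R.
Proof. by rewrite mulr_gt0 // ltr0n expn_gt0 ltnW. Qed.

Lemma hs_exponentE e : (hs_exponent e)%:R = (Num.ceil (s * (p ^ e)%:R))%:~R :> R.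
Proof. by rewrite /hs_exponent natr_absz ger0_norm // ltW // ceil_gt0. Qed.

Lemma hs_exponent_ge e : s * (p ^ e)%:R <= (hs_exponent e)%:R.
Proof. by rewrite hs_exponentE ceil_ge. Qed.

Lemma hs_exponent_lt e : (hs_exponent e)%:R < s * (p ^ e)%:R + 1.
Proof. by rewrite hs_exponentE; have := ceilB1_lt (s * (p ^ e)%:R); rewrite rmorphB ltrBlDr. Qed.

Lemma hs_exponentS e : (p * hs_exponent e < hs_exponent e.+1 + p)%N.
Proof.
rewrite -(ltr_nat R) natrM natrD; apply: lt_le_trans (_ : p%:R * (s * (p ^ e)%:R + 1) <= _).
  by rewrite ltr_pM2l ?hs_exponent_lt // ltr0n ltnW.
by rewrite mulrDr mulr1 mulrCA -natrM -expnS lerD2r hs_exponent_ge.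
Qed.

(** By rounding up s first, since s p^e is at most the integer ceil s * p^e. *)
Lemma hs_exponent_upper e : (hs_exponent e <= hs_exponent 0 * p ^ e)%N.
Proof.
rewrite -ltnS -(ltr_nat R); apply: lt_le_trans (hs_exponent_lt e) _.
rewrite -natr1 lerD2r natrM ler_wpM2r //.
by have := hs_exponent_ge 0; rewrite expn0 mulr1.
Qed.

Lemma hs_exponent_unbounded M : exists e, (M < hs_exponent e)%N.
Proof.
pose e := `|Num.ceil (M.+1%:R / s)|%N; exists e.
rewrite -(ltr_nat R); apply: lt_le_trans (hs_exponent_ge e).
have le : M.+1%:R / s <= e%:R.
  by rewrite /e natr_absz ger0_norm ?ceil_ge // ceil_ge0 (lt_le_trans (ltrN10 _)) // divr_ge0 // ltW.
have lt : M.+1%:R <= s * (p ^ e)%:R.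
  rewrite mulrC -ler_pdivrMr //; apply: le_trans le _.
  by rewrite ler_nat ltnW // ltn_expl.
by apply: lt_le_trans lt; rewrite ltr_nat.
Qed.
End CeilGrowth.

Section HsLimit.
Variables (R : realType) (n C p d : nat) (a b : nat -> nat -> nat).
Hypotheses (p1 : (1 < p)%N) (ab : hs_bounds n C p d a b).
Variables (N : nat -> nat) (T : nat).
Hypotheses (Np : forall e, (p * N e < N e.+1 + p)%N)
  (NT : forall e, (N e <= T * p ^ e)%N) (Nlarge : forall M, exists e, (M < N e)%N).

Definition hs_ratio (u : nat -> nat) (dim e : nat) : R := (u e)%:R / (p ^ (e * dim))%:R.
Notation ratio_a := (hs_ratio (fun e => a (N e) (p ^ e)) d.+1).
Notation ratio_b := (hs_ratio (fun e => b (N e) (p ^ e))).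

Let pe0 e : (0 : R) < (p ^ e)%:R. Proof. by rewrite ltr0n expn_gt0 ltnW. Qed.

Let geo0 : ((p ^ e)%:R^-1 : R) @[e --> \oo] --> (0 : R).
Proof.
have := @cvg_geometric R 1 p%:R^-1; rewrite ger0_norm ?invr_ge0 //.
rewrite invf_lt1 ?ltr1n ?ltr0n ?(ltnW p1) // => /(_ p1).
suff -> : (fun e => (p ^ e)%:R^-1) = geometric 1 (p%:R^-1 : R) by [].
by apply/funext => e; rewrite /geometric /= mul1r exprVn natrX.
Qed.

(** The core sequence is nondecreasing and bounded after normalization, and differs
   from the sequence itself by O(p^-e). *)
Lemma hs_ratio_a_cvg : cvg (ratio_a @ \oo).
Proof.
pose nu := hs_ratio (hs_core n p N a) d.+1.
have cnu : cvg (nu @ \oo).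
  apply: nondecreasing_is_cvgn.
    apply/nondecreasing_seqP => e; rewrite /nu /hs_ratio ler_pdivlMr // mulrAC ler_pdivrMr //.
    rewrite -!natrM ler_nat mulSn [(p ^ (_ + _))%N]expnD mulnA leq_mul2r; apply/orP; right.
    by rewrite mulnC (hs_corel_step p1 ab Np).
  exists (C * T.+1 ^ d.+1)%:R => _ [e _ <-]; rewrite /nu /hs_ratio ler_pdivrMr // -natrM ler_nat.
  exact: leq_trans (hs_core_le ab N e) (hs_upper p1 ab NT e).
pose B := ((2 * n + 2) * C * T.+1 ^ d)%N.
have c0 : (ratio_a e - nu e) @[e --> \oo] --> (0 : R).
  apply: (@squeeze_cvgr _ _ _ _ (fun _ => 0) (fun e => B%:R * (p ^ e)%:R^-1)).
  - near=> e; rewrite /nu /hs_ratio -mulrBl; apply/andP; split.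
      by rewrite divr_ge0 // subr_ge0 ler_nat (hs_core_le ab).
    rewrite ler_pdivrMr // mulnS expnD natrM mulrA mulfVK ?gt_eqF // lerBlDl -natrM -natrD ler_nat.
    exact: (hs_core_ge p1 ab NT).
  - exact: cvg_cst.
  - by rewrite -[X in _ --> X](mulr0 B%:R); apply: cvgM => //; exact: cvg_cst.
have -> : ratio_a = (fun e => (ratio_a e - nu e) + nu e) by apply/funext => e; rewrite subrK.
by apply: is_cvgD => //; apply/cvg_ex; exists 0.
Unshelve. all: by end_near.
Qed.

Lemma hs_ratio_b_lower : exists2 c : R, 0 < c & \forall e \near \oo, c <= ratio_b d.+1 e.
Proof.
have [e0 low] := hs_lower p1 ab Np Nlarge.
exists (p ^ (e0 * d.+1))%:R^-1; first by rewrite invr_gt0.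
exists e0 => // e /= le; rewrite -(subnKC le) ler_pdivlMr // mulrC ler_pdivrMr //.
rewrite -natrM ler_nat mulnDl expnD mulnC leq_mul2r; apply/orP; right; exact: low.
Qed.

Lemma hs_ratio_b_upper e : ratio_b d.+1 e <= (C * T.+1 ^ d.+1)%:R.
Proof.
rewrite /hs_ratio ler_pdivrMr // -natrM ler_nat.
exact: leq_trans (hsb_le ab _ _) (hs_upper p1 ab NT e).
Qed.

Lemma hs_ratio_a_lim_ge0 : 0 <= lim (ratio_a @ \oo).
Proof. by apply: limr_ge hs_ratio_a_cvg _; near=> e; rewrite divr_ge0. Unshelve. all: by end_near. Qed.

(** When the left-hand sequence diverges, its lim is the default value 0. *)
Lemma hs_ratio_b_lim : lim (ratio_b d.+1 @ \oo) <= lim (ratio_a @ \oo).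
Proof.
have [cb|/dvgP -> //] := pselect (cvg (ratio_b d.+1 @ \oo)); last exact: hs_ratio_a_lim_ge0.
apply: ler_lim => //; first exact: hs_ratio_a_cvg.
by near=> e; rewrite ler_pM2r ?invr_gt0 // ler_nat (hsb_le ab).
Unshelve. all: by end_near.
Qed.

(** The lengths of the quadric are of exact order p^(e (d + 1)). With a larger
   exponent the ratio tends to 0; with a smaller one it is unbounded, and the lim of a
   divergent sequence is 0. *)
Lemma hs_ratio_b_lim_eq0 d' : d' <> d.+1 -> lim (ratio_b d' @ \oo) = 0.
Proof.
move=> /eqP; rewrite neq_ltn => /orP[lt|lt]; last first.
  apply/cvg_lim => //; have := @squeeze_cvgr _ _ _ _ (fun _ => 0 : R)
    (fun e => (C * T.+1 ^ d.+1)%:R * (p ^ e)%:R^-1) (ratio_b d').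
  apply; last 2 first.
  - exact: cvg_cst.
  - by rewrite -[X in _ --> X](mulr0 (C * T.+1 ^ d.+1)%:R); apply: cvgM => //; exact: cvg_cst.
  near=> e; rewrite divr_ge0 //=.
  have le : ratio_b d' e <= ratio_b d.+1 e * (p ^ e)%:R^-1.
    rewrite /hs_ratio -mulrA -invfM -natrM -expnD ler_wpM2l // lef_pV2 ?posrE // ler_nat.
    by rewrite leq_exp2l // -mulnSr leq_mul2l lt orbT.
  by apply: le_trans le _; rewrite ler_wpM2r // ?invr_ge0 // hs_ratio_b_upper.
have [cb|/dvgP -> //] := pselect (cvg (ratio_b d' @ \oo)).
exfalso; have [c c0 low] := hs_ratio_b_lower.
have lim0 : (ratio_b d' e * (p ^ e)%:R^-1) @[e --> \oo] --> (0 : R).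
  by rewrite -[X in _ --> X](mulr0 (lim (ratio_b d' @ \oo))); apply: cvgM.
have : c <= 0.
  apply: (cvgr_to_ge lim0); near=> e; apply: (@le_trans _ _ (ratio_b d.+1 e)).
    by near: e.
  rewrite /hs_ratio -mulrA -invfM -natrM -expnD ler_wpM2l // lef_pV2 ?posrE // ler_nat.
  by rewrite leq_exp2l // -mulnSr leq_mul2l lt orbT.
by rewrite leNgt c0.
Unshelve. all: by end_near.
Qed.
End HsLimit.

(** * Positivity of the normalizing constant *)

Section CalHNonneg.
Variable R : realType.
Implicit Types (s x : R) (m : nat).

Definition pospart x : R := Num.max x 0.

(** Up to the factor m!, the volume of the points of the unit cube of dimension m
   whose coordinates have sum at most s. Writing it with truncated powers makes the
   range of summation independent of s. *)
Definition alt_powers m s : R :=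
  \sum_(i < m.+1) (-1) ^+ i * 'C(m, i)%:R * pospart (s - i%:R) ^+ m.

Lemma pospart_le0 x : x <= 0 -> pospart x = 0. Proof. exact: max_r. Qed.
Lemma pospart_ge0 x : 0 <= x -> pospart x = x. Proof. exact: max_l. Qed.

Lemma pospartS x m : (0 < m)%N -> pospart x ^+ m.+1 = x * pospart x ^+ m.
Proof.
move=> m0; have [x0|/ltW x0] := leP 0 x; first by rewrite exprS pospart_ge0.
by rewrite pospart_le0 // !expr0n (gtn_eqF m0) /= mulr0n mulr0.
Qed.

(** The recurrence for the integrals of B-splines, from (s - i) C(m+1, i) = s C(m, i)
   - (m + 1 - s) C(m, i - 1). *)
Lemma alt_powersS m s : (0 < m)%N ->
  alt_powers m.+1 s = s * alt_powers m s + (m.+1%:R - s) * alt_powers m (s - 1).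
Proof.
move=> m0; pose t i : R := pospart (s - i%:R) ^+ m.
have E1 : alt_powers m s = t 0 + \sum_(i < m.+1) (-1) ^+ i.+1 * 'C(m, i.+1)%:R * t i.+1.
  transitivity (\sum_(i < m.+2) (-1) ^+ i * 'C(m, i)%:R * t i).
    by rewrite [RHS]big_ord_recr /= bin_small // mulr0n mulr0 mul0r addr0.
  rewrite big_ord_recl /= expr0 bin0 !mul1r; congr (_ + _).
have E2 : alt_powers m (s - 1) = \sum_(i < m.+1) (-1) ^+ i * 'C(m, i)%:R * t i.+1.
  by apply: eq_bigr => i _; rewrite /t -addrA -opprD -natr1 [1 + _]addrC.
have -> : alt_powers m.+1 s = s * t 0 +
    \sum_(i < m.+1) (-1) ^+ i.+1 * 'C(m.+1, i.+1)%:R * ((s - i.+1%:R) * t i.+1).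
  rewrite /alt_powers big_ord_recl /= expr0 bin0 !mul1r pospartS // subr0.
  congr (_ + _); first by rewrite /t subr0.
  by apply: eq_bigr => i _; rewrite pospartS.
rewrite E1 E2 mulrDr -addrA; congr (_ + _); rewrite !mulr_sumr -big_split.
apply: eq_bigr => i _ /=.
have B : m.+1%:R * 'C(m, i)%:R = i.+1%:R * 'C(m.+1, i.+1)%:R :> R.
  by rewrite -!natrM mul_bin_diag.
have B' : 'C(m.+1, i.+1)%:R = 'C(m, i.+1)%:R + 'C(m, i)%:R :> R by rewrite binS natrD.
rewrite exprS mulN1r; move: (t _) ((-1) ^+ i) => u e.
have -> : - e * 'C(m.+1, i.+1)%:R * ((s - i.+1%:R) * u) =
  (- e * u) * (s * 'C(m.+1, i.+1)%:R - i.+1%:R * 'C(m.+1, i.+1)%:R) by ring.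
rewrite -B B'; ring.
Qed.

Lemma alt_powers_le0 m s : (0 < m)%N -> s <= 0 -> alt_powers m s = 0.
Proof.
move=> m0 s0; rewrite /alt_powers big1 // => i _; rewrite pospart_le0 ?expr0n ?gtn_eqF //= ?mulr0n ?mulr0 //.
by rewrite subr_le0 (le_trans s0).
Qed.

Lemma alt_powers1 s : alt_powers 1 s = pospart s - pospart (s - 1).
Proof. by rewrite /alt_powers !big_ord_recl big_ord0 /=; rewrite !expr1 /= subr0 binn bin0 expr0 addr0 !mul1r mulr1 mulN1r. Qed.

Lemma alt_powers_ge m s : (0 < m)%N -> m%:R <= s -> alt_powers m s = m`!%:R.
Proof.
case: m => [//|m] _; elim: m s => [|m IH] s ms.
  rewrite alt_powers1 !pospart_ge0 ?subr_ge0 //; last exact: le_trans ms.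
  by rewrite opprB addrC subrK.
have ms1 : m.+1%:R <= s - 1 by rewrite lerBrDr natr1.
rewrite alt_powersS // !IH //; last by rewrite (le_trans ms1) // gerBl.
by rewrite -mulrDl [s + _]addrC subrK -natrM -factS.
Qed.

(** The two coefficients of alt_powersS are nonnegative for 0 <= s <= m + 1, and
   outside of this interval the value is known. *)
Lemma alt_powers_ge0 m s : (0 < m)%N -> 0 <= alt_powers m s.
Proof.
case: m => [//|m] _; elim: m s => [|m IH] s.
  by rewrite alt_powers1 subr_ge0 /pospart ge_max !le_max lexx orbT andbT gerBl ler01.
have [s0|/ltW s0] := leP s 0; first by rewrite alt_powers_le0.
have [ms|/ltW ms] := leP m.+2%:R s; first by rewrite alt_powers_ge.
by rewrite alt_powersS // addr_ge0 // mulr_ge0 // subr_ge0.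
Qed.

(** The terms with i > d have a zero binomial coefficient, and those with i > s a zero
   truncated power, so both sums may be extended to a common range. *)
Lemma calHE s d : 0 < s -> (0 < d)%N -> calH s d = alt_powers d s / d`!%:R.
Proof.
move=> s0 d0; pose M := (`|Num.floor s| + d).+1.
pose F i : R := (-1) ^+ i * 'C(d, i)%:R * pospart (s - i%:R) ^+ d.
have fE : (`|Num.floor s|%N%:R : R) = (Num.floor s)%:~R.
  by rewrite natr_absz ger0_norm // floor_ge0 ltW.
have -> : alt_powers d s = \sum_(0 <= i < M) F i.
  rewrite (@big_cat_nat _ _ _ d.+1) ?ltnS ?leq_addl //= big_mkord.
  rewrite [X in _ = _ + X]big_nat_cond [X in _ = _ + X]big1 ?addr0 // => i.
  by rewrite andbT => /andP[di _]; rewrite /F bin_small // mulr0n mulr0 mul0r.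
rewrite /calH (@big_cat_nat _ _ _ `|Num.floor s|.+1 0 M) ?ltnS ?leq_addr //=.
rewrite [X in _ = (_ + X) / _]big_nat_cond [X in _ = (_ + X) / _]big1 ?addr0 => [|i]; last first.
  rewrite andbT => /andP[fi _]; rewrite /F pospart_le0 ?expr0n ?gtn_eqF ?mulr0 //.
  rewrite subr_le0 ltW //; apply: lt_le_trans (_ : `|Num.floor s|.+1%:R <= _); last by rewrite ler_nat.
  by rewrite -natr1 fE; have /andP[_] := floor_itv s; rewrite rmorphD.
rewrite mulr_suml !big_nat; apply: eq_bigr => i /andP[_ fi].
rewrite /F pospart_ge0 ?subr_ge0; first by ring.
have /andP[h _] := floor_itv s; apply: le_trans h; rewrite -fE ler_nat; exact: fi.
Qed.

Lemma calH_ge0 s d : 0 < s -> (0 < d)%N -> 0 <= calH s d.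
Proof. by move=> s0 d0; rewrite calHE // divr_ge0 // alt_powers_ge0. Qed.
End CalHNonneg.

(** * The comparison of s-multiplicities *)

Theorem corollary4p8 (R : realType) (d p : nat) (k : fieldType)
    (A : comNzRingType) (hd : (2 <= d)%N)
    (hpk : p \in [pchar k]) (hp2 : (2 < p)%N)
    (hloc : noetherian_local A) (hsing : ~ regular A)
    (hci : complete_intersection A)
    (hpA : p \in [pchar A]) (hdim : is_krull_dim A d)
    (hres : has_residue_field A k) :
  forall s : R, 0 < s -> e_s_ring A p s >= e_s_ring (quadric k d) p s.
Proof.
move=> s s0; case: d hd hdim => // d hd hdim.
have p1 : (1 < p)%N by exact: ltnW.
have [n [C ab]] := hs_length_bounds hloc hci hres hpk hp2 hsing hdim.
pose N e := hs_exponent s p e; pose T := hs_exponent s p 0.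
have Np e : (p * N e < N e.+1 + p)%N by apply: hs_exponentS.
have NT e : (N e <= T * p ^ e)%N by apply: hs_exponent_upper.
have NL M : exists e, (M < N e)%N by apply: hs_exponent_unbounded.
rewrite /e_s_ring /e_s (krull_dimE hdim).
have hE (B : comPzRingType) :
  h_s p s (maxideal B) = lim (hs_ratio R p (fun e => hs_length B (N e) (p ^ e)) (krull_dim B) @ \oo) by [].
rewrite !hE (krull_dimE hdim).
have cH := calH_ge0 s0 (isT : (0 < d.+1)%N).
have [->|dq] := pselect (krull_dim (quadric k d.+1) = d.+1).
  by rewrite ler_wpM2r ?invr_ge0 // (hs_ratio_b_lim R p1 ab Np NT).
rewrite (hs_ratio_b_lim_eq0 R p1 ab Np NT NL dq) mul0r divr_ge0 //.
exact: (hs_ratio_a_lim_ge0 R p1 ab Np NT).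
Qed.
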